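(* Let $n$ be a natural number and $p$ a prime with $p\geq n$. Then there is a one-to-one correspondence between the set of isomorphism classes of groups $P$ of order $p^n$ satisfying $\mho_1([P,P])=1$, and the set of isomorphism classes of nilpotent Lie algebras $L$ over the ring $\mathbb{F}_p[T]/(T^n)$ having exactly $p^n$ elements and satisfying $T[L,L]=0$.
   Context: $[P,P]$ denotes the derived (commutator) subgroup of $P$, and for a group $H$, $\mho_1(H)$ is the subgroup generated by all $p$-th powers $h^p$, $h\in H$; so $\mho_1([P,P])=1$ means that $[P,P]$ has exponent dividing $p$. An $\mathbb{F}_p[T]/(T^n)$-Lie algebra is an $\mathbb{F}_p[T]/(T^n)$-module $L$ with a bilinear bracket $[\cdot,\cdot]$ satisfying $[x,x]=0$ and the Jacobi identity; $[L,L]$ is the submodule spanned by all brackets, and $T[L,L]=0$ means $T$ annihilates every bracket. Isomorphisms of such Lie algebras are $\mathbb{F}_p[T]/(T^n)$-linear bijections preserving the bracket. *)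

(* Defs.v *)
From HB Require Import structures.
From mathcomp Require Import all_boot all_order all_algebra all_fingroup all_solvable.
Set Implicit Arguments.
Unset Strict Implicit.
Unset Printing Implicit Defensive.
Import GRing.Theory.
Local Open Scope ring_scope.

Definition truncR (p n : nat) := {poly %/ ('X^n : {poly 'F_p})}.
Definition Tgen (p n : nat) : truncR p n := 'qX.

Definition is_lie_bracket (R : nzRingType) (L : lmodType R) (br : L -> L -> L) :=
  [/\ forall a x y z, br (a *: x + y) z = a *: br x z + br y z,
      forall a x y z, br x (a *: y + z) = a *: br x y + br x z,
      forall x, br x x = 0 &
      forall x y z, br x (br y z) + br y (br z x) + br z (br x y) = 0].

(* Nilpotent: some term L^(k+1) of the lower central series vanishes, i.e.
   all iterated brackets [x_1,[x_2,...,[x_k,y]...]] are zero. *)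
Definition lie_nilpotent (R : nzRingType) (L : lmodType R) (br : L -> L -> L) :=
  exists k : nat, forall (s : seq L) (y : L), size s = k -> foldr br y s = 0.

Record FinLie (p n : nat) := MkFinLie {
  lie_car : finLmodType (truncR p n);
  lie_br : lie_car -> lie_car -> lie_car;
  lie_brP : is_lie_bracket lie_br
}.
Arguments lie_car {p n} f : rename.
Arguments lie_br {p n} f _ _ : rename.

Definition lie_isom (p n : nat) (L M : FinLie p n) (f : lie_car L -> lie_car M) :=
  [/\ bijective f,
      forall (a : truncR p n) x y, f (a *: x + y) = a *: f x + f y &
      forall x y, f (lie_br L x y) = lie_br M (f x) (f y)].
Definition lie_iso (p n : nat) (L M : FinLie p n) :=
  exists f : lie_car L -> lie_car M, lie_isom f.

Definition good_lie (p n : nat) (L : FinLie p n) :=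
  [/\ lie_nilpotent (lie_br L),
      #|lie_car L| = (p ^ n)%N &
      forall x y, Tgen p n *: lie_br L x y = 0].

Definition FinGrp := {gT : finGroupType & {group gT}}.
Definition grp_iso (G H : FinGrp) := (tagged G \isog tagged H)%g.

Definition good_grp (p n : nat) (G : FinGrp) :=
  #|tagged G| = (p ^ n)%N /\ ('Mho^1([~: tagged G, tagged G]) = 1)%g.

Definition iso_class_bijection (p n : nat) :=
  exists (Phi : FinGrp -> FinLie p n) (Psi : FinLie p n -> FinGrp),
    [/\ (forall G, good_grp p n G -> good_lie (Phi G)) /\
        (forall L, good_lie L -> good_grp p n (Psi L)),
        forall G H, good_grp p n G -> good_grp p n H ->
          (grp_iso G H <-> lie_iso (Phi G) (Phi H)),
        forall L M, good_lie L -> good_lie M ->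
          (lie_iso L M <-> grp_iso (Psi L) (Psi M)),
        forall G, good_grp p n G -> grp_iso (Psi (Phi G)) G &
        forall L, good_lie L -> lie_iso (Phi (Psi L)) L].

(* Main.v *)
From HB Require Import structures.
Require Import Defs.
From mathcomp Require Import all_boot all_algebra all_fingroup all_solvable.
From mathcomp Require Import ssrAC.
From Stdlib Require Import Classical ClassicalEpsilon.
Set Implicit Arguments.
Unset Strict Implicit.
Unset Printing Implicit Defensive.
Import GRing.Theory.
Local Open Scope ring_scope.

(** The correspondence is the Lazard correspondence followed by a change of base ring.

Let m = p - 1 and q = p ^ max(n, 1).  A group of order p ^ n with n <= p has class at most m,
and so has a nilpotent Lie algebra of that order.  As 1, ..., m are invertible in Z/q, the
Baker-Campbell-Hausdorff product truncated at length m makes every Z/q-Lie algebra of class at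
most m into a group, and group morphisms are then the same thing as Lie morphisms.  Conversely, a
group G of class at most m and exponent dividing q arises in this way: in the product of the free
truncated exponential group on G with G, the subgroup generated by the pairs (X_g, g) is the graph
of a map from Lie elements to G, along which the Lie operations descend to G.  Under this
correspondence, Mho^1([G, G]) = 1 means p [N, N] = 0.

A Lie bracket on a Z/q-module N with p [N, N] = 0 is a biadditive map from N / pN to the socle
{x | p x = 0}, so it only depends on these two spaces and on the filtrations they inherit.
Over Z/q and over F_p[T]/(T^n), which are chain rings of the same length with the same residue
field, finite modules have the same elementary divisors, and expanding coordinates in base p gives
bijections that turn p into T, are additive on the socle and additive modulo T; these transport
brackets.  Between modules over the same ring, such a bijection can be replaced by a linear
isomorphism with the same effect on the socle and on the quotient modulo the uniformiser, so
isomorphism classes correspond. *)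

(** * Truncated free associative algebras *)

(** The difficulty is to recover addition and bracket from a group law alone, over a ring where only
    1, ..., m can be inverted. Inversion formulas and bases of free Lie algebras are avoided by
    relying on Dynkin's operator: it multiplies a homogeneous Lie element of degree k by k, a unit
    for 0 < k <= m. As a criterion it characterises Lie elements without a coproduct; divided by the
    degree it evaluates them in any Lie algebra of class at most m; and the same identity in the
    graded Lie ring of a group shows that the subgroup of pairs is a graph. For the last point, let
    a pair with trivial first coordinate lie in the k-th term of the lower central series. Dynkin's
    operator vanishes on a combination of commutator words representing it, so k times its class in
    the k-th factor is 0; as the exponent divides q, k is invertible there, and the pair drops to
    the next term. It ends in term m + 1, which projects to 1 in G. The bound n <= p serves only to
    bound the class by m, for groups and for Lie algebras alike. *)

Section Conv.
Variables (R : comNzRingType) (X : Type).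
Implicit Types (f g h : seq X -> R) (w u : seq X).

(** The coefficient at [w] of a product of non-commutative series: the sum of [f u * g v] over all
    factorisations of [w] as [u ++ v]. The recursion absorbs the first letter of [w] into [f]. *)
Fixpoint conv f g w : R :=
  if w is x :: w' then f [::] * g w + conv (fun u => f (x :: u)) g w'
  else f [::] * g [::].

Lemma eq_conv f f' g g' w :
  (forall u, (size u <= size w)%N -> f u = f' u) ->
  (forall u, (size u <= size w)%N -> g u = g' u) -> conv f g w = conv f' g' w.
Proof.
elim: w f f' => [|x w IH] f f' ef eg /=; first by rewrite ef // eg.
by rewrite ef // eg //; congr (_ + _); apply: IH => u hu; [apply: ef | apply: eg; apply: leqW].
Qed.

Lemma conv_linl a f f' g w :
  conv (fun u => a * f u + f' u) g w = a * conv f g w + conv f' g w.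
Proof.
elim: w f f' => [|x w IH] f f' /=; first by rewrite mulrDl mulrA.
by rewrite (IH (fun u => f (x :: u))) mulrDl !mulrDr !mulrA addrACA.
Qed.

Lemma conv_linr a f g g' w :
  conv f (fun u => a * g u + g' u) w = a * conv f g w + conv f g' w.
Proof.
elim: w f => [|x w IH] f /=; first by rewrite mulrDr mulrCA.
by rewrite IH !mulrDr mulrCA addrACA.
Qed.

Lemma convA f g h w : conv f (conv g h) w = conv (conv f g) h w.
Proof.
elim: w f g => [|x w IH] f g /=; first by rewrite mulrA.
by rewrite conv_linl IH mulrDr -!addrA mulrA.
Qed.

Lemma conv1l f w : conv (fun u => (nilp u)%:R) f w = f w.
Proof.
have z g v : conv (fun=> 0) g v = 0.
  by elim: v => [|y v IH] /=; rewrite mul0r // add0r IH.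
by case: w => [|x w] /=; rewrite mul1r // z addr0.
Qed.

Lemma conv1r f w : conv f (fun u => (nilp u)%:R) w = f w.
Proof. by elim: w f => [|x w IH] f /=; rewrite ?mulr1 // mulr0 add0r IH. Qed.

Lemma conv_ge i j f g w :
  (forall u, (size u < i)%N -> f u = 0) -> (forall u, (size u < j)%N -> g u = 0) ->
  (size w < i + j)%N -> conv f g w = 0.
Proof.
elim: w i f => [|x w IH] [|i] f hf hg hw /=.
- by rewrite hg ?mulr0.
- by rewrite hf ?mul0r.
- rewrite hg ?mulr0 ?add0r //; apply: (IH 0) => //=; exact: ltnW.
by rewrite hf // mul0r add0r; apply: (IH i) => // u hu; apply: hf.
Qed.

End Conv.

(* Polynomials in the non-commuting variables X modulo words of length greater than m. *)
Definition fra (R : finComUnitRingType) (m : nat) (X : finType) :=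
  {ffun {bseq m of X} -> R^o}.
HB.instance Definition _ R m X := GRing.Lmodule.on (fra R m X).
HB.instance Definition _ R m X := Finite.on (fra R m X).

(** Reading coefficients at arbitrary words, with value 0 beyond length m, keeps the length bound
    out of most statements. *)
Definition fcoef (R : finComUnitRingType) m (X : finType) (f : fra R m X) (w : seq X) : R :=
  if insub w is Some v then (f : {ffun _ -> _}) v else 0.

Definition fmk (R : finComUnitRingType) m (X : finType) (F : seq X -> R) : fra R m X := [ffun v : {bseq m of X} => F v].
Arguments fmk {R} m {X} F.

HB.lock Definition fmul (R : finComUnitRingType) m (X : finType) (f g : fra R m X) : fra R m X := fmk m (conv (fcoef f) (fcoef g)).

Section Fra.
Variables (R : finComUnitRingType) (m : nat) (X : finType).
Local Notation A := (fra R m X).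
Implicit Types (f g h : A) (w u : seq X).

Lemma fcoef_val f (v : {bseq m of X}) : fcoef f v = (f : {ffun _ -> _}) v.
Proof. by rewrite /fcoef valK. Qed.

Lemma fcoef_big f w : (m < size w)%N -> fcoef f w = 0.
Proof. by move=> hw; rewrite /fcoef insubN // -ltnNge. Qed.

Lemma fcoef_mk (F : seq X -> R) w : (size w <= m)%N -> fcoef (fmk m F) w = F w.
Proof. by move=> hw; rewrite /fcoef insubT ffunE. Qed.

Lemma fcoefP f g : (forall w, (size w <= m)%N -> fcoef f w = fcoef g w) -> f = g.
Proof.
by move=> h; apply/ffunP => v; rewrite -!fcoef_val; apply: h; apply: size_bseq.
Qed.

Lemma fcoef_lin a f g w : fcoef (a *: f + g) w = a * fcoef f w + fcoef g w.
Proof.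
rewrite /fcoef; case: insubP => [v _ _|_]; last by rewrite mulr0 addr0.
by rewrite !ffunE.
Qed.
Lemma fcoefZ a f w : fcoef (a *: f) w = a * fcoef f w.
Proof. by rewrite -[a *: f]addr0 fcoef_lin [fcoef (0 : A) w](_ : _ = 0) ?addr0 // /fcoef; case: insubP => // v _ _; rewrite ffunE. Qed.
Lemma fcoefD f g w : fcoef (f + g) w = fcoef f w + fcoef g w.
Proof. by rewrite -[f]scale1r fcoef_lin scale1r mul1r. Qed.
Lemma fcoef0 w : fcoef (0 : A) w = 0.
Proof. by rewrite -(scale0r (0 : A)) fcoefZ mul0r. Qed.
Lemma fcoefN f w : fcoef (- f) w = - fcoef f w.
Proof. by rewrite -scaleN1r fcoefZ mulN1r. Qed.
Lemma fcoefB f g w : fcoef (f - g) w = fcoef f w - fcoef g w.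
Proof. by rewrite fcoefD fcoefN. Qed.

Lemma fcoef_mul f g w : (size w <= m)%N -> fcoef (fmul f g) w = conv (fcoef f) (fcoef g) w.
Proof. by move=> hw; rewrite fmul.unlock fcoef_mk. Qed.
Definition fone : A := fmk m (fun u => (nilp u)%:R).

Lemma fmulA : associative (@fmul R m X).
Proof.
move=> f g h; apply: fcoefP => w hw; rewrite !fcoef_mul //.
transitivity (conv (fcoef f) (conv (fcoef g) (fcoef h)) w).
  by apply: eq_conv => // u hu; rewrite fcoef_mul // (leq_trans hu).
by rewrite convA; apply: eq_conv => // u hu; rewrite fcoef_mul // (leq_trans hu).
Qed.

Lemma fmul1 : left_id fone (@fmul R m X).
Proof.
move=> f; apply: fcoefP => w hw; rewrite fcoef_mul // -[RHS]conv1l.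
by apply: eq_conv => // u hu; rewrite fcoef_mk // (leq_trans hu).
Qed.
Lemma f1mul : right_id fone (@fmul R m X).
Proof.
move=> f; apply: fcoefP => w hw; rewrite fcoef_mul // -[RHS]conv1r.
by apply: eq_conv => // u hu; rewrite fcoef_mk // (leq_trans hu).
Qed.
Lemma fmul_linl a f g h : fmul (a *: f + g) h = a *: fmul f h + fmul g h.
Proof.
apply: fcoefP => w hw; rewrite fcoef_lin !fcoef_mul // -conv_linl.
by apply: eq_conv => // u _; rewrite fcoef_lin.
Qed.
Lemma fmul_linr a f g h : fmul h (a *: f + g) = a *: fmul h f + fmul h g.
Proof.
apply: fcoefP => w hw; rewrite fcoef_lin !fcoef_mul // -conv_linr.
by apply: eq_conv => // u _; rewrite fcoef_lin.
Qed.
Lemma fmulDl : left_distributive (@fmul R m X) +%R.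
Proof. by move=> f g h; rewrite -[f]scale1r fmul_linl !scale1r. Qed.
Lemma fmulDr : right_distributive (@fmul R m X) +%R.
Proof. by move=> h f g; rewrite -[f]scale1r fmul_linr !scale1r. Qed.
Lemma fone_neq0 : fone != 0.
Proof.
apply/eqP => /(congr1 (fun f : A => fcoef f [::])); rewrite fcoef0 fcoef_mk //=; move/eqP.
by rewrite oner_eq0.
Qed.
HB.instance Definition _ := GRing.Zmodule_isNzRing.Build A fmulA fmul1 f1mul fmulDl fmulDr fone_neq0.

Lemma fmul_scaleAl a f g : a *: (f * g) = (a *: f) * g.
Proof. by rewrite -[a *: f]addr0 [RHS](fmul_linl a f 0 g) -[fmul 0 g]/(0 * g) mul0r addr0. Qed.
Lemma fmul_scaleAr a f g : a *: (f * g) = f * (a *: g).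
Proof. by rewrite -[a *: g]addr0 [RHS](fmul_linr a g 0 f) -[fmul f 0]/(f * 0) mulr0 addr0. Qed.
HB.instance Definition _ := GRing.Lmodule_isLalgebra.Build R A fmul_scaleAl.
HB.instance Definition _ := GRing.Lalgebra_isAlgebra.Build R A fmul_scaleAr.

End Fra.

Section Words.
Variables (R : finComUnitRingType) (m : nat) (X : finType).
Local Notation A := (fra R m X).
Implicit Types (f g h : A) (w u v : seq X).

Lemma fcoefM f g w :
  (size w <= m)%N -> fcoef (f * g) w = conv (fcoef f) (fcoef g) w.
Proof. exact: fcoef_mul. Qed.

Lemma fcoef1 w : (size w <= m)%N -> fcoef (1 : A) w = (nilp w)%:R.
Proof. exact: fcoef_mk. Qed.

Lemma fcoefM_nil f g : fcoef (f * g) [::] = fcoef f [::] * fcoef g [::].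
Proof. by rewrite fcoefM. Qed.

Definition wd w : A := fmk m (fun u => (u == w)%:R).

Lemma fcoef_wd w u : fcoef (wd w) u = ((u == w) && (size u <= m)%N)%:R.
Proof.
case: (leqP (size u) m) => hu; first by rewrite fcoef_mk // andbT.
by rewrite fcoef_big // andbF.
Qed.

Lemma wd_big w : (m < size w)%N -> wd w = 0.
Proof.
move=> hw; apply: fcoefP => u hu; rewrite fcoef_wd fcoef0 hu andbT.
by case: eqP => // e; move: hw; rewrite -e ltnNge hu.
Qed.

Lemma wd0 : wd [::] = 1.
Proof. by apply: fcoefP => u hu; rewrite fcoef_wd hu andbT fcoef1 //; case: u hu. Qed.

Lemma wdM u v : wd u * wd v = wd (u ++ v).
Proof.
apply: fcoefP => w hw; rewrite fcoefM // fcoef_wd hw andbT.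
have E u' v' w' : (size w' <= m)%N ->
    conv (fun w1 => ((w1 == u') && (size w1 <= m)%N)%:R)
         (fun w1 => ((w1 == v') && (size w1 <= m)%N)%:R) w' = ((w' == u' ++ v')%:R : R).
  clear; elim: w' u' => [|x w' IH] u' hw' /=.
    by rewrite !andbT -natrM mulnb; case: u'.
  have z : conv (fun w1 => (false && (size w1 <= m)%N)%:R)
         (fun w1 => ((w1 == v') && (size w1 <= m)%N)%:R) w' = (0 : R).
    apply: (@conv_ge _ _ (size w').+1 0) => //=; by rewrite addn0.
  case: u' => [|y u'] /=.
    rewrite mul1r hw' andbT -[RHS]addr0; congr (_ + _); rewrite -[RHS]z.
    by apply: eq_conv => // u0 _ /=.
  rewrite mul0r add0r eqseq_cons; case: eqP => [->|ne] /=.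
    rewrite -IH ?(ltnW hw') //; apply: eq_conv => // u0 h0.
    by rewrite eqseq_cons eqxx /= (leq_ltn_trans h0 hw') (leq_trans h0 (ltnW hw')).
  rewrite -[RHS]z; apply: eq_conv => // u0 h0.
  by rewrite eqseq_cons; case: eqP.
rewrite -E //; apply: eq_conv => w1 _; exact: fcoef_wd.
Qed.

Lemma fra_sum f : f = \sum_(v : {bseq m of X}) fcoef f v *: wd v.
Proof.
apply: fcoefP => w hw.
have -> : fcoef (\sum_(v : {bseq m of X}) fcoef f v *: wd v) w =
   \sum_(v : {bseq m of X}) fcoef f v * fcoef (wd v) w.
  elim/big_rec2: _ => [|i a b _ <-]; first exact: fcoef0.
  by rewrite fcoef_lin.
rewrite (bigD1 (Bseq hw)) //= fcoef_wd eqxx hw mulr1 big1 ?addr0 // => v /eqP ne.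
by rewrite fcoef_wd; case: eqP => [e|]; [case: ne; apply: val_inj | rewrite mulr0].
Qed.

Definition flin (V : lmodType R) (g : seq X -> V) f : V :=
  \sum_(v : {bseq m of X}) fcoef f v *: g v.

Lemma flin_is_linear (V : lmodType R) (g : seq X -> V) : linear (flin g).
Proof.
move=> a f h; rewrite /flin scaler_sumr -big_split; apply: eq_bigr => v _.
by rewrite fcoef_lin scalerDl scalerA.
Qed.
HB.instance Definition _ (V : lmodType R) (g : seq X -> V) :=
  GRing.isLinear.Build R A V _ (flin g) (flin_is_linear g).

Lemma flin_wd (V : lmodType R) (g : seq X -> V) w :
  (size w <= m)%N -> flin g (wd w) = g w.
Proof.
move=> hw; rewrite /flin (bigD1 (Bseq hw)) //= fcoef_wd eqxx hw scale1r.
rewrite big1 ?addr0 // => v /eqP ne; rewrite fcoef_wd.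
by case: eqP => [e|]; [case: ne; apply: val_inj | rewrite scale0r].
Qed.

Lemma flin_wd0 (V : lmodType R) (g : seq X -> V) w :
  (forall u, (m < size u)%N -> g u = 0) -> flin g (wd w) = g w.
Proof.
move=> hg; case: (leqP (size w) m) => hw; first exact: flin_wd.
by rewrite wd_big // linear0 hg.
Qed.

Lemma eq_flin (V : lmodType R) (g g' : seq X -> V) f :
  (forall u, (size u <= m)%N -> g u = g' u) -> flin g f = flin g' f.
Proof. by move=> h; apply: eq_bigr => v _; rewrite h // size_bseq. Qed.

(* Linear identities only have to be checked on words. *)
Lemma fra_ind (V : lmodType R) (F G : A -> V) :
  linear F -> linear G -> (forall w, (size w <= m)%N -> F (wd w) = G (wd w)) -> F =1 G.
Proof.
move=> lF lG e f.
pose F1 : {linear A -> V} := HB.pack F (GRing.isLinear.Build _ _ _ _ F lF).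
pose G1 : {linear A -> V} := HB.pack G (GRing.isLinear.Build _ _ _ _ G lG).
rewrite -[F f]/(F1 f) -[G f]/(G1 f) (fra_sum f) !linear_sum; apply: eq_bigr => v _.
by rewrite !linearZ /= e // size_bseq.
Qed.

(** This is the k-th power of the augmentation ideal, the filtration behind all leading-term
    arguments. *)
Definition fge k f := forall w, (size w < k)%N -> fcoef f w = 0.

Lemma fge0 k : fge k 0. Proof. by move=> w _; rewrite fcoef0. Qed.
Lemma fge_all f : fge 0 f. Proof. by []. Qed.
Lemma fgeD k f g : fge k f -> fge k g -> fge k (f + g).
Proof. by move=> hf hg w hw; rewrite fcoefD hf ?hg ?addr0. Qed.
Lemma fgeZ k a f : fge k f -> fge k (a *: f).
Proof. by move=> hf w hw; rewrite fcoefZ hf ?mulr0. Qed.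
Lemma fgeN k f : fge k f -> fge k (- f).
Proof. by move=> hf; rewrite -scaleN1r; apply: fgeZ. Qed.
Lemma fgeB k f g : fge k f -> fge k g -> fge k (f - g).
Proof. by move=> hf hg; apply: fgeD => //; apply: fgeN. Qed.
Lemma fge_sum k (I : Type) (r : seq I) (P : pred I) (F : I -> A) :
  (forall i, P i -> fge k (F i)) -> fge k (\sum_(i <- r | P i) F i).
Proof. by move=> h; elim/big_rec: _ => [|i x Pi IH]; [apply: fge0 | apply: fgeD; [apply: h |]]. Qed.
Lemma fgeW j k f : (j <= k)%N -> fge k f -> fge j f.
Proof. by move=> hjk hf w hw; apply: hf; apply: leq_trans hjk. Qed.
Lemma fgeM i j f g : fge i f -> fge j g -> fge (i + j)%N (f * g).
Proof.
move=> hf hg w hw; case: (leqP (size w) m) => h; last exact: fcoef_big.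
rewrite fcoefM //; exact: conv_ge hw.
Qed.
Lemma fgeMr i f g : fge i g -> fge i (f * g).
Proof. by move=> hf; rewrite -[i]add0n; apply: fgeM. Qed.
Lemma fgeX k f n : fge k f -> fge (k * n)%N (f ^+ n).
Proof.
by move=> hf; elim: n => [|n IH]; [rewrite muln0 | rewrite mulnS exprS; apply: fgeM].
Qed.
Lemma fge_eq0 k f : (m < k)%N -> fge k f -> f = 0.
Proof.
by move=> hk hf; apply: fcoefP => w hw; rewrite fcoef0 hf // (leq_ltn_trans hw).
Qed.
Lemma fge1P f : fge 1 f <-> fcoef f [::] = 0.
Proof. by split=> [h|h [|//]]; [apply: h|]. Qed.

(** The Euler derivation and, once 1, ..., m are units, its inverse on series without constant
    term. *)
Definition fdeg f : A := fmk m (fun w => (size w)%:R * fcoef f w).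
Definition fdegV f : A := fmk m (fun w => ((size w)%:R)^-1 * fcoef f w).

Lemma fcoef_deg f w : fcoef (fdeg f) w = (size w)%:R * fcoef f w.
Proof.
by case: (leqP (size w) m) => h; [rewrite fcoef_mk | rewrite !fcoef_big ?mulr0].
Qed.
Lemma fcoef_degV f w : fcoef (fdegV f) w = ((size w)%:R)^-1 * fcoef f w.
Proof.
by case: (leqP (size w) m) => h; [rewrite fcoef_mk | rewrite !fcoef_big ?mulr0].
Qed.
Lemma fdeg_is_linear : linear fdeg.
Proof.
move=> a f g; apply: fcoefP => w _.
by rewrite !(fcoef_lin, fcoef_deg) mulrDr mulrCA.
Qed.
HB.instance Definition _ := GRing.isLinear.Build R A A _ fdeg fdeg_is_linear.
Lemma fdegV_is_linear : linear fdegV.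
Proof.
move=> a f g; apply: fcoefP => w _.
by rewrite !(fcoef_lin, fcoef_degV) mulrDr mulrCA.
Qed.
HB.instance Definition _ := GRing.isLinear.Build R A A _ fdegV fdegV_is_linear.

Lemma fdeg_wd w : fdeg (wd w) = (size w)%:R *: wd w.
Proof.
apply: fcoefP => u hu; rewrite fcoef_deg fcoefZ fcoef_wd hu andbT.
by case: eqP => [->|]; rewrite ?mulr0.
Qed.
Lemma fdegV_wd w : fdegV (wd w) = ((size w)%:R)^-1 *: wd w.
Proof.
apply: fcoefP => u hu; rewrite fcoef_degV fcoefZ fcoef_wd hu andbT.
by case: eqP => [->|]; rewrite ?mulr0.
Qed.
Lemma fge_deg k f : fge k f -> fge k (fdeg f).
Proof. by move=> h w hw; rewrite fcoef_deg h ?mulr0. Qed.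
Lemma fge1_deg f : fge 1 (fdeg f).
Proof. by apply/fge1P; rewrite fcoef_deg mul0r. Qed.

Lemma fdegM f g : fdeg (f * g) = fdeg f * g + f * fdeg g.
Proof.
move: f; apply: fra_ind => [a f h|a f h|u hu].
- by rewrite mulrDl linearD -scalerAl linearZ.
- by rewrite linearP !mulrDl scalerDr -!addrA -!scalerAl; congr (_ + _); rewrite addrCA.
move: g; apply: fra_ind => [a f h|a f h|v hv].
- by rewrite mulrDr linearD -scalerAr linearZ.
- rewrite linearP !mulrDr scalerDr -!addrA -!scalerAr; congr (_ + _).
  by rewrite addrCA.
by rewrite wdM !fdeg_wd -scalerAl -scalerAr !wdM -scalerDl size_cat natrD.
Qed.

Definition pr k f : A := fmk m (fun w => if size w == k then fcoef f w else 0).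
Lemma fcoef_pr k f w : fcoef (pr k f) w = if size w == k then fcoef f w else 0.
Proof.
by case: (leqP (size w) m) => h; [rewrite fcoef_mk | rewrite !fcoef_big //; case: ifP].
Qed.
Lemma pr_is_linear k : linear (pr k).
Proof.
move=> a f g; apply: fcoefP => w _.
by rewrite !(fcoef_lin, fcoef_pr); case: eqP; rewrite ?mulr0 ?addr0.
Qed.
HB.instance Definition _ k := GRing.isLinear.Build R A A _ (pr k) (pr_is_linear k).
Lemma pr_wd k w : pr k (wd w) = if size w == k then wd w else 0.
Proof.
apply: fcoefP => u hu; rewrite fcoef_pr fcoef_wd hu andbT.
case: (u =P w) => [<-|/eqP/negPf ne]; last first.
  by rewrite if_same; case: ifP; rewrite ?fcoef0 // fcoef_wd ne.
by case: ifP; rewrite ?fcoef0 // fcoef_wd eqxx hu.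
Qed.
Lemma sum_pr f : f = \sum_(k < m.+1) pr k f.
Proof.
apply: fcoefP => w hw.
have -> : fcoef (\sum_(k < m.+1) pr k f) w = \sum_(k < m.+1) fcoef (pr k f) w.
  elim/big_rec2: _ => [|i a b _ <-]; [exact: fcoef0 | exact: fcoefD].
rewrite (bigD1 (Ordinal (hw : size w < m.+1)%N)) //= fcoef_pr eqxx big1 ?addr0 // => k hk.
rewrite fcoef_pr; case: eqP => // e; case/eqP: hk; exact: val_inj.
Qed.
Lemma fge_pr k f : fge k (pr k f).
Proof. by move=> w hw; rewrite fcoef_pr; case: eqP => // e; rewrite e ltnn in hw. Qed.
Lemma fge_split k f : fge k f -> fge k.+1 (f - pr k f).
Proof.
move=> h w; rewrite ltnS leq_eqVlt => /orP [/eqP e|hw].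
  by rewrite fcoefB fcoef_pr e eqxx subrr.
by rewrite fcoefB fcoef_pr; case: eqP => [_|_]; rewrite ?subrr // h // subr0.
Qed.

End Words.
Arguments wd {R m X}.
Arguments fgeX {R m X k f} n.

(** * Lie elements *)

Section LieBasics.
Variables (R : nzRingType) (L : lmodType R) (br : L -> L -> L).
Hypothesis brP : is_lie_bracket br.

Lemma lie_linl a x y z : br (a *: x + y) z = a *: br x z + br y z.
Proof. by case: brP. Qed.
Lemma lie_linr a x y z : br x (a *: y + z) = a *: br x y + br x z.
Proof. by case: brP. Qed.
Lemma liexx x : br x x = 0. Proof. by case: brP. Qed.
Lemma lieDl x y z : br (x + y) z = br x z + br y z.
Proof. by rewrite -[x]scale1r lie_linl !scale1r. Qed.
Lemma lieDr x y z : br x (y + z) = br x y + br x z.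
Proof. by rewrite -[y]scale1r lie_linr !scale1r. Qed.
Lemma lie0l x : br 0 x = 0.
Proof. by apply: (@addrI _ (br 0 x)); rewrite addr0 -lieDl addr0. Qed.
Lemma lie0r x : br x 0 = 0.
Proof. by apply: (@addrI _ (br x 0)); rewrite addr0 -lieDr addr0. Qed.
Lemma lieZl a x y : br (a *: x) y = a *: br x y.
Proof. by rewrite -[a *: x]addr0 lie_linl lie0l addr0. Qed.
Lemma lieZr a x y : br x (a *: y) = a *: br x y.
Proof. by rewrite -[a *: y]addr0 lie_linr lie0r addr0. Qed.
Lemma lieNl x y : br (- x) y = - br x y.
Proof. by rewrite -scaleN1r lieZl scaleN1r. Qed.
Lemma lieNr x y : br x (- y) = - br x y.
Proof. by rewrite -scaleN1r lieZr scaleN1r. Qed.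
Lemma lieC x y : br x y = - br y x.
Proof.
apply/eqP; rewrite -addr_eq0; apply/eqP; rewrite -[RHS](liexx (x + y)).
by rewrite lieDl !lieDr !liexx add0r addr0.
Qed.
Lemma lie_jacobi x y z : br (br x y) z = br x (br y z) - br y (br x z).
Proof.
case: brP => _ _ _ J; have := J x y z; rewrite (lieC z (br x y)) (lieC z x) lieNr.
by move/eqP; rewrite subr_eq0 => /eqP <-.
Qed.
Lemma lie_suml I (r : seq I) (P : pred I) (F : I -> L) y :
  br (\sum_(i <- r | P i) F i) y = \sum_(i <- r | P i) br (F i) y.
Proof. by elim/big_rec2: _ => [|i a b _ <-]; rewrite ?lie0l ?lieDl. Qed.
Lemma lie_sumr I (r : seq I) (P : pred I) (F : I -> L) y :
  br y (\sum_(i <- r | P i) F i) = \sum_(i <- r | P i) br y (F i).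
Proof. by elim/big_rec2: _ => [|i a b _ <-]; rewrite ?lie0r ?lieDr. Qed.

End LieBasics.

(** With [y], the bracket has m + 1 entries, so this says that the class is at most m. *)
Definition lie_class (R : nzRingType) (L : lmodType R) (br : L -> L -> L) (m : nat) :=
  forall (s : seq L) (y : L), size s = m -> foldr br y s = 0.

Definition cbr (R : nzRingType) (A : algType R) (f g : A) : A := f * g - g * f.

Lemma cbrP (R : comNzRingType) (A : algType R) : is_lie_bracket (@cbr R A).
Proof.
split.
- move=> a x y z; rewrite /cbr mulrDl mulrDr scalerBr -scalerAl -scalerAr.
  by rewrite opprD addrACA.
- move=> a x y z; rewrite /cbr mulrDl mulrDr scalerBr -scalerAl -scalerAr.
  by rewrite opprD addrACA.
- by move=> x; rewrite /cbr subrr.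
move=> x y z; rewrite /cbr !mulrBr !mulrBl !mulrA.
move: (x * y * z) (x * z * y) (y * z * x) (z * y * x) (y * x * z) (z * x * y) => a b c d e f.
rewrite !opprB [LHS](AC ((2*2)*(2*2)*(2*2)) ((1*12)*(2*7)*(3*10)*(4*5)*(6*11)*(8*9))) /=.
by rewrite !subrr !addNr !addr0.
Qed.

Section LieEval.
Variables (R : finComUnitRingType) (m : nat) (L : lmodType R) (br : L -> L -> L).
Hypothesis brP : is_lie_bracket br.
Hypothesis brN : lie_class br m.
Variables (X : finType) (al : X -> L).
Local Notation A := (fra R m X).
Implicit Types (f g h : A) (w u v : seq X).

(** A word acts on L by composing the adjoint maps of its letters; [lword] is its right-normed
    bracket, with value 0 at the empty word. *)
Definition lactw w z := foldr (fun x b => br (al x) b) z w.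
Fixpoint lword w :=
  if w is x :: w' then (if nilp w' then al x else br (al x) (lword w')) else 0.

Lemma lactw_cat u v z : lactw (u ++ v) z = lactw u (lactw v z).
Proof. by rewrite /lactw foldr_cat. Qed.

Lemma lword_cat u v : ~~ nilp v -> lword (u ++ v) = lactw u (lword v).
Proof.
move=> nv; elim: u => //= x u ->; case: ifP => //.
by rewrite /nilp size_cat addn_eq0 -[size v == 0]/(nilp v) (negPf nv) andbF.
Qed.

Lemma lword_cons x w : ~~ nilp w -> lword (x :: w) = br (al x) (lword w).
Proof. by move=> /negPf /= ->. Qed.

Lemma lactw_big w z : (m <= size w)%N -> lactw w z = 0.
Proof.
move=> hw; rewrite -(cat_take_drop m w) lactw_cat /lactw.
have <- : forall t y, foldr br y (map al t) = foldr (fun x b => br (al x) b) y t.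
  by elim=> //= x t IH y; rewrite IH.
by rewrite brN // size_map size_takel.
Qed.

Lemma lword_big w : (m < size w)%N -> lword w = 0.
Proof.
case/lastP: w => // w x; rewrite size_rcons ltnS => hw.
by rewrite -cats1 lword_cat // lactw_big.
Qed.

Lemma lactw_linear w : linear (lactw w).
Proof.
by move=> a x y; elim: w => //= c w ->; rewrite (lie_linr brP).
Qed.

(** Dynkin's operator with values in L, and the module structure over [A] for which a letter [x]
    acts as [br (al x)]. Both are compatible with truncation because a class at most m kills the
    long words. *)
Definition dyn : A -> L := flin lword.
Definition lact f z : L := flin (lactw^~ z) f.
HB.instance Definition _ := GRing.Linear.on dyn.

Lemma lact_linearl z : linear (lact^~ z).
Proof. by move=> a f g; rewrite /lact linearP. Qed.
Lemma lact_linearr f : linear (lact f).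
Proof.
move=> a x y; rewrite /lact /flin scaler_sumr -big_split; apply: eq_bigr => v _.
by rewrite lactw_linear scalerDr !scalerA mulrC.
Qed.
HB.instance Definition _ f := GRing.isLinear.Build R L L _ (lact f) (lact_linearr f).

Lemma lact_wd' w z : lact (wd w) z = lactw w z.
Proof. by rewrite /lact flin_wd0 // => u hu; apply: lactw_big; apply: ltnW. Qed.
Lemma dyn_wd w : dyn (wd w) = lword w.
Proof. by rewrite /dyn flin_wd0 // => u hu; apply: lword_big. Qed.

Lemma lactM f g z : lact (f * g) z = lact f (lact g z).
Proof.
move: f; apply: fra_ind => [a f h|a f h|u hu].
- by rewrite mulrDl -scalerAl [LHS]lact_linearl.
- by rewrite [LHS]lact_linearl.
move: g; apply: fra_ind => [a f h|a f h|v hv].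
- by rewrite mulrDr -scalerAr [LHS]lact_linearl.
- by rewrite [lact _ z]lact_linearl linearP.
by rewrite wdM !lact_wd' lactw_cat.
Qed.

Lemma lact1 z : lact 1 z = z.
Proof. by rewrite -wd0 lact_wd'. Qed.

(** Bracketing [u ++ v] from the right lets [u] act on the bracket of [v], except when [v] is empty;
    the second term accounts for that case. *)
Lemma dynM f g : dyn (f * g) = lact f (dyn g) + fcoef g [::] *: dyn f.
Proof.
move: f; apply: fra_ind => [a f h|a f h|u hu].
- by rewrite mulrDl -scalerAl linearP.
- by rewrite linearP [lact _ _]lact_linearl !scalerDr addrACA; congr (_ + _ + _); rewrite !scalerA mulrC.
move: g; apply: fra_ind => [a f h|a f h|v hv].
- by rewrite mulrDr -scalerAr linearP.
- by rewrite linearP linearP fcoef_lin !scalerDl scalerDr addrACA scalerA.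
rewrite wdM !dyn_wd lact_wd' fcoef_wd /= andbT.
case: v hv => [|x v] hv; last by rewrite scale0r addr0 lword_cat.
by rewrite cats0 scale1r -[lword [::]]/0 -(lact_wd' u) linear0 add0r.
Qed.

Lemma lact_letter x z : lact (wd [:: x]) z = br (al x) z.
Proof. by rewrite lact_wd'. Qed.

End LieEval.

Section FraLie.
Variables (R : finComUnitRingType) (m : nat) (X : finType).
Local Notation A := (fra R m X).
Implicit Types (f g h : A) (w u v : seq X).

Lemma cbrE f g : cbr f g = f * g - g * f.
Proof. by []. Qed.

Lemma fge_cbr i j f g : fge i f -> fge j g -> fge (i + j)%N (cbr f g).
Proof.
by move=> hf hg; apply: fgeB; [apply: fgeM | rewrite addnC; apply: fgeM].
Qed.

(** Scalars are central, so a bracket ignores constant terms; hence bracketing with any element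
    raises the order. *)
Lemma cbr_shift c f g : cbr (f - c%:A) g = cbr f g.
Proof.
rewrite /cbr mulrBl mulrBr opprB -scalerAl -scalerAr mul1r mulr1.
by rewrite addrA subrK.
Qed.

Lemma fge1_shift f : fge 1 (f - (fcoef f [::])%:A).
Proof. by apply/fge1P; rewrite fcoefB fcoefZ fcoef1 // mulr1 subrr. Qed.

Lemma cbr_fgeS k f g : fge k g -> fge k.+1 (cbr f g).
Proof.
move=> hg; rewrite -(cbr_shift (fcoef f [::])) -add1n; apply: fge_cbr => //.
exact: fge1_shift.
Qed.

Lemma cbr_fge2 f g : fge 2 (cbr f g).
Proof.
rewrite (lieC (cbrP _)) -(cbr_shift (fcoef g [::])) -(lieC (cbrP _)).
apply: cbr_fgeS; exact: fge1_shift.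
Qed.

(** The innermost bracket already has order 2, so m nested brackets reach order m + 1. *)
Lemma cbrN : (0 < m)%N -> lie_class (@cbr R A) m.
Proof.
have E (s : seq A) y : (0 < size s)%N -> fge (size s).+1 (foldr (@cbr R A) y s).
  elim: s => // x [|z s] IH _; first exact: cbr_fge2.
  by apply: cbr_fgeS; apply: IH.
by move=> m0 s y hs; apply: (@fge_eq0 _ _ _ (size s).+1); [rewrite hs | apply: E; rewrite hs].
Qed.

Definition fhom k f := forall w, size w != k -> fcoef f w = 0.

Lemma conv_hom i j (F G : seq X -> R) w :
  (forall u, size u != i -> F u = 0) -> (forall u, size u != j -> G u = 0) ->
  size w != (i + j)%N -> conv F G w = 0.
Proof.
elim: w i F => [|x w IH] [|i] F hF hG hw /=.
- by rewrite hG ?mulr0.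
- by rewrite hF ?mul0r.
- rewrite hG // mulr0 add0r.
  apply: (@conv_ge _ _ (size w).+1 0) => //; last by rewrite addn0.
  by move=> u _; apply: hF.
by rewrite hF // mul0r add0r; apply: (IH i) => // u hu; apply: hF.
Qed.

Lemma fhomM i j f g : fhom i f -> fhom j g -> fhom (i + j)%N (f * g).
Proof.
move=> hf hg w hw; case: (leqP (size w) m) => h; last exact: fcoef_big.
by rewrite fcoefM //; apply: conv_hom hw.
Qed.
Lemma fhomB i f g : fhom i f -> fhom i g -> fhom i (f - g).
Proof. by move=> hf hg w hw; rewrite fcoefB hf ?hg ?subr0. Qed.
Lemma fhom_wd w : fhom (size w) (wd w).
Proof. by move=> u hu; rewrite fcoef_wd; case: eqP => // e; rewrite e eqxx in hu. Qed.
Lemma fhom_degV k f : fhom k f -> fdegV f = (k%:R)^-1 *: f.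
Proof.
move=> hf; apply: fcoefP => w _; rewrite fcoef_degV fcoefZ.
by case: (eqVneq (size w) k) => [->//|h]; rewrite hf // !mulr0.
Qed.
Lemma fhom_pr k j f : fhom k f -> pr j f = if k == j then f else 0.
Proof.
move=> hf; apply: fcoefP => w _; rewrite fcoef_pr.
case: (eqVneq (size w) k) => [->|h]; first by case: ifP; rewrite ?fcoef0.
by case: ifP => _; rewrite ?(hf _ h) //; case: ifP; rewrite ?fcoef0 ?hf.
Qed.
Lemma fhom_pr' k f : fhom k (pr k f).
Proof. by move=> w hw; rewrite fcoef_pr (negPf hw). Qed.

Definition letr (x : X) : A := wd [:: x].
Local Notation lw := (lword (@cbr R A) letr).

Lemma lword_hom w : fhom (size w) (lw w).
Proof.
elim: w => [|x w IH] /=; first by move=> u _; rewrite fcoef0.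
case: ifP => [/nilP ->|_]; first exact: (@fhom_wd [:: x]).
apply: fhomB; rewrite -add1n; first exact: fhomM (@fhom_wd [:: x]) IH.
by rewrite addnC; apply: fhomM IH (@fhom_wd [:: x]).
Qed.

Hypothesis m0 : (0 < m)%N.
Definition dynA : A -> A := dyn (@cbr R A) letr.
HB.instance Definition _ := GRing.Linear.on dynA.

Lemma dynA_wd w : dynA (wd w) = lw w.
Proof. by rewrite /dynA dyn_wd //; apply: cbrN. Qed.

Lemma dynA_pr k f : dynA (pr k f) = pr k (dynA f).
Proof.
move: f; apply: fra_ind => [a f h|a f h|w hw]; try by rewrite !linearP.
rewrite pr_wd dynA_wd (fhom_pr _ (@lword_hom w)).
by case: ifP; rewrite ?dynA_wd // linear0.
Qed.
Lemma dynA_degV f : dynA (fdegV f) = fdegV (dynA f).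
Proof.
move: f; apply: fra_ind => [a f h|a f h|w hw]; try by rewrite !linearP.
by rewrite fdegV_wd linearZ /= dynA_wd (fhom_degV (@lword_hom w)).
Qed.
Lemma fge_dynA k f : fge k f -> fge k (dynA f).
Proof.
move=> hf; apply: fge_sum => v _; case: (ltnP (size v) k) => hv.
  by rewrite hf // scale0r; apply: fge0.
by apply: fgeZ => u hu; apply: lword_hom; rewrite neq_ltn (leq_trans hu hv).
Qed.
Lemma dynA_letter x : dynA (letr x) = letr x.
Proof. by rewrite dynA_wd. Qed.

(* The Dynkin-Specht-Wever criterion, taken as the definition of a Lie element. *)
Definition inS f := fcoef f [::] = 0 /\ dynA f = fdeg f.

Hypothesis unitm : forall k, (0 < k <= m)%N -> (k%:R : R) \is a GRing.unit.

Lemma fdegVK f : fcoef f [::] = 0 -> fdegV (fdeg f) = f.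
Proof.
move=> f0; apply: fcoefP => w hw; rewrite fcoef_degV fcoef_deg mulrA.
case: w hw => [|x w] hw; first by rewrite !f0 !mulr0.
by rewrite mulVr ?mul1r // unitm.
Qed.

(** This exhibits a Lie element as an explicit combination of right-normed brackets of letters, the
    form in which the criterion is used. *)
Lemma inS_dyn f : inS f -> dynA (fdegV f) = f.
Proof. by case=> f0 fS; rewrite dynA_degV fS fdegVK. Qed.

Lemma inS_linear a f g : inS f -> inS g -> inS (a *: f + g).
Proof.
move=> [f0 fS] [g0 gS]; split; first by rewrite fcoef_lin f0 g0 mulr0 addr0.
by rewrite !linearP /= fS gS.
Qed.
Lemma inS0 : inS 0. Proof. by split; rewrite ?fcoef0 // !linear0. Qed.
Lemma inSZ a f : inS f -> inS (a *: f).
Proof. by move=> fS; rewrite -[a *: f]addr0; apply: inS_linear fS inS0. Qed.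
Lemma inSN f : inS f -> inS (- f).
Proof. by rewrite -scaleN1r; apply: inSZ. Qed.
Lemma inSD f g : inS f -> inS g -> inS (f + g).
Proof. by rewrite -{2}[f]scale1r; apply: inS_linear. Qed.
Lemma inS_pr k f : inS f -> inS (pr k f).
Proof.
move=> [f0 fS]; split; first by rewrite fcoef_pr f0 if_same.
rewrite dynA_pr fS; apply: fcoefP => w _; rewrite !(fcoef_pr, fcoef_deg).
by case: ifP; rewrite ?mulr0.
Qed.
Lemma inS_letter x : inS (letr x).
Proof.
split; first by rewrite fcoef_wd.
by rewrite dynA_letter fdeg_wd scale1r.
Qed.

Section Target.
Variables (L : lmodType R) (br : L -> L -> L) (al : X -> L).
Hypothesis brP : is_lie_bracket br.
Hypothesis brN : lie_class br m.
Local Notation dynL := (dyn (m := m) br al).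
Local Notation actL := (lact (m := m) br al).

(** By the Jacobi identity, a bracket of letters acts as the adjoint map of the corresponding
    bracket in L. *)
Lemma lact_dynA f z : actL (dynA f) z = br (dynL f) z.
Proof.
move: f; apply: fra_ind => [a f h|a f h|w hw].
- by rewrite linearP [LHS]lact_linearl.
- by rewrite linearP (lie_linl brP).
rewrite dynA_wd dyn_wd //; elim: w z {hw} => [|x w IH] z /=.
  by rewrite -(scale0r 0) -[0 *: 0]addr0 [LHS]lact_linearl !scale0r (lie0l brP) !add0r /lact linear0.
case: ifP => _; first exact: lact_letter.
rewrite /cbr /lact linearB /= -!/(lact _ _ _ _) !lactM // !lact_letter // !IH.
by rewrite (lie_jacobi brP).
Qed.

(** The evaluation of Lie elements in L that extends [al]: [dyn] evaluates brackets but multiplies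
    degree k by k, which [fdegV] undoes. With [lphi_br], the Lie elements serve as the free Lie
    algebra of class m. *)
Definition lphi f : L := dynL (fdegV f).
Lemma lphi_is_linear : linear lphi.
Proof. by move=> a f g; rewrite /lphi !linearP. Qed.
HB.instance Definition _ := GRing.isLinear.Build R A L _ lphi lphi_is_linear.

Lemma lact_inS f z : inS f -> actL f z = br (lphi f) z.
Proof. by move=> fS; rewrite -{1}(inS_dyn fS) lact_dynA. Qed.

Lemma lphi_letter x : lphi (letr x) = al x.
Proof. by rewrite /lphi /letr fdegV_wd linearZ /= dyn_wd //= invr1 scale1r. Qed.

Lemma lphi_hom k f : fhom k f -> lphi f = (k%:R)^-1 *: dynL f.
Proof. by move=> h; rewrite /lphi (fhom_degV h) linearZ. Qed.

(** By [dynM], Dynkin's operator takes [cbr f g] to the action of [f] on [dynL g] minus that of [g]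
    on [dynL f]. Since it is multiplication by the degree on Lie elements, the two terms contribute
    j and i times the bracket. *)
Lemma lphi_br_hom i j f g : (0 < i)%N -> (0 < j)%N -> fhom i f -> fhom j g ->
  inS f -> inS g -> lphi (cbr f g) = br (lphi f) (lphi g).
Proof.
move=> i0 j0 hf hg fS gS.
have E : br (lphi f) (lphi g) = (j%:R)^-1 *: dynL (f * g).
  rewrite -lact_inS // (lphi_hom hg) linearZ /= dynM //.
  by case: gS => -> _; rewrite scale0r addr0.
(* Beyond m, the integer i + j need not be a unit; but then [f * g] is 0, and by [E] so is the
   bracket in L. *)
case: (leqP (i + j) m) => hij; last first.
  rewrite E [f * g](@fge_eq0 _ _ _ (i + j)) //; last first.
    by apply: fgeM => w hw; [apply: hf | apply: hg]; rewrite neq_ltn hw.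
  rewrite [cbr f g](@fge_eq0 _ _ _ (i + j)) ?linear0 ?scaler0 //.
  by apply: fge_cbr => w hw; [apply: hf | apply: hg]; rewrite neq_ltn hw.
have fgh : fhom (i + j)%N (cbr f g).
  by apply: fhomB; [apply: fhomM | rewrite addnC; apply: fhomM].
have ui : (i%:R : R) \is a GRing.unit by apply: unitm; rewrite i0 (leq_trans _ hij) // leq_addr.
have uj : (j%:R : R) \is a GRing.unit by apply: unitm; rewrite j0 (leq_trans _ hij) // leq_addl.
have uij : ((i + j)%:R : R) \is a GRing.unit by apply: unitm; rewrite hij addn_gt0 i0.
rewrite (lphi_hom fgh).
suff -> : dynL (cbr f g) = (i + j)%:R *: br (lphi f) (lphi g) by rewrite scalerA mulVr // scale1r.
rewrite cbrE linearB /= !dynM //.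
case: (fS) => -> _; case: (gS) => -> _; rewrite !scale0r !addr0.
rewrite !lact_inS // natrD scalerDl (lieC brP (lphi g)) opprK addrC; congr (_ + _).
  by rewrite -(lieZl brP) (lphi_hom hf) scalerA mulrV // scale1r.
by rewrite -(lieZr brP) (lphi_hom hg) scalerA mulrV // scale1r.
Qed.

Lemma lphi_br f g : inS f -> inS g -> lphi (cbr f g) = br (lphi f) (lphi g).
Proof.
move=> fS gS; rewrite {1}(sum_pr f) {1}(sum_pr g) {2}(sum_pr f) {2}(sum_pr g).
rewrite (lie_suml (cbrP _)) !linear_sum (lie_suml brP); apply: eq_bigr => i _.
rewrite (lie_sumr (cbrP _)) (linear_sum lphi) (lie_sumr brP); apply: eq_bigr => j _.
have z h : inS h -> pr 0 h = 0.
  case=> h0 _; apply: fcoefP => w _; rewrite fcoef_pr fcoef0.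
  by case: eqP => // /size0nil ->.
case: (posnP i) => [->|i0]; first by rewrite z // (lie0l (cbrP _)) linear0 (lie0l brP).
case: (posnP j) => [->|j0]; first by rewrite z // (lie0r (cbrP _)) linear0 (lie0r brP).
by apply: (lphi_br_hom i0 j0); try exact: fhom_pr'; apply: inS_pr.
Qed.

End Target.
End FraLie.

(** * Exponentials and the Baker-Campbell-Hausdorff product *)

Lemma fgeX_diff (R : finComUnitRingType) m (X : finType) k (f g : fra R m X) j : fge 1 f -> fge 1 g -> fge k (f - g) ->
  fge (k + j)%N (f ^+ j.+1 - g ^+ j.+1).
Proof.
move=> hf hg h; elim: j => [|j IH]; first by rewrite addn0.
have -> : f ^+ j.+2 - g ^+ j.+2 = f * (f ^+ j.+1 - g ^+ j.+1) + (f - g) * g ^+ j.+1.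
  by rewrite mulrBr mulrBl -!exprS addrA subrK.
apply: fgeD; first by rewrite addnS -add1n; apply: fgeM.
by apply: fgeM => //; have := fgeX j.+1 hg; rewrite mul1n.
Qed.

(** The step by Pascal's rule shared by the two non-commutative binomial formulas [mulX_ad] and
    [fdegX]. *)
Lemma sum_pascal (R : nzRingType) (V : lmodType R) (T : nat -> nat -> V) k :
  \sum_(j < k.+2) 'C(k.+1, j)%:R *: T j (k.+1 - j)%N =
  \sum_(j < k.+1) 'C(k, j)%:R *: T j.+1 (k - j)%N
   + \sum_(j < k.+1) 'C(k, j)%:R *: T j (k - j).+1.
Proof.
rewrite big_ord_recl /= bin0 subn0.
under eq_bigr => j _ do rewrite /bump /= add1n binS natrD scalerDl subSS.
rewrite big_split /= addrA addrC; congr (_ + _).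
transitivity (\sum_(j < k.+2) 'C(k, j)%:R *: T j (k.+1 - j)%N).
  by rewrite [RHS]big_ord_recl /= bin0 subn0.
rewrite big_ord_recr /= bin_small // scale0r addr0; apply: eq_bigr => j _.
by rewrite subSn // -ltnS.
Qed.

Definition ifact (R : comUnitRingType) k : R := (k`!%:R)^-1.

HB.lock Definition fexp (R : finComUnitRingType) m (X : finType) (f : fra R m X) : fra R m X :=
  \sum_(k < m.+1) ifact R k *: f ^+ k.

Lemma fexpE (R : finComUnitRingType) m (X : finType) (f : fra R m X) :
  fexp f = \sum_(k < m.+1) ifact R k *: f ^+ k.
Proof. by rewrite fexp.unlock. Qed.

Section Exp.
Variables (R : finComUnitRingType) (m : nat) (X : finType).
Local Notation A := (fra R m X).
Implicit Types (f g h u v : A).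
Hypothesis m0 : (0 < m)%N.
Hypothesis unitm : forall k, (0 < k <= m)%N -> (k%:R : R) \is a GRing.unit.

Let AP : is_lie_bracket (@cbr R A) := @cbrP R A.
Let AN : lie_class (@cbr R A) m := cbrN m0.

Lemma fact_unit k : (k <= m)%N -> (k`!%:R : R) \is a GRing.unit.
Proof.
elim: k => [|k IH] hk; first by rewrite fact0 unitr1.
by rewrite factS natrM unitrM IH ?unitm // ltnW.
Qed.

Lemma ifact_bin k j : (j <= k <= m)%N ->
  ifact R k * 'C(k, j)%:R = ifact R j * ifact R (k - j)%N.
Proof.
case/andP=> hj hk.
have uj := fact_unit (leq_trans hj hk).
have ukj : ((k - j)`!%:R : R) \is a GRing.unit.
  by apply: fact_unit; rewrite (leq_trans _ hk) // leq_subr.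
have := bin_fact hj => /(congr1 (fun n => n%:R : R)); rewrite !natrM => e.
have uab : (j`!%:R * (k - j)`!%:R : R) \is a GRing.unit by rewrite unitrM uj.
apply: (mulIr uab); rewrite -mulrA e /ifact mulVr ?fact_unit //.
by rewrite mulrACA !mulVr // mulr1.
Qed.

Lemma sum_shift (V : zmodType) j (G : nat -> V) :
  (forall i, (m < i + j)%N -> G i = 0) ->
  \sum_(i < m.+1) G i = \sum_(k < m.+1 | (j <= k)%N) G (k - j)%N.
Proof.
move=> hG.
have -> : \sum_(k < m.+1 | (j <= k)%N) G (k - j)%N = \sum_(0 + j <= k < m.+1) G (k - j)%N.
  by rewrite add0n big_geq_mkord.
rewrite big_addn -(big_mkord xpredT) (@big_cat_nat _ _ _ (m.+1 - j)) ?leq_subr //=.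
rewrite [X in _ + X]big_nat_cond [X in _ + X]big1; last first.
  by move=> i /andP [/andP [hi _] _]; apply: hG; rewrite addnC -leq_subLR.
by rewrite addr0; apply: eq_big_nat => i _; rewrite addnK.
Qed.

(** The product rule for exponential generating functions. The orders of [b j] and [f] kill the
    products of total degree above m, for which factorials need not be invertible. It serves for
    exponentials of sums, for the derivative of an exponential and for conjugation by one. *)
Lemma fexp_comb f (b c : nat -> A) : fge 1 f -> (forall j, fge j (b j)) ->
  (forall k, c k = \sum_(j < k.+1) 'C(k, j)%:R *: (b j * f ^+ (k - j))) ->
  \sum_(k < m.+1) ifact R k *: c k = (\sum_(j < m.+1) ifact R j *: b j) * fexp f.
Proof.
move=> hf hb hc; rewrite mulr_suml.
transitivity (\sum_(k < m.+1) \sum_(j < m.+1 | (j <= k)%N)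
    (ifact R j *: b j) * (ifact R (k - j) *: f ^+ (k - j))).
  apply: eq_bigr => k _; rewrite hc scaler_sumr.
  have hk : (k.+1 <= m.+1)%N by apply: ltn_ord.
  rewrite (big_ord_widen m.+1 (fun j => ifact R k *: ('C(k, j)%:R *: (b j * f ^+ (k - j)))) hk).
  apply: eq_bigr => j hj; rewrite scalerA ifact_bin; last by rewrite -ltnS hj -ltnS.
  by rewrite -scalerAl -scalerAr scalerA.
rewrite (exchange_big_dep xpredT) //=; apply: eq_bigr => j _.
rewrite !fexpE mulr_sumr.
rewrite (@sum_shift _ j (fun i => (ifact R j *: b j) * (ifact R i *: f ^+ i))) // => i hi.
rewrite -scalerAl -scalerAr (_ : b j * f ^+ i = 0) ?scaler0 //.
apply: fge_eq0 hi _; rewrite addnC; apply: fgeM => //.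
by have := fgeX i hf; rewrite mul1n.
Qed.

Lemma fexpD_comm f g : fge 1 f -> fge 1 g -> f * g = g * f ->
  fexp (f + g) = fexp f * fexp g.
Proof.
move=> hf hg fg; rewrite [LHS]fexpE (@fexp_comb g (fun j => f ^+ j) (fun k => (f + g) ^+ k)) //; first by rewrite -fexpE.
  by move=> j; have := fgeX j hf; rewrite mul1n.
move=> k; rewrite addrC (exprDn_comm k (esym fg)); apply: eq_bigr => j _.
by rewrite -scaler_nat; congr (_ *: _); apply: commrX; apply: commr_sym; apply: commrX.
Qed.

Lemma fexp0 : fexp (0 : A) = 1.
Proof.
rewrite !fexpE big_ord_recl big1 => [|i _]; last by rewrite expr0n /= scaler0.
by rewrite addr0 expr0 /ifact fact0 invr1 scale1r.
Qed.

Lemma fexpN f : fge 1 f -> fexp (- f) * fexp f = 1.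
Proof.
move=> hf; rewrite -fexpD_comm ?addNr ?fexp0 //; first exact: fgeN.
by rewrite mulNr mulrN.
Qed.

(** Only the linear terms differ in order k; all higher powers agree one order further. Injectivity
    of [fexp] and the later leading terms rest on this estimate. *)
Lemma fexp_diff k f g : fge 1 f -> fge 1 g -> fge k (f - g) ->
  fge k.+1 (fexp f - fexp g - (f - g)).
Proof.
move=> hf hg h; rewrite !fexpE -sumrB.
case: m m0 f g hf hg h => // m' _ f g hf hg h.
rewrite !big_ord_recl /= !expr0 subrr add0r !expr1 /ifact invr1 !scale1r.
rewrite addrAC subrr add0r; apply: fge_sum => i _; rewrite -scalerBr; apply: fgeZ.
rewrite /bump /= !add1n; apply: fgeW (@fgeX_diff R m'.+1 X k f g _ hf hg h).
by rewrite addnS ltnS leq_addr.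
Qed.

Lemma fexp_coef0 f : fge 1 f -> fcoef (fexp f) [::] = 1.
Proof.
move=> hf; have := @fexp_diff 1 f 0 hf (@fge0 _ _ _ 1); rewrite subr0 fexp0.
move=> /(_ hf [::] isT)/eqP; rewrite !fcoefB fcoef1 // ((fge1P f).1 hf) subr0.
by rewrite subr_eq0 => /eqP.
Qed.

Lemma fexp_inj f g : fge 1 f -> fge 1 g -> fexp f = fexp g -> f = g.
Proof.
move=> hf hg e; apply/eqP; rewrite -subr_eq0; apply/eqP.
have H k : fge k (f - g).
  elim: k => // k IH; have := fexp_diff hf hg IH.
  by rewrite e subrr sub0r => /fgeN; rewrite opprK.
exact: (fge_eq0 (ltnSn m) (H _)).
Qed.

(** By counting: [fexp f - 1] defines an injection of the finite set of series without constant term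
    into itself. No series for the logarithm is needed. *)
Lemma fexp_surj u : fcoef u [::] = 1 -> exists2 f, fge 1 f & fexp f = u.
Proof.
move=> hu; pose P := [set f : A | fcoef f [::] == 0].
pose E f := fexp f - 1.
have EP : E @: P = P.
  apply/eqP; rewrite eqEcard; apply/andP; split.
    apply/subsetP => y /imsetP [f]; rewrite inE => /eqP/fge1P hf ->.
    by rewrite inE fcoefB fexp_coef0 // fcoef1 // subrr.
  rewrite card_in_imset // => f g; rewrite !inE => /eqP/fge1P hf /eqP/fge1P hg /addIr.
  exact: fexp_inj.
have : u - 1 \in E @: P by rewrite EP inE fcoefB hu fcoef1 // subrr.
case/imsetP => f; rewrite inE => /eqP/fge1P hf /addIr ->; by exists f.
Qed.

Local Notation lactA := (lact (m := m) (@cbr R A) (@letr R m X)).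

(* Characterises the exponentials of Lie elements (inG_exp, inG_S), and is visibly closed under
   products; this is how the logarithm of a product of exponentials is seen to be Lie. *)
Definition inG u := [/\ fcoef u [::] = 1, fdeg u = dynA u * u & forall z, u * z = lactA u z * u].

(** By the Leibniz rule, [fdeg (u * v)] is [dynA u * u * v + u * dynA v * v]. Moving [u] past
    [dynA v] turns [dynA v] into its image under the action of [u], and [dynM] recognises the sum as
    [dynA (u * v) * (u * v)], because [v] has constant term 1. *)
Lemma inG_mul u v : inG u -> inG v -> inG (u * v).
Proof.
move=> [u0 u1 u2] [v0 v1 v2]; split; first by rewrite fcoefM_nil u0 v0 mulr1.
  rewrite fdegM u1 v1 /dynA (dynM AP AN).
  by rewrite v0 scale1r mulrDl mulrA u2 addrC !mulrA.
by move=> z; rewrite -mulrA v2 mulrA u2 (lactM AP AN) mulrA.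
Qed.

Lemma fge_ad f z k : fge 1 f -> fge k (iter k (cbr f) z).
Proof. by move=> hf; elim: k => // k IH; apply: cbr_fgeS. Qed.

Lemma mulX_ad f z k :
  f ^+ k * z = \sum_(j < k.+1) 'C(k, j)%:R *: (iter j (cbr f) z * f ^+ (k - j)).
Proof.
elim: k z => [|k IH] z; first by rewrite big_ord_recl big_ord0 addr0 !expr0 mulr1 mul1r scale1r.
have -> : f ^+ k.+1 * z = f ^+ k * cbr f z + f ^+ k * z * f.
  by rewrite exprSr cbrE mulrBr !mulrA subrK.
rewrite !IH mulr_suml (sum_pascal (fun j i => iter j (cbr f) z * f ^+ i)).
congr (_ + _); apply: eq_bigr => j _; first by rewrite -iterSr.
by rewrite -scalerAl -mulrA -exprSr.
Qed.

(** Divided by k! and summed, this is the classical formula for the derivative of an exponential;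
    the term j = 0 is absent, hence the value 0. *)
Lemma fdegX f k : fdeg (f ^+ k) =
  \sum_(j < k.+1) 'C(k, j)%:R *:
     ((if (j : nat) is j'.+1 then iter j' (cbr f) (fdeg f) else 0) * f ^+ (k - j)).
Proof.
elim: k => [|k IH].
  by rewrite big_ord_recl big_ord0 expr0 -wd0 fdeg_wd scale0r mul0r scaler0 addr0.
rewrite (sum_pascal (fun j i => (if j is j'.+1 then iter j' (cbr f) (fdeg f) else 0) * f ^+ i)).
rewrite exprSr fdegM IH mulr_suml addrC; congr (_ + _); first by rewrite mulX_ad.
by apply: eq_bigr => j _; rewrite -scalerAl -mulrA -exprSr.
Qed.

Lemma inS_lactX f z k : inS f -> lactA (f ^+ k) z = iter k (cbr f) z.
Proof.
move=> fS; elim: k z => [|k IH] z; first by rewrite expr0 (lact1 AN).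
rewrite exprSr (lactM AP AN) IH.
by rewrite (lact_inS m0 unitm _ AP AN _ fS) /lphi -/(dynA _) inS_dyn // -iterSr.
Qed.

(** For a Lie element, [dynM] gives that [dynA (f ^+ j.+1)] is (ad f)^j applied to [fdeg f]. These
    are the coefficients in [fdegX], so [fexp_comb] yields the second condition; [mulX_ad] yields
    the third in the same way. *)
Lemma inG_exp f : inS f -> inG (fexp f).
Proof.
move=> fS; have f1 : fge 1 f by apply/fge1P; case: fS.
split; first exact: fexp_coef0.
  have E k : dynA (f ^+ k) = if k is j.+1 then iter j (cbr f) (fdeg f) else 0.
    case: k => [|k]; first by rewrite expr0 -wd0 dynA_wd.
    rewrite exprSr /dynA (dynM AP AN).
    case: (fS) => -> e; rewrite scale0r addr0 -/(dynA f) e.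
    exact: inS_lactX.
  rewrite [X in fdeg X]fexpE [X in dynA X]fexpE !linear_sum /=.
  under eq_bigr => i _ do rewrite linearZ /=.
  rewrite (@fexp_comb f (fun k => if k is j.+1 then iter j (cbr f) (fdeg f) else 0)
    (fun k => fdeg (f ^+ k))).
  - by congr (_ * _); apply: eq_bigr => i _; rewrite linearZ /= E.
  - exact: f1.
  - case=> [|j]; first exact: fge_all.
    elim: j => [|j IH]; [exact: fge1_deg | exact: cbr_fgeS].
  by move=> k; apply: fdegX.
move=> z; rewrite [X in X * z]fexpE [X in lact _ _ X _]fexpE mulr_suml.
under eq_bigr => i _ do rewrite -scalerAl.
rewrite (@fexp_comb f (fun k => iter k (cbr f) z) (fun k => f ^+ k * z)) //.
- congr (_ * _); rewrite /lact linear_sum /=; apply: eq_bigr => i _.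
  by rewrite linearZ /= -/(lact _ _ _ _) inS_lactX.
- by move=> j; apply: fge_ad.
by move=> k; apply: mulX_ad.
Qed.

(** Degree by degree. If the part [f'] of lower degree is Lie, dividing by its exponential gives
    [v], again in [inG], which is 1 plus the next component [a] plus higher terms. In the equation
    [fdeg v = dynA v * v] the last factor counts as 1 in lowest degree, which leaves
    [fdeg a = dynA a]. *)
Lemma inG_S f : fge 1 f -> inG (fexp f) -> inS f.
Proof.
move=> hf fG.
suff H d : inS (\sum_(k < d) pr k f) by have := H m.+1; rewrite -sum_pr.
elim: d => [|d IH]; first by rewrite big_ord0; apply: inS0.
rewrite big_ord_recr /=; apply: inSD => //; move: IH.
set f' := \sum_(k < d) _ => f'S.
have f'1 : fge 1 f' by apply/fge1P; case: f'S.
have hd : fge d (f - f').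
  move=> w hw; rewrite fcoefB.
  have -> : fcoef f' w = \sum_(k < d) fcoef (pr k f) w.
    by rewrite /f'; elim/big_rec2: _ => [|i a b _ <-]; [exact: fcoef0 | exact: fcoefD].
  rewrite (bigD1 (Ordinal hw)) //= fcoef_pr eqxx big1 ?addr0 ?subrr // => k hk.
  rewrite fcoef_pr; case: eqP => // e; case/eqP: hk; exact: val_inj.
have hd' : fge d.+1 (f - f' - pr d f).
  have -> : pr d f = pr d (f - f').
    rewrite linearB /= (_ : pr d f' = 0) ?subr0 // /f' linear_sum /= big1 // => k _.
    rewrite (fhom_pr _ (@fhom_pr' _ _ _ k f)); case: eqP => // e.
    by have := ltn_ord k; rewrite e ltnn.
  exact: fge_split.
case: d f' f'S f'1 hd hd' => [|d] f' f'S f'1 hd hd'.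
  have -> : pr 0 f = 0; last exact: inS0.
  apply: fcoefP => w _; rewrite fcoef_pr fcoef0; case: eqP => // /size0nil ->.
  exact/fge1P.
pose v := fexp (- f') * fexp f.
have vG : inG v by apply: inG_mul => //; apply: inG_exp; apply: inSN.
pose a := pr d.+1 f; pose r := v - 1 - a.
have hr : fge d.+2 r.
  have e1 := fexp_diff hf f'1 hd.
  (* Here [v - 1] equals [fexp (- f') * (fexp f - fexp f')], so its leading term is that of
     [f - f'], namely [a]. *)
  have -> : r = fexp (- f') * (fexp f - fexp f' - (f - f'))
                + (fexp (- f') - 1) * (f - f') + (f - f' - a).
    rewrite /r /v; move: (f - f') => t; rewrite !mulrBr mulrBl fexpN // mul1r.
    by rewrite !addrA subrK subrK.
  apply: fgeD => //; apply: fgeD; first exact: fgeMr.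
  rewrite -add1n; apply: fgeM => //; apply/fge1P.
  by rewrite fcoefB fexp_coef0 ?fcoef1 ?subrr //; apply: fgeN.
have ev : v = 1 + (a + r) by rewrite /r [a + _]addrC subrK addrC subrK.
have hv1 : fge 1 (v - 1).
  by apply/fge1P; rewrite fcoefB fcoef1 //; case: vG => -> _ _; rewrite subrr.
split; first by rewrite fcoef_pr.
apply: fcoefP => w _; case: (eqVneq (size w) d.+1) => hw; last first.
  by rewrite dynA_pr // fcoef_deg !fcoef_pr (negPf hw) mulr0.
have hh : fge d.+2 (dynA a - fdeg a).
  case: vG => _ e _.
  have d1 : dynA (1 : A) = 0 by rewrite -wd0 dynA_wd.
  have g1 : fdeg (1 : A) = 0 by rewrite -wd0 fdeg_wd scale0r.
  have ed : dynA v = dynA a + dynA r by rewrite {1}ev !linearD /= d1 add0r.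
  have eg : fdeg v = fdeg a + fdeg r by rewrite {1}ev !linearD /= g1 add0r.
  have -> : dynA a - fdeg a = fdeg r - dynA r - dynA v * (v - 1).
    rewrite mulrBr mulr1 -e ed eg.
    move: (dynA a) (fdeg a) (dynA r) (fdeg r) => b c b' c'.
    rewrite !opprD !opprK [RHS](AC (2*(2*2)) ((5*3)*(1*4)*(2*6))) /=.
    by rewrite subrr addNr !addr0.
  apply: fgeB; first by apply: fgeB; [apply: fge_deg | apply: fge_dynA].
  rewrite -addn1; apply: fgeM => //.
  rewrite ed; apply: fgeD; apply: fge_dynA => //.
    exact: fge_pr.
  exact: fgeW hr.
by have := hh w; rewrite hw ltnSn fcoefB => /(_ isT)/eqP; rewrite subr_eq0 => /eqP.
Qed.

Lemma inS_bch f g h : inS f -> inS g -> fge 1 h -> fexp h = fexp f * fexp g -> inS h.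
Proof.
move=> fS gS h1 e; apply: inG_S => //; rewrite e.
by apply: inG_mul; apply: inG_exp.
Qed.

Definition flog u : A := odflt 0 [pick f | (fcoef f [::] == 0) && (fexp f == u)].

Lemma flogP u : fcoef u [::] = 1 -> fge 1 (flog u) /\ fexp (flog u) = u.
Proof.
move=> hu; rewrite /flog; case: pickP => [f /andP [/eqP/fge1P hf /eqP e] //|].
by have [f /fge1P hf e] := fexp_surj hu => /(_ f); rewrite hf e !eqxx.
Qed.

End Exp.

Section LwordFacts.
Variables (R : finComUnitRingType) (m : nat) (L : lmodType R) (br : L -> L -> L) (X : finType).

Lemma eq_lword (al al' : X -> L) w : al =1 al' -> lword br al w = lword br al' w.
Proof. by move=> e; elim: w => //= x w ->; rewrite e. Qed.

Lemma eq_lphi (al al' : X -> L) (f : fra R m X) : al =1 al' -> lphi br al f = lphi br al' f.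
Proof. by move=> e; apply: eq_flin => w _; apply: eq_lword. Qed.

(** The predicate [P] admits maps that respect brackets only on a closed subset, such as [lphi] on
    the Lie elements. *)
Lemma lword_morph (M : lmodType R) (br' : M -> M -> M) (phi : L -> M) (P : L -> Prop)
    (al : X -> L) w :
  phi 0 = 0 -> (forall x, P (al x)) ->
  (forall x y, P x -> P y -> P (br x y)) ->
  (forall x y, P x -> P y -> phi (br x y) = br' (phi x) (phi y)) ->
  phi (lword br al w) = lword br' (phi \o al) w.
Proof.
move=> p0 Pal Pbr pbr.
have Pw : forall w, ~~ nilp w -> P (lword br al w).
  elim=> //= x u IH _; case: ifP => // nu; apply: Pbr => //; apply: IH; by rewrite nu.
by elim: w => //= x u IH; case: ifP => // nu; rewrite pbr ?IH //; apply: Pw; rewrite nu.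
Qed.

End LwordFacts.

HB.lock Definition bch (R : finComUnitRingType) (m : nat) : fra R m bool :=
  flog (fexp (letr R m false) * fexp (letr R m true)).

Definition pair2 (L : Type) (x y : L) (b : bool) := if b then y else x.

HB.lock Definition star (R : finComUnitRingType) (m : nat) (L : lmodType R)
    (br : L -> L -> L) (x y : L) : L :=
  lphi br (pair2 x y) (bch R m).

Lemma starE (R : finComUnitRingType) (m : nat) (L : lmodType R) (br : L -> L -> L) x y :
  star m br x y = lphi br (pair2 x y) (bch R m).
Proof. by rewrite star.unlock. Qed.

Section Star.
Variables (R : finComUnitRingType) (m : nat).
Hypothesis m0 : (0 < m)%N.
Hypothesis unitm : forall k, (0 < k <= m)%N -> (k%:R : R) \is a GRing.unit.

Section Subst.
Variables (X Y : finType) (s : Y -> fra R m X).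
Hypothesis s1 : forall y, fge 1 (s y).
Local Notation A := (fra R m X).

Definition fsub : fra R m Y -> A := flin (fun w => \prod_(y <- w) s y).
HB.instance Definition _ := GRing.Linear.on fsub.

Lemma fge_prodw (w : seq Y) : fge (size w) (\prod_(y <- w) s y).
Proof.
elim: w => [|y w IH]; first by rewrite big_nil.
by rewrite big_cons /= -add1n; apply: fgeM.
Qed.

Lemma fsub_wd w : fsub (wd w) = \prod_(y <- w) s y.
Proof. by apply: flin_wd0 => u hu; apply: (fge_eq0 hu); apply: fge_prodw. Qed.

Lemma fsubM f g : fsub (f * g) = fsub f * fsub g.
Proof.
move: f; apply: fra_ind => [a f h|a f h|u hu].
- by rewrite mulrDl -scalerAl linearP.
- by rewrite linearP mulrDl scalerAl.
move: g; apply: fra_ind => [a f h|a f h|v hv].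
- by rewrite mulrDr -scalerAr linearP.
- by rewrite linearP mulrDr scalerAr.
by rewrite wdM !fsub_wd big_cat.
Qed.

Lemma fsub1 : fsub 1 = 1.
Proof. by rewrite -wd0 fsub_wd big_nil. Qed.

Lemma fsub_exp f : fsub (fexp f) = fexp (fsub f).
Proof.
rewrite !fexpE linear_sum; apply: eq_bigr => k _; rewrite linearZ /=; congr (_ *: _).
by elim: (nat_of_ord k) => [|j IH]; rewrite ?expr0 ?fsub1 // !exprS fsubM IH.
Qed.

Lemma fsub_letr y : fsub (letr R m y) = s y.
Proof. by rewrite fsub_wd big_seq1. Qed.

Lemma fsub_dynA f : fsub (dynA f) = dyn (@cbr R A) s f.
Proof.
move: f; apply: fra_ind => [a f h|a f h|w hw]; try by rewrite !linearP.
rewrite dynA_wd // (dyn_wd (cbrN m0)).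
rewrite (@lword_morph _ _ _ _ _ (@cbr R A) fsub xpredT) ?linear0 //.
  by apply: eq_lword => y /=; rewrite fsub_letr.
by move=> f g _ _; rewrite !cbrE linearB /= !fsubM.
Qed.

End Subst.

Lemma fge1_letr (X : finType) (x : X) : fge 1 (letr R m x).
Proof. by apply/fge1P; rewrite fcoef_wd. Qed.

Lemma bchP : fge 1 (bch R m) /\ fexp (bch R m) = fexp (letr R m false) * fexp (letr R m true).
Proof.
rewrite bch.unlock; apply: flogP => //; rewrite fcoefM_nil !fexp_coef0 ?mulr1 //; exact: fge1_letr.
Qed.

Lemma inS_bchelt : inS (bch R m).
Proof.
have [b1 be] := bchP; apply: inS_bch b1 be => //; exact: inS_letter.
Qed.

Section StarA.
Variable X : finType.
Local Notation A := (fra R m X).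
Local Notation starA := (star m (@cbr R A)).
Implicit Types f g h : A.

(** A Lie element is a combination of brackets, so evaluating it through commutators or substituting
    into its words gives the same result. Substitution commutes with [fexp], which makes [star] the
    product of exponentials. *)
Lemma starA_sub f g : fge 1 f -> fge 1 g -> starA f g = fsub (pair2 f g) (bch R m).
Proof.
move=> f1 g1; have s1 y : fge 1 (pair2 f g y) by case: y.
by rewrite starE -[in RHS](inS_dyn m0 unitm inS_bchelt) fsub_dynA.
Qed.

Lemma fge_fsub (Y : finType) (s : Y -> A) k (f : fra R m Y) :
  (forall y, fge 1 (s y)) -> fge k f -> fge k (fsub s f).
Proof.
move=> s1 hf; apply: fge_sum => v _; case: (ltnP (size v) k) => hv.
  by rewrite hf // scale0r; apply: fge0.
by apply: fgeZ; apply: fgeW hv _; apply: fge_prodw.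
Qed.

Lemma fge1_starA f g : fge 1 f -> fge 1 g -> fge 1 (starA f g).
Proof.
move=> f1 g1; rewrite starA_sub //; apply: fge_fsub; first by case.
by case: bchP.
Qed.

Lemma fexp_starA f g : fge 1 f -> fge 1 g -> fexp (starA f g) = fexp f * fexp g.
Proof.
move=> f1 g1; have s1 y : fge 1 (pair2 f g y) by case: y.
by rewrite starA_sub // -fsub_exp //; case: bchP => _ ->; rewrite fsubM // !fsub_exp // !fsub_letr.
Qed.

Lemma inS_fge1 f : inS f -> fge 1 f.
Proof. by case=> /fge1P. Qed.

Lemma inS_starA f g : inS f -> inS g -> inS (starA f g).
Proof.
move=> fS gS; have f1 := inS_fge1 fS; have g1 := inS_fge1 gS.
by apply: inS_bch fS gS (fge1_starA f1 g1) (fexp_starA f1 g1).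
Qed.

Lemma starAA f g h : fge 1 f -> fge 1 g -> fge 1 h ->
  starA f (starA g h) = starA (starA f g) h.
Proof.
move=> f1 g1 h1.
have fg := fge1_starA f1 g1; have gh := fge1_starA g1 h1.
apply: (fexp_inj m0 (fge1_starA f1 gh) (fge1_starA fg h1)).
by rewrite (fexp_starA f1 gh) (fexp_starA fg h1) !fexp_starA // mulrA.
Qed.

Lemma starA0f f : fge 1 f -> starA 0 f = f.
Proof.
have h0 := @fge0 R m X 1; move=> f1.
apply: (fexp_inj m0 (fge1_starA h0 f1) f1).
by rewrite (fexp_starA h0 f1) fexp0 mul1r.
Qed.

Lemma starANf f : fge 1 f -> starA (- f) f = 0.
Proof.
have h0 := @fge0 R m X 1; move=> f1; have n1 := fgeN f1.
apply: (fexp_inj m0 (fge1_starA n1 f1) h0).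
by rewrite (fexp_starA n1 f1) fexp0 fexpN.
Qed.

Lemma cbr_inS f g : inS f -> inS g -> inS (cbr f g).
Proof.
move=> fS gS; split; first by have := inS_fge1 fS => f1; apply: (@cbr_fge2 R m X).
have E h z : inS h -> lact (m := m) (@cbr R A) (@letr R m X) h z = cbr h z.
  move=> hS; rewrite (lact_inS m0 unitm _ (@cbrP R A) (cbrN m0) _ hS) /lphi -/(dynA _).
  by rewrite inS_dyn.
rewrite cbrE linearB /= /dynA !(dynM (@cbrP R A) (cbrN m0)).
case: (fS) => f0 fD; case: (gS) => g0 gD.
rewrite f0 g0 !scale0r !addr0 -/(dynA f) -/(dynA g) fD gD !E //.
rewrite [fdeg (_ - _)]linearB /= !fdegM !cbrE opprB opprD !addrA; congr (_ - _).
by rewrite addrAC [f * _ + _]addrC.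
Qed.

End StarA.

Section StarL.
Variables (L : lmodType R) (br : L -> L -> L).
Hypothesis brP : is_lie_bracket br.
Hypothesis brN : lie_class br m.
Local Notation "x ** y" := (star m br x y) (at level 40).

Lemma lphi_star (X : finType) (al : X -> L) (f g : fra R m X) : inS f -> inS g ->
  lphi br al (star m (@cbr R _) f g) = lphi br al f ** lphi br al g.
Proof.
move=> fS gS; set S := (X in lphi br al X).
have -> : S = \sum_(v : {bseq m of bool}) fcoef (fdegV (bch R m)) v *: lword (@cbr R _) (pair2 f g) v by rewrite /S starE.
rewrite (linear_sum (lphi br al)) starE; apply: eq_bigr => v _; rewrite linearZ /=; congr (_ *: _).
rewrite (@lword_morph _ _ _ _ _ br (lphi br al) (@inS R m X)) ?linear0 //.
- by apply: eq_lword; case.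
- by case.
- by move=> x y; apply: cbr_inS.
by move=> x y xS yS; apply: lphi_br.
Qed.

(* Identities for star are pulled back from the free algebra on three letters. *)
Lemma lphi3 x y z : exists (al : 'I_3 -> L) (f g h : fra R m 'I_3),
  [/\ inS f, inS g & inS h] /\ [/\ lphi br al f = x, lphi br al g = y & lphi br al h = z].
Proof.
exists (fun i : 'I_3 => nth 0 [:: x; y; z] i).
exists (letr R m ord0), (letr R m (inord 1)), (letr R m (inord 2)).
by split; split; rewrite ?lphi_letter //; try exact: inS_letter; rewrite inordK.
Qed.

Lemma starA x y z : x ** (y ** z) = (x ** y) ** z.
Proof.
have [al [f [g [h [[fS gS hS] [<- <- <-]]]]]] := lphi3 x y z.
rewrite -!lphi_star //; try exact: inS_starA.
by rewrite starAA //; exact: inS_fge1.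
Qed.

Lemma star0x x : 0 ** x = x.
Proof.
have [al [f [_ [_ [[fS _ _] [<- _ _]]]]]] := lphi3 x x x.
rewrite -[X in X ** _](_ : lphi br al (0 : fra R m 'I_3) = 0); last by rewrite linear0.
rewrite -lphi_star //; last exact: inS0.
by rewrite starA0f //; apply: inS_fge1.
Qed.

Lemma starNx x : (- x) ** x = 0.
Proof.
have [al [f [_ [_ [[fS _ _] [<- _ _]]]]]] := lphi3 x x x.
rewrite -linearN -lphi_star //; last exact: inSN.
by rewrite starANf ?linear0 //; apply: inS_fge1.
Qed.

Lemma bch_lead : fge 2 ((bch R m) - (letr R m false + letr R m true)).
Proof.
have [b1 be] := bchP.
have z1 := @fge0 R m bool 1.
have x1 := @fge1_letr bool false; have y1 := @fge1_letr bool true.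
move: be; set x := letr R m false; set y := letr R m true => be.
have eb : fge 2 (fexp (bch R m) - 1 - (bch R m)).
  by have := @fexp_diff _ _ _ m0 1 _ _ b1 z1; rewrite subr0 fexp0; apply.
have ex : fge 2 (fexp x - 1 - x).
  by have := @fexp_diff _ _ _ m0 1 _ _ x1 z1; rewrite subr0 fexp0; apply.
have ey : fge 2 (fexp y - 1 - y).
  by have := @fexp_diff _ _ _ m0 1 _ _ y1 z1; rewrite subr0 fexp0; apply.
have x1' : fge 1 (fexp x - 1) by apply/fge1P; rewrite fcoefB fexp_coef0 // fcoef1 // subrr.
have y1' : fge 1 (fexp y - 1) by apply/fge1P; rewrite fcoefB fexp_coef0 // fcoef1 // subrr.
have -> : (bch R m) - (x + y) = (fexp x - 1) * (fexp y - 1) + (fexp x - 1 - x) + (fexp y - 1 - y)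
     - (fexp (bch R m) - 1 - (bch R m)).
  rewrite be mulrBl mulrBr mul1r mulr1.
  move: (fexp x * fexp y) (fexp x) (fexp y) => a b c.
  rewrite !opprB opprD [RHS](AC ((((2*2)*3)*3)*(1*2))
    ((11*(7*10)) * (1*13) * (2*5) * (3*6) * (4*8) * (9*12))) /=.
  by rewrite !subrr !addNr !addr0.
by apply: fgeB => //; apply: fgeD => //; apply: fgeD => //; apply: (@fgeM _ _ _ 1 1).
Qed.

End StarL.
End Star.

(** * Groups and Lie algebras generated by the same elements *)

Section StarMore.
Variables (R : finComUnitRingType) (m : nat).
Hypothesis m0 : (0 < m)%N.
Hypothesis unitm : forall k, (0 < k <= m)%N -> (k%:R : R) \is a GRing.unit.

Section OneLie.
Variables (L : lmodType R) (br : L -> L -> L).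
Hypothesis brP : is_lie_bracket br.
Hypothesis brN : lie_class br m.
Local Notation "x ** y" := (star m br x y) (at level 40).

Lemma starx0 x : x ** 0 = x.
Proof.
rewrite -{1}[x]opprK -(starNx m0 unitm brP brN x) starA // starNx //.
by rewrite star0x.
Qed.
Lemma starxN x : x ** (- x) = 0.
Proof. by rewrite -{1}[x]opprK starNx. Qed.
Lemma starKx x y : (- x) ** (x ** y) = y.
Proof. by rewrite starA // starNx // star0x. Qed.

Lemma star_expand (P : L -> Prop) x y : P 0 ->
  (forall a u v, P u -> P v -> P (a *: u + v)) ->
  (forall w, (1 < size w <= m)%N -> P (lword br (pair2 x y) w)) -> P (x ** y - (x + y)).
Proof.
move=> P0 Plin Pw; have := @bch_lead R m m0.
set b := (X in fge 2 X) => hb.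
have -> : x ** y - (x + y) = lphi br (pair2 x y) b.
  have lD (f g : fra R m bool) : lphi br (pair2 x y) (f + g) =
      lphi br (pair2 x y) f + lphi br (pair2 x y) g by rewrite linearD.
  by rewrite starE [RHS]linearB /= lD !lphi_letter.
rewrite /lphi /dyn /flin; elim/big_rec: _ => // v z _ Pz.
case: (ltnP (size v) 2) => hv; last by apply: Plin => //; apply: Pw; rewrite hv size_bseq.
by rewrite fcoef_degV hb // mulr0 scale0r add0r.
Qed.

Lemma star_comm x y : br x y = 0 -> x ** y = x + y.
Proof.
move=> xy; apply/eqP; rewrite -subr_eq0; apply/eqP.
apply: (star_expand (P := fun z => z = 0)) => // [a u v -> ->|w]; first by rewrite scaler0 addr0.
have yx : br y x = 0 by rewrite (lieC brP) xy oppr0.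
have B (b c : bool) : br (pair2 x y b) (pair2 x y c) = 0.
  by case: b; case: c => //=; rewrite (liexx brP).
elim: w => // b [|c [|d w]] IH hw //=.
rewrite [X in br _ X](_ : _ = 0) ?(lie0r brP) //; apply: IH.
by move: hw; rewrite /= => /ltnW.
Qed.

Lemma star_natmul x k : (x *+ k) ** x = x *+ k.+1.
Proof.
rewrite star_comm ?mulrSr //.
by rewrite -scaler_nat (lieZl brP) (liexx brP) scaler0.
Qed.

Lemma star_mod (P : L -> Prop) x y : P 0 ->
  (forall a u v, P u -> P v -> P (a *: u + v)) ->
  (forall u v, P (br u v)) -> P (x ** y - (x + y)).
Proof.
move=> P0 Plin Pbr; apply: star_expand => // -[//|a [//|b w]] _.
exact: Pbr.
Qed.

End OneLie.

Lemma lphi_morph (L M : lmodType R) (br : L -> L -> L) (br' : M -> M -> M) (phi : L -> M)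
    (X : finType) (al : X -> L) (f : fra R m X) :
  linear phi -> (forall x y, phi (br x y) = br' (phi x) (phi y)) ->
  phi (lphi br al f) = lphi br' (phi \o al) f.
Proof.
move=> lphi pbr.
pose p1 : {linear L -> M} := HB.pack phi (GRing.isLinear.Build _ _ _ _ phi lphi).
rewrite -[phi _]/(p1 _) linear_sum; apply: eq_bigr => v _; rewrite linearZ /=; congr (_ *: _).
by apply: (@lword_morph _ _ _ _ _ br' phi xpredT) => //; apply: (linear0 p1).
Qed.

Lemma star_morph (L M : lmodType R) (br : L -> L -> L) (br' : M -> M -> M) (phi : L -> M) x y :
  linear phi -> (forall x y, phi (br x y) = br' (phi x) (phi y)) ->
  phi (star m br x y) = star m br' (phi x) (phi y).
Proof.
move=> lphi pbr; rewrite !starE (lphi_morph _ _ lphi pbr).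
by apply: eq_lphi; case.
Qed.

Definition pbr (L M : lmodType R) (br : L -> L -> L) (br' : M -> M -> M)
  (u v : L * M) : L * M := (br u.1 v.1, br' u.2 v.2).

Lemma pbrP (L M : lmodType R) (br : L -> L -> L) (br' : M -> M -> M) :
  is_lie_bracket br -> is_lie_bracket br' -> is_lie_bracket (pbr br br').
Proof.
move=> [a1 b1 c1 d1] [a2 b2 c2 d2]; split.
- by move=> a x y z; rewrite /pbr /= a1 a2.
- by move=> a x y z; rewrite /pbr /= b1 b2.
- by move=> x; rewrite /pbr /= c1 c2.
by move=> x y z; rewrite /pbr; congr (_, _) => /=; [apply: d1 | apply: d2].
Qed.

Lemma pbrN (L M : lmodType R) (br : L -> L -> L) (br' : M -> M -> M) :
  lie_class br m -> lie_class br' m -> lie_class (pbr br br') m.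
Proof.
move=> h h' s y hs.
have -> : foldr (pbr br br') y s = (foldr br y.1 (map fst s), foldr br' y.2 (map snd s)).
  by elim: s {hs} => [|x s IH] //=; [case: y | rewrite IH].
by rewrite h ?h' ?size_map.
Qed.

Lemma star_pair (L M : lmodType R) (br : L -> L -> L) (br' : M -> M -> M) u v :
  star m (pbr br br') u v = (star m br u.1 v.1, star m br' u.2 v.2).
Proof.
rewrite [LHS]surjective_pairing; congr (_, _).
  by apply: (@star_morph (L * M)%type).
by apply: (@star_morph (L * M)%type).
Qed.

Section Generation.
Hypothesis natR : forall c : R, exists k, c = k%:R.
Variable X : finType.
Local Notation A := (fra R m X).
Local Notation "f ** g" := (star m (@cbr R A) f g) (at level 40).
Local Notation lw := (lword (@cbr R A) (@letr R m X)).
Implicit Types f g h : A.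
Let AP : is_lie_bracket (@cbr R A) := @cbrP R A.
Let AN : lie_class (@cbr R A) m := cbrN m0.

Lemma fge_fexp1 k f : (0 < k)%N -> fge k f -> fge k.+1 (fexp f - 1 - f).
Proof.
move=> k0 hf; have z1 := @fge0 R m X 1.
by have := @fexp_diff _ _ _ m0 k _ _ (fgeW k0 hf) z1; rewrite subr0 fexp0; apply.
Qed.

Lemma fge_fexpV k f : fge 1 f -> fge k (fexp f - 1) -> fge k f.
Proof.
move=> f1 hk; have H l : (l < k)%N -> fge l.+1 f.
  elim: l => // l IH hl.
  have h := fge_fexp1 (ltn0Sn l) (IH (ltnW hl)).
  have e : (fexp f - 1) - (fexp f - 1 - f) = f by rewrite subKr.
  by rewrite -e; apply: fgeB => //; apply: fgeW hk.
by case: k hk H => [|k] hk H //; apply: H.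
Qed.

Definition scomm f g := ((- f) ** (- g)) ** (f ** g).

(** With F = exp f - 1 and G = exp g - 1, the exponential of the group commutator minus 1 is
    [E * cbr F G], where [E] has constant term 1; and F, G have leading terms [f], [g]. *)
Lemma scomm_lead i j f g : (0 < i)%N -> (0 < j)%N -> fge i f -> fge j g ->
  fge (i + j).+1 (scomm f g - cbr f g).
Proof.
move=> i0 j0 hf hg; have f1 := fgeW i0 hf; have g1 := fgeW j0 hg.
have nf := fgeN f1; have ng := fgeN g1.
have fg1 := fge1_starA m0 unitm f1 g1.
have nfg1 := fge1_starA m0 unitm nf ng.
have c1 : fge 1 (scomm f g) by apply: (fge1_starA m0 unitm).
pose F := fexp f - 1; pose G := fexp g - 1.
have hF := fge_fexp1 i0 hf; have hG := fge_fexp1 j0 hg.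
have hF' : fge i F by rewrite -[F](subrK f); apply: fgeD => //; apply: fgeW hF.
have hG' : fge j G by rewrite -[G](subrK g); apply: fgeD => //; apply: fgeW hG.
have lead : fge (i + j).+1 (cbr F G - cbr f g).
  have -> : cbr F G - cbr f g = cbr (F - f) G + cbr f (G - g).
    move: F G {hF hG hF' hG'} => F G.
    by rewrite (lieDl AP) (lieDr AP) (lieNl AP) (lieNr AP) addrA subrK.
  apply: fgeD; first by rewrite -addSn; apply: fge_cbr.
  by rewrite -addnS; apply: fge_cbr.
pose E := fexp (- f) * fexp (- g).
have ec : fexp (scomm f g) - 1 = E * cbr F G.
  rewrite /scomm (fexp_starA m0 unitm nfg1 fg1) (fexp_starA m0 unitm nf ng).
  rewrite (fexp_starA m0 unitm f1 g1) -/E.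
  have e1 : E * (fexp g * fexp f) = 1.
    by rewrite /E mulrA -[_ * _ * fexp g]mulrA fexpN // mulr1 fexpN.
  rewrite -[X in _ - X]e1 -mulrBr; congr (_ * _).
  rewrite cbrE /F /G !mulrBl !mulrBr !mul1r !mulr1.
  move: (fexp f * fexp g) (fexp g * fexp f) (fexp f) (fexp g) => a b c d.
  rewrite !opprB [RHS](AC ((2*2)*(2*2)) ((1*8)*(2*5)*(3*6)*(4*7))) /=.
  by rewrite subrr !addNr !addr0.
have E1 : fge 1 (E - 1).
  by apply/fge1P; rewrite fcoefB fcoefM_nil !fexp_coef0 // mulr1 fcoef1 // subrr.
have l2 : fge (i + j).+1 (fexp (scomm f g) - 1 - cbr f g).
  have -> : fexp (scomm f g) - 1 - cbr f g = (E - 1) * cbr F G + (cbr F G - cbr f g).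
    by rewrite ec mulrBl mul1r addrA subrK.
  by apply: fgeD => //; rewrite -add1n; apply: fgeM => //; apply: fge_cbr.
have hc : fge (i + j)%N (scomm f g).
  apply: fge_fexpV => //; rewrite -[fexp _ - 1](subrK (cbr f g)).
  by apply: fgeD; [apply: fgeW l2 | apply: fge_cbr].
have ij0 : (0 < i + j)%N by rewrite addn_gt0 i0.
have := fge_fexp1 ij0 hc => l3.
have -> : scomm f g - cbr f g = (fexp (scomm f g) - 1 - cbr f g)
     - (fexp (scomm f g) - 1 - scomm f g).
  by move: (fexp (scomm f g) - 1) (scomm f g) (cbr f g) => t z y; rewrite opprB [RHS]addrC addrA subrK.
exact: fgeB.
Qed.

Lemma starA_lead d f g : (0 < d)%N -> fge d f -> fge d g -> fge d.+1 (f ** g - (f + g)).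
Proof.
move=> d0 hf hg.
have := star_expand AN (P := fun u : A => fge d.+1 u) (x := f) (y := g) (@fge0 R m X _).
apply; first by move=> a u v hu hv; apply: fgeD => //; apply: fgeZ.
move=> [|b [|c w]] // _.
have P2 b' : fge d (pair2 f g b') by case: b'.
have H : forall w', ~~ nilp w' -> fge d (lword (@cbr R A) (pair2 f g) w').
  elim=> // x w' IH _ /=; case: ifP => // nw; apply: fgeW (fge_cbr (P2 x) (IH _)); last by rewrite nw.
  by rewrite leq_addl.
rewrite lword_cons //; apply: fgeW (fge_cbr (P2 b) (H (c :: w) isT)).
by rewrite -addn1 leq_add2l.
Qed.

Section LieGen.
Variable H : A -> Prop.
Hypotheses (H0 : H 0) (HS : forall f, H f -> inS f) (HN : forall f, H f -> H (- f))
  (Hstar : forall f g, H f -> H g -> H (f ** g)) (Hlet : forall x, H (letr R m x)).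

(** Every scalar is a natural number by [natR], and natural multiples are [star] powers, so closure
    under [star] is enough. *)
Lemma HZ c f : H f -> H (c *: f).
Proof.
case: (natR c) => k -> hf; rewrite scaler_nat; elim: k => [|k IH]; first by rewrite mulr0n.
by rewrite -(star_natmul AP AN); apply: Hstar.
Qed.

Lemma Hword w : ~~ nilp w -> exists2 g, H g & fge (size w).+1 (g - lw w).
Proof.
elim: w => // x w IH _; case: (boolP (nilp w)) => nw.
  by exists (letr R m x) => //=; rewrite nw subrr; apply: fge0.
have [g hg eg] := IH nw; exists (scomm (letr R m x) g).
  by apply: Hstar; apply: Hstar => //; apply: HN.
rewrite lword_cons //.
have sw : (0 < size w)%N by case: (w) nw.
have gw : fge (size w) g.
  rewrite -[g](subrK (lw w)); apply: fgeD; first exact: fgeW eg.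
  by move=> u hu; apply: lword_hom; rewrite neq_ltn hu.
have l1 := @fge1_letr R m X x.
have := scomm_lead (ltn0Sn 0) sw l1 gw; rewrite add1n => h.
rewrite -[scomm _ _](subrK (cbr (letr R m x) g)) -addrA; apply: fgeD => //.
rewrite -(lieNr AP) -(lieDr AP); exact: (@fge_cbr _ _ _ 1 (size w).+1).
Qed.

(** Any combination of brackets of length d is the leading term of an element of [H]: to leading
    order [star] is addition, and [Hword] supplies the single brackets. *)
Lemma Hlead d (c : {bseq m of X} -> R) (r : seq {bseq m of X}) : (0 < d)%N ->
  exists2 g, H g /\ fge d g & fge d.+1 (g - \sum_(v <- r | size v == d) c v *: lw v).
Proof.
move=> d0; elim: r => [|v r [g [Hg gd] eg]].
  by exists 0; [split; [|exact: fge0] | rewrite big_nil subrr; apply: fge0].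
rewrite big_cons; case: eqP => hv; last by exists g.
have nv : ~~ nilp v by rewrite /nilp hv -lt0n.
have [h Hh eh] := Hword nv; rewrite hv in eh.
have hd : fge d h.
  rewrite -[h](subrK (lw v)); apply: fgeD; first exact: fgeW eh.
  by move=> u hu; apply: lword_hom; rewrite hv neq_ltn hu.
have chd : fge d (c v *: h) by apply: fgeZ.
have l := starA_lead d0 chd gd.
exists ((c v *: h) ** g).
  split; first by apply: Hstar => //; apply: HZ.
  rewrite -[_ ** _](subrK (c v *: h + g)); apply: fgeD; first exact: fgeW l.
  exact: fgeD.
rewrite -[_ ** _](subrK (c v *: h + g)) -addrA; apply: fgeD => //.
rewrite opprD addrACA -scalerBr; apply: fgeD => //; exact: fgeZ.
Qed.

(* Induction on leading terms: group commutator and Lie bracket have the same leading term. *)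
Lemma inS_gen f : inS f -> H f.
Proof.
suff K k : forall d f, (0 < d)%N -> (d + k = m.+1)%N -> inS f -> fge d f -> H f.
  by move=> fS; apply: (K m 1) => //; apply: inS_fge1.
elim: k => [|k IH] d g d0 hd gS hg.
  by rewrite addn0 in hd; rewrite (fge_eq0 _ hg) // hd.
have [h [Hh hh] eh] := Hlead (fun v => fcoef (pr d (fdegV g)) v) (index_enum _) d0.
have e : \sum_(v : {bseq m of X} | size v == d) fcoef (pr d (fdegV g)) v *: lw v = pr d g.
  rewrite -[in RHS](inS_dyn m0 unitm gS) -dynA_pr // /dynA /dyn /flin [RHS](bigID (fun v : {bseq m of X} => size v == d)) /=.
  rewrite [X in _ + X]big1 ?addr0 // => v hv; by rewrite fcoef_pr (negPf hv) scale0r.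
rewrite e in eh.
have h1 := fgeW d0 hh; have g1 := fgeW d0 hg; have nh1 := fgeN h1.
have nh : fge d (- h) by apply: fgeN.
have HsS : inS ((- h) ** g) by apply: inS_starA => //; apply: inSN; apply: HS.
have s1 : fge d.+1 ((- h) ** g).
  rewrite -[_ ** _](subrK (- h + g)); apply: fgeD; first exact: starA_lead.
  have -> : - h + g = (g - pr d g) - (h - pr d g) by rewrite opprB addrA subrK addrC.
  by apply: fgeB => //; apply: fge_split.
have -> : g = h ** ((- h) ** g).
  have hs1 := fgeW (ltn0Sn d) s1; have z1 := @fge0 R m X 1.
  by rewrite (starAA m0 unitm h1 nh1 g1) -{1}[h]opprK (starANf m0 unitm nh1) (starA0f m0 unitm g1).
by apply: Hstar => //; apply: (IH d.+1) => //; rewrite addSnnS.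
Qed.

End LieGen.
End Generation.

Section SubLie.
Hypothesis natR : forall c : R, exists k, c = k%:R.
Variables (L : lmodType R) (br : L -> L -> L).
Hypothesis brP : is_lie_bracket br.
Hypothesis brN : lie_class br m.
Variable H : L -> Prop.
Hypotheses (H0 : H 0) (HN : forall x, H x -> H (- x))
  (Hstar : forall x y, H x -> H y -> H (star m br x y)).

(** The Lie elements whose value lies in [H] contain the letters and are closed under [star], hence
    are all Lie elements by [inS_gen]. Taking [f] to be the sum or the commutator of the two letters
    replaces the inversion formulas expressing addition and bracket through [star]. *)
Lemma sub_lphi x y (f : fra R m bool) : H x -> H y -> inS f -> H (lphi br (pair2 x y) f).
Proof.
move=> hx hy fS.
suff : inS f /\ H (lphi br (pair2 x y) f) by case.
apply: (inS_gen natR (H := fun g => inS g /\ H (lphi br (pair2 x y) g))) => //.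
- by split; [exact: inS0 | rewrite linear0].
- by move=> g [].
- by move=> g [gS gH]; split; [exact: inSN | rewrite linearN; apply: HN].
- by move=> g h [gS gH] [hS hH]; split; [exact: inS_starA | rewrite lphi_star //; apply: Hstar].
by move=> b; split; [exact: inS_letter | rewrite lphi_letter //; case: b].
Qed.

Lemma subD x y : H x -> H y -> H (x + y).
Proof.
move=> hx hy; have := @sub_lphi x y (letr R m false + letr R m true) hx hy.
rewrite linearD /= !lphi_letter //; apply; apply: inSD; exact: inS_letter.
Qed.

Lemma subBr x y : H x -> H y -> H (br x y).
Proof.
move=> hx hy; have := @sub_lphi x y (cbr (letr R m false) (letr R m true)) hx hy.
have l b := @inS_letter R m bool m0 b.
by rewrite lphi_br // !lphi_letter //; apply; apply: cbr_inS.
Qed.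

Lemma subZ c x : H x -> H (c *: x).
Proof.
case: (natR c) => k -> hx; rewrite scaler_nat; elim: k => [|k IH]; first by rewrite mulr0n.
by rewrite mulrSr; apply: subD.
Qed.
End SubLie.

Section GroupHom.
Hypothesis natR : forall c : R, exists k, c = k%:R.
Variables (L M : lmodType R) (br : L -> L -> L) (br' : M -> M -> M).
Hypotheses (brP : is_lie_bracket br) (brN : lie_class br m).
Hypotheses (brP' : is_lie_bracket br') (brN' : lie_class br' m).
Variable phi : L -> M.
Hypothesis phi_star : forall x y, phi (star m br x y) = star m br' (phi x) (phi y).

(* The graph of phi is a subgroup of the product, hence a Lie subring. *)
Lemma star_hom_lie :
  [/\ forall x y, phi (x + y) = phi x + phi y, forall c x, phi (c *: x) = c *: phi x &
      forall x y, phi (br x y) = br' (phi x) (phi y)].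
Proof.
have p0 : phi 0 = 0.
  have := phi_star 0 0; rewrite (star0x m0 unitm brP brN) => e.
  by rewrite -[LHS](starKx brP' brN' (phi 0)) -e (starNx m0 unitm brP' brN').
have pN x : phi (- x) = - phi x.
  rewrite -[LHS](starKx brP' brN' (phi x)) -phi_star starxN // p0.
  by rewrite (starx0 brP' brN').
pose G (u : (L * M)%type) := phi u.1 = u.2.
have G0 : G 0 by [].
have GN u : G u -> G (- u) by rewrite /G /= pN => ->.
have Gs u v : G u -> G v -> G (star m (pbr br br') u v).
  by rewrite /G star_pair /= phi_star => -> ->.
have P2 := pbrP brP brP'; have N2 := pbrN brN brN'.
split.
- by move=> x y; apply: (subD natR P2 N2 G0 GN Gs (x := (x, phi x)) (y := (y, phi y))).
- by move=> c x; apply: (subZ natR P2 N2 G0 GN Gs c (x := (x, phi x))).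
by move=> x y; apply: (subBr natR P2 N2 G0 GN Gs (x := (x, phi x)) (y := (y, phi y))).
Qed.
End GroupHom.
End StarMore.

(** * The graded Lie ring of the lower central series *)

Section Lcn.
Variables (gT : finGroupType) (E : {group gT}).
Local Open Scope group_scope.

(** Induction on i, with the three subgroups lemma applied in the quotient by the target term. *)
Lemma lcn_commG i j : (0 < i)%N -> (0 < j)%N -> [~: 'L_i(E), 'L_j(E)] \subset 'L_(i + j)(E).
Proof.
case: i => // i _; elim: i j => [|i IH] j j0.
  by rewrite lcn1 commGC add1n; case: j j0 => // j _; rewrite lcnSn.
rewrite lcnSn; pose N := 'L_(i.+2 + j)(E)%G; change 'L_(i.+2 + j)(E) with (gval N).
have nN k : 'L_k(E) \subset 'N(N).
  exact: subset_trans (lcn_sub _ _) (lcn_norm _ _).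
have nE : E \subset 'N(N) := lcn_norm _ _.
rewrite -quotient_sub1; last by rewrite !comm_subG ?nN ?nE.
have nj := nN j; have ni := nN i.+1.
have n1 : [~: E, 'L_j(E)] \subset 'N(N) by rewrite comm_subG.
have n2 : [~: 'L_j(E), 'L_i.+1(E)] \subset 'N(N) by rewrite comm_subG.
have n3 : [~: 'L_i.+1(E), E] \subset 'N(N) by rewrite comm_subG.
rewrite !quotientR //.
have t : [~: E / N, 'L_j(E) / N, 'L_i.+1(E) / N] :=: 1.
  apply/eqP; rewrite -!quotientR // -subG1 quotient_sub1; last by rewrite comm_subG.
  have s : [~: 'L_j.+1(E), 'L_i.+1(E)] \subset N by rewrite commGC /N addSnnS; apply: IH.
  by apply: subset_trans s; apply: commSg; rewrite commGC; apply: lcnSnS.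
have t' : [~: 'L_j(E) / N, 'L_i.+1(E) / N, E / N] :=: 1.
  apply/eqP; rewrite -!quotientR // -subG1 quotient_sub1; last by rewrite comm_subG.
  have s : [~: 'L_(i.+1 + j)(E), E] \subset N by rewrite /N addSn; apply: lcnSnS.
  by apply: subset_trans s; apply: commSg; rewrite commGC; apply: IH.
by rewrite (three_subgroup t t').
Qed.

Lemma lcn_comm i j x y : (0 < i)%N -> (0 < j)%N -> x \in 'L_i(E) -> y \in 'L_j(E) ->
  [~ x, y] \in 'L_(i + j)(E).
Proof. by move=> i0 j0 hx hy; apply: (subsetP (lcn_commG i0 j0)); apply: mem_commg. Qed.

Lemma gen_ind (A : {set gT}) (P : gT -> Prop) :
  P 1 -> (forall x y, x \in A -> y \in <<A>> -> P y -> P (x * y)) -> forall x, x \in <<A>> -> P x.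
Proof.
move=> P1 PM x /gen_prodgP [n [c hc ->]].
elim: n c hc => [|n IH] c hc; first by rewrite big_ord0.
rewrite big_ord_recl; apply: PM => //; last by apply: IH.
by apply: group_prod => i _; apply: mem_gen.
Qed.
End Lcn.

Section Good.
Variables (gT : finGroupType) (E : {group gT}) (V : zmodType).
Local Notation L n := ('L_n(E)%g).
Implicit Types (c : gT -> V) (n i j k : nat).

(* c induces a morphism on the n-th factor of the lower central series. *)
Definition good n c :=
  (forall z z', z \in L n -> z' \in L n -> c (z * z')%g = c z + c z') /\
  (forall z, z \in L n.+1 -> c z = 0).

Section OneGood.
Variables (n : nat) (c : gT -> V).
Hypothesis gc : good n c.

Lemma good1 : c 1%g = 0. Proof. by case: gc => _; apply; apply: group1. Qed.
Lemma goodV z : z \in L n -> c z^-1%g = - c z.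
Proof.
move=> hz; apply/eqP; rewrite -addr_eq0; case: (gc) => a _.
by rewrite -a ?groupV // mulVg good1.
Qed.
Lemma goodJ z g : (0 < n)%N -> z \in L n -> g \in E -> c (z ^ g)%g = c z.
Proof.
move=> n0 hz hg; have hr : [~ z, g]%g \in L n.+1.
  by rewrite -addn1; apply: lcn_comm.
rewrite conjg_mulR; case: gc => a b; rewrite a ?(b _ hr) ?addr0 //.
by apply: (subsetP (lcn_subS n E)).
Qed.
End OneGood.

Lemma lcnE_sub n x : x \in L n -> x \in E. Proof. exact: (subsetP (lcn_sub _ _)). Qed.

Lemma good_br n i j c u : good n c -> (0 < i)%N -> (0 < j)%N -> (i + j = n)%N -> u \in L i ->
  good j (fun z => c [~ u, z]%g).
Proof.
move=> gc i0 j0 e hu; split=> [z z' hz hz'|z hz]; last first.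
  by case: gc => _; apply; rewrite -e -addnS; apply: lcn_comm.
have h1 : [~ u, z]%g \in L n by rewrite -e; apply: lcn_comm.
have h2 : [~ u, z']%g \in L n by rewrite -e; apply: lcn_comm.
have hE := lcnE_sub hz'; have n0 : (0 < n)%N by rewrite -e addn_gt0 i0.
rewrite commgMJ; case: (gc) => a _; rewrite a //; first by rewrite addrC (goodJ gc).
by rewrite memJ_norm // (subsetP (lcn_norm _ _)).
Qed.

Lemma good_anti n i j c u v : good n c -> (0 < i)%N -> (0 < j)%N -> (i + j = n)%N ->
  u \in L i -> v \in L j -> c [~ v, u]%g = - c [~ u, v]%g.
Proof.
move=> gc i0 j0 e hu hv; rewrite -invg_comm (goodV gc) //.
by rewrite -e; apply: lcn_comm.
Qed.

Lemma good_brl n i j c u : good n c -> (0 < i)%N -> (0 < j)%N -> (i + j = n)%N -> u \in L i ->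
  good j (fun z => c [~ z, u]%g).
Proof.
move=> gc i0 j0 e hu; have [g1 g2] := good_br gc i0 j0 e hu.
split=> [z z' hz hz'|z hz].
  by rewrite !(good_anti gc i0 j0 e hu) ?groupM // g1 // opprD.
have hz' : z \in L j := subsetP (lcn_subS j E) z hz.
by rewrite (good_anti gc i0 j0 e hu hz') g2 // oppr0.
Qed.

(** This is the Hall-Witt identity read through [c], which ignores conjugation and turns inverses
    into signs. *)
Lemma good_jacobi n i j k c u v w : good n c -> (0 < i)%N -> (0 < j)%N -> (0 < k)%N ->
  (i + j + k = n)%N -> u \in L i -> v \in L j -> w \in L k ->
  c [~ [~ u, v], w]%g = c [~ u, [~ v, w]]%g - c [~ v, [~ u, w]]%g.
Proof.
have H a b d i' j' k' : good n c -> (0 < i')%N -> (0 < j')%N -> (0 < k')%N ->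
    (i' + j' + k' = n)%N -> a \in L i' -> b \in L j' -> d \in L k' ->
    c ([~ a, b^-1, d] ^ b)%g = - c [~ [~ a, b], d]%g /\ ([~ a, b^-1, d] ^ b)%g \in L n.
  move=> gc i0 j0 k0 e ha hb hd.
  have hbV : b^-1%g \in L j' by rewrite groupV.
  have hab := lcn_comm i0 j0 ha hbV.
  have ij0 : (0 < i' + j')%N by rewrite addn_gt0 i0.
  have habd : [~ a, b^-1, d]%g \in L n by rewrite -e; apply: lcn_comm.
  have n0 : (0 < n)%N by rewrite -e !addn_gt0 i0.
  split; last by rewrite memJ_norm // (subsetP (lcn_norm _ _)) // (lcnE_sub hb).
  rewrite (goodJ gc) //; last exact: lcnE_sub hb.
  have g1 : good (i' + j') (fun z => c [~ z, d]%g).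
    by apply: (good_brl gc k0) => //; rewrite addnC.
  have g2 : good j' (fun z => c [~ [~ a, z], d]%g) := good_br g1 i0 j0 (erefl _) ha.
  exact: (goodV g2).
move=> gc i0 j0 k0 e hu hv hw.
have [e1 m1] := H u v w i j k gc i0 j0 k0 e hu hv hw.
have n2 : (j + k + i = n)%N by rewrite -e addnC addnA.
have n3 : (k + i + j = n)%N by rewrite -e -addnA addnC.
have [e2 m2] := H v w u j k i gc j0 k0 i0 n2 hv hw hu.
have [e3 m3] := H w u v k i j gc k0 i0 j0 n3 hw hu hv.
have := Hall_Witt_identity u v w => /(congr1 c); rewrite (good1 gc).
case: (gc) => a _; rewrite (a _ _ (groupM m1 m2) m3) (a _ _ m1 m2) e1 e2 e3.
have hvw := lcn_comm j0 k0 hv hw; have huw := lcn_comm i0 k0 hu hw.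
have jk0 : (0 < j + k)%N by rewrite addn_gt0 j0.
have ik0 : (0 < i + k)%N by rewrite addn_gt0 i0.
rewrite (good_anti gc i0 jk0 _ hu hvw) ?addnA //.
have ki0 : (0 < k + i)%N by rewrite addn_gt0 k0.
have g1 : good (k + i) (fun z => c [~ z, v]%g).
  by apply: (good_brl gc j0 ki0 _ hv); rewrite addnC.
have -> : c [~ [~ w, u], v]%g = - c [~ [~ u, w], v]%g.
  by apply: (good_anti g1 i0 k0) => //; rewrite addnC.
rewrite (good_anti gc j0 ik0 _ hv huw) ?opprK; last by rewrite addnA [(j + i)%N]addnC.
by rewrite -addrA addrC => /eqP; rewrite subr_eq0 => /eqP ->.
Qed.
End Good.

(** * Dynkin's identity for commutators in a group *)

Section FlinMul.
Variables (R : finComUnitRingType) (m : nat) (X : finType) (V : lmodType R).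
Local Notation A := (fra R m X).
Implicit Types (f : A) (g : seq X -> V).

Lemma flin_hom d f g g' : fhom d f -> (forall v, size v = d -> g v = g' v) -> flin g f = flin g' f.
Proof.
move=> hf e; apply: eq_bigr => v _; case: (eqVneq (size v) d) => [/e -> //|hv].
by rewrite hf // !scale0r.
Qed.

Lemma flin_letrM d f g x : (d < m)%N -> fhom d f ->
  flin g (letr R m x * f) = flin (fun v => g (x :: v)) f.
Proof.
move=> dm hf; rewrite {1}(fra_sum f) mulr_sumr linear_sum; apply: eq_bigr => v _.
rewrite -scalerAr linearZ /=; case: (eqVneq (size v) d) => hv; last by rewrite hf // !scale0r.
by rewrite wdM flin_wd //= hv.
Qed.

Lemma flin_Mletr d f g x : (d < m)%N -> fhom d f ->
  flin g (f * letr R m x) = flin (fun v => g (rcons v x)) f.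
Proof.
move=> dm hf; rewrite {1}(fra_sum f) mulr_suml linear_sum; apply: eq_bigr => v _.
rewrite -scalerAl linearZ /=; case: (eqVneq (size v) d) => hv; last by rewrite hf // !scale0r.
by rewrite wdM cats1 flin_wd // size_rcons hv.
Qed.
End FlinMul.

Section GrDynkin.
Variables (R : finComUnitRingType) (m : nat) (X : finType) (V : lmodType R).
Hypothesis m0 : (0 < m)%N.
Variables (gT : finGroupType) (E : {group gT}) (e : X -> gT).
Hypothesis eE : forall x, e x \in E.
Local Notation A := (fra R m X).
Local Notation lw := (lword (@cbr R A) (@letr R m X)).
Implicit Types (c : gT -> V) (w : seq X).

(** The counterparts of [lactw] and [lword] with group commutators in place of brackets. *)
Definition gact w a := foldr (fun x b => [~ e x, b]%g) a w.
Fixpoint gcom w := if w is x :: w' then (if nilp w' then e x else [~ e x, gcom w']%g) else 1%g.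

Lemma gcom_cons x w : ~~ nilp w -> gcom (x :: w) = [~ e x, gcom w]%g.
Proof. by move=> /negPf /= ->. Qed.

Lemma gcom_rcons w x : gcom (rcons w x) = gact w (e x).
Proof.
elim: w => //= y w ->; case: ifP => //.
by rewrite /nilp size_rcons.
Qed.

Lemma gcom_lcn w : ~~ nilp w -> gcom w \in 'L_(size w)(E)%g.
Proof.
elim: w => // x w IH _; case: (boolP (nilp w)) => nw.
  by move/nilP: (nw) => -> /=; rewrite lcn1.
rewrite gcom_cons //= -add1n; apply: lcn_comm => //; last exact: IH.
by case: (w) nw.
Qed.

(** The counterpart of [lact_dynA], with [good_jacobi] for the Jacobi identity. In the induction the
    outer letter is moved into the functional, replacing [c] by its composite with the commutator by
    [e x]. *)
Lemma gr_act n i w c a : (0 < i)%N -> (size w <= m)%N -> ~~ nilp w -> (size w + i = n)%N ->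
  good E n c -> a \in 'L_i(E)%g ->
  flin (fun v => c (gact v a)) (lw w) = c [~ gcom w, a]%g.
Proof.
elim: w n i c a => // x w IH n i c a i0 hw _ en gc ha.
case: (boolP (nilp w)) => nw.
  by move/nilP: (nw) hw => -> hw /=; rewrite flin_wd.
have w0 : (0 < size w)%N by case: (w) nw.
have hom := @lword_hom R m X w.
have ex1 : e x \in 'L_1(E)%g by rewrite lcn1.
have hc := gcom_lcn nw.
rewrite lword_cons // gcom_cons // cbrE linearB /=.
rewrite (flin_letrM _ _ _ hom) // (flin_Mletr _ _ _ hom) //.
have g1 : good E (size w + i) (fun z => c [~ e x, z]%g).
  by apply: (good_br gc (i := 1)) => //; rewrite ?addn_gt0 ?w0 // add1n -addSn.
have -> : flin (fun v => c (gact (x :: v) a)) (lw w) = c [~ e x, [~ gcom w, a]]%g.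
  exact: (IH (size w + i)%N i (fun z => c [~ e x, z]%g) a i0 (ltnW hw) nw (erefl _) g1 ha).
have -> : flin (fun v => c (gact (rcons v x) a)) (lw w) = c [~ gcom w, [~ e x, a]]%g.
  rewrite -(IH n i.+1 c [~ e x, a]%g) //; last by rewrite -add1n; apply: lcn_comm.
  - by apply: eq_flin => v _; rewrite /gact foldr_rcons.
  - exact: ltnW.
  by rewrite addnS -addSn.
by rewrite (good_jacobi gc _ _ _ _ ex1 hc ha) // add1n.
Qed.

(** Write the bracket of [x :: w] as a commutator. The words beginning with [x] contribute [size w]
    times the value, by induction; those ending with [x] contribute it once more, by [gr_act] and
    antisymmetry. *)
Lemma gr_dynkin n w c : (size w <= m)%N -> ~~ nilp w -> size w = n -> good E n c ->
  flin (c \o gcom) (lw w) = (size w)%:R *: c (gcom w).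
Proof.
elim: w n c => // x w IH n c hw _ en gc.
case: (boolP (nilp w)) => nw.
  by move/nilP: (nw) hw => -> hw /=; rewrite flin_wd // scale1r.
have w0 : (0 < size w)%N by case: (w) nw.
have hom := @lword_hom R m X w.
have ex1 : e x \in 'L_1(E)%g by rewrite lcn1.
have hc := gcom_lcn nw.
rewrite lword_cons // gcom_cons // cbrE linearB /=.
rewrite (flin_letrM _ _ _ hom) // (flin_Mletr _ _ _ hom) //.
have g1 : good E (size w) (fun z => c [~ e x, z]%g).
  by apply: (good_br gc (i := 1)).
have -> : flin (fun v => (c \o gcom) (x :: v)) (lw w) = (size w)%:R *: c [~ e x, gcom w]%g.
  rewrite -(IH _ _ (ltnW hw) nw (erefl _) g1); apply: (flin_hom hom) => v sv.
  by rewrite /= ifF //; apply/negbTE; rewrite /nilp sv -lt0n.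
have -> : flin (fun v => (c \o gcom) (rcons v x)) (lw w) = c [~ gcom w, e x]%g.
  have n1 : (size w + 1 = n)%N by rewrite addn1.
  rewrite -(@gr_act n 1 w c (e x) isT (ltnW hw) nw n1 gc ex1).
  by apply: eq_flin => v _; rewrite /= gcom_rcons.
rewrite (good_anti gc _ w0 _ ex1 hc) // opprK.
by rewrite -{2}[c _]scale1r -scalerDl -natr1.
Qed.

End GrDynkin.

(** * Abelian groups as modules over Z/q, and Lie algebras as groups *)

Definition abz (gT : finGroupType) (C : forall x y : gT, (x * y = y * x)%g) := gT : Type.
Section Abz.
Variables (gT : finGroupType) (C : forall x y : gT, (x * y = y * x)%g).
HB.instance Definition _ := Finite.on (abz C).
HB.instance Definition _ := GRing.isZmodule.Build (abz C) (@mulgA gT) C (@mul1g gT) (@mulVg gT).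
Lemma abz_mulrn (x : gT) k : ((x : abz C) *+ k) = (x ^+ k)%g.
Proof. by elim: k => // k IH; rewrite mulrS expgS IH. Qed.
End Abz.

Definition zqmod (q : nat) (q1 : (1 < q)%N) (V : zmodType) (H : forall x : V, x *+ q = 0) := V : Type.
Section Zqmod.
Variables (q : nat) (q1 : (1 < q)%N) (V : zmodType) (H : forall x : V, x *+ q = 0).
Local Notation W := (zqmod q1 H).
HB.instance Definition _ := GRing.Zmodule.on W.
Definition zqscale (c : 'Z_q) (x : W) : W := x *+ c.
Lemma zq_mod (x : W) k : x *+ (k %% q) = x *+ k.
Proof. by rewrite {2}(divn_eq k q) mulrnDr mulnC mulrnA H mul0rn add0r. Qed.
Lemma zq_mod' (x : W) k : x *+ (k %% (Zp_trunc q).+2) = x *+ k.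
Proof. by rewrite Zp_cast // zq_mod. Qed.
Lemma zqscaleA a b x : zqscale a (zqscale b x) = zqscale (a * b) x.
Proof. by rewrite /zqscale zq_mod' -mulrnA mulnC. Qed.
Lemma zqscale1 : left_id 1 zqscale.
Proof. by move=> x; rewrite /zqscale zq_mod' mulr1n. Qed.
Lemma zqscaleDr : right_distributive zqscale +%R.
Proof. by move=> a x y; rewrite /zqscale mulrnDl. Qed.
Lemma zqscaleDl x : {morph zqscale^~ x : a b / a + b}.
Proof.
by move=> a b; rewrite /zqscale zq_mod' mulrnDr.
Qed.
HB.instance Definition _ := GRing.Zmodule_isLmodule.Build 'Z_q W zqscaleA zqscale1 zqscaleDr zqscaleDl.
End Zqmod.
HB.instance Definition _ q q1 (V : finZmodType) H := Finite.on (@zqmod q q1 V H).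

Record lie_over (R : nzRingType) (m : nat) := LieOver {
  lo_car : finLmodType R;
  lo_br : lo_car -> lo_car -> lo_car;
  lo_P : is_lie_bracket lo_br;
  lo_N : lie_class lo_br m
}.
Arguments lo_br {R m} N _ _ : rename.

Definition invertible_upto (R : unitRingType) (m : nat) :=
  forall k, (0 < k <= m)%N -> (k%:R : R) \is a GRing.unit.

Definition lgroup (R : finComUnitRingType) (m : nat) (m0 : (0 < m)%N)
  (um : invertible_upto R m) (N : lie_over R m) := lo_car N : Type.

Section LGroup.
Variables (R : finComUnitRingType) (m : nat) (m0 : (0 < m)%N).
Variables (um : invertible_upto R m) (N : lie_over R m).
Local Notation U := (lgroup m0 um N).
HB.instance Definition _ := Finite.on U.
Definition lg_mul (x y : U) : U := star m (lo_br N) (x : lo_car N) (y : lo_car N).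
Definition lg_inv (x : U) : U := - (x : lo_car N).
Definition lg_one : U := (0 : lo_car N).
Lemma lg_mulA : associative lg_mul.
Proof. by move=> x y z; apply: (starA m0 um (lo_P N) (@lo_N _ _ N)). Qed.
Lemma lg_mul1 : left_id lg_one lg_mul.
Proof. by move=> x; apply: (star0x m0 um (lo_P N) (@lo_N _ _ N)). Qed.
Lemma lg_mulV : left_inverse lg_one lg_inv lg_mul.
Proof. by move=> x; apply: (starNx m0 um (lo_P N) (@lo_N _ _ N)). Qed.
HB.instance Definition _ := Finite_isGroup.Build U lg_mulA lg_mul1 lg_mulV.

Lemma lgM (x y : U) : (x * y)%g = star m (lo_br N) x y. Proof. by []. Qed.
Lemma lgX (x : U) k : (x ^+ k)%g = (x : lo_car N) *+ k.
Proof.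
elim: k => [|k IH] //; rewrite expgSr IH lgM.
exact: (star_natmul m0 (lo_P N) (@lo_N _ _ N)).
Qed.
End LGroup.

(** The factor of the lower central series is abelian and killed by q, so it is itself a Z/q-module
    and the projection onto it can serve as [c]. Off ['L_K(E)], where [c] is unconstrained, [coset]
    and [subg] take default values. *)
Lemma section_functional (q : nat) (q1 : (1 < q)%N) (eT : finGroupType) (E : {group eT}) K :
  (forall z, z \in E -> (z ^+ q = 1)%g) ->
  exists (V : lmodType 'Z_q) (c : eT -> V),
    good E K c /\ forall z, z \in 'L_K(E)%g -> c z = 0 -> z \in 'L_K.+1(E)%g.
Proof.
move=> hE; pose Q := ('L_K(E) / 'L_K.+1(E))%G.
have aQ : abelian Q by apply: abelianS (lcn_central K E) (center_abelian _).
have nE x : x \in 'L_K(E)%g -> x \in 'N('L_K.+1(E))%g.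
  by move=> hx; apply: (subsetP (lcn_norm K.+1 E)); apply: (subsetP (lcn_sub K E)).
have C (x y : subg_of Q) : (x * y = y * x)%g.
  by apply: val_inj; apply: (centsP aQ); apply: subgP.
have H (x : abz C) : x *+ q = 0.
  rewrite abz_mulrn; apply: val_inj => /=.
  have [z nz hz ez] := morphimP (subgP (x : subg_of Q)).
  have -> : val (x ^+ q : subg_of Q)%g = (sgval x ^+ q)%g by rewrite -morphX ?inE.
  by rewrite ez -morphX // hE ?morph1 // (subsetP (lcn_sub K E)).
exists (zqmod q1 H), (fun z => subg Q (coset _ z)).
have hQ z : z \in 'L_K(E)%g -> coset 'L_K.+1(E)%G z \in Q.
  by move=> hz; apply: mem_quotient.
split; first split.
- move=> z z' hz hz'; rewrite morphM ?nE //; apply: (subgM (hQ z hz) (hQ z' hz')).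
- move=> z hz; rewrite coset_id //; exact: morph1.
move=> z hz /(congr1 val); rewrite subgK ?hQ // => e.
by apply: coset_idr; rewrite ?nE.
Qed.

(** * The Lie structure of a group *)

Section FreeLaz.
Variables (q : nat) (q1 : (1 < q)%N) (m : nat) (m0 : (0 < m)%N).
Variable um : invertible_upto 'Z_q m.
Local Notation R := 'Z_q.

Lemma natZ (c : R) : exists k, c = k%:R.
Proof. by exists c; rewrite natr_Zp. Qed.

Lemma Zq_mulrn (V : lmodType R) (x : V) : x *+ q = 0.
Proof. by rewrite -scaler_nat pchar_Zp // scale0r. Qed.

Definition freeN (X : finType) : lie_over R m :=
  LieOver (@cbrP R (fra R m X)) (cbrN m0).

Variables (gT : finGroupType) (G : {group gT}).
Hypothesis hG : ('L_m.+1(G) = 1)%g.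
Hypothesis hq : forall x, x \in G -> (x ^+ q = 1)%g.

Local Notation A := (fra R m gT).
Local Notation UA := (lgroup m0 um (freeN gT)).
Local Notation eT := (UA * gT)%type.

(* The group generated by the pairs (X_g, g); EE_free says that it is the graph of a function
   into G.  Elements of gT outside G give harmless extra letters above 1. *)
Definition sG (x : gT) : gT := if x \in G then x else 1%g.
Lemma sG_in x : sG x \in G. Proof. by rewrite /sG; case: ifP. Qed.

Definition ee (x : gT) : eT := (letr R m x : UA, sG x).
Definition EE : {group eT} := <<[set ee x | x : gT]>>%G.

Lemma ee_in x : ee x \in EE.
Proof. by apply: mem_gen; apply: imset_f. Qed.

Lemma EE_ind (P : eT -> Prop) : P 1%g ->
  (forall x y, y \in EE -> P y -> P (ee x * y)%g) -> forall z, z \in EE -> P z.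
Proof.
move=> P1 PM; apply: gen_ind => // _ y /imsetP [x _ ->]; exact: PM.
Qed.

Lemma EE_fge1 z : z \in EE -> fge 1 (z.1 : A).
Proof.
move: z; apply: EE_ind => [|x y _ hy]; first exact: fge0.
apply: (fge1_starA m0 um) => //; exact: fge1_letr.
Qed.

Lemma EE_G z : z \in EE -> z.2 \in G.
Proof.
move: z; apply: EE_ind => [|x y _ hy]; first exact: group1.
by rewrite groupM // sG_in.
Qed.

Lemma UA_comm (x y : UA) : ([~ x, y]%g : A) = scomm (x : A) (y : A).
Proof.
have -> : ([~ x, y] = x^-1 * y^-1 * (x * y))%g by rewrite /commg /conjg -!mulgA.
by [].
Qed.

Lemma fge_mul k (x y : UA) : (0 < k)%N -> fge k (x : A) -> fge k (y : A) -> fge k ((x * y)%g : A).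
Proof.
move=> k0 hx hy; rewrite -[X in fge k X](subrK ((x : A) + (y : A))).
by apply: fgeD; [apply: fgeW (starA_lead m0 k0 hx hy) | apply: fgeD].
Qed.

Lemma lcn_fge k z : (0 < k)%N -> z \in 'L_k(EE)%g -> fge k (z.1 : A).
Proof.
case: k => // k _; elim: k z => [|k IH] z; first by rewrite lcn1; apply: EE_fge1.
rewrite lcnSn; move: z; apply: gen_ind => [|x y hx _ hy]; first exact: fge0.
apply: fge_mul => //; case/imset2P: hx => a b ha hb ->.
have h1 := IH a ha; have h2 := EE_fge1 hb.
rewrite [X in fge _ X](_ : _ = scomm (a.1 : A) (b.1 : A)); last exact: UA_comm.
rewrite -[scomm _ _](subrK (cbr (a.1 : A) (b.1 : A))).
apply: fgeD; last by have := fge_cbr h1 h2; rewrite addn1.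
by apply: fgeW (scomm_lead m0 um _ _ h1 h2); rewrite ?addn1.
Qed.

(** The combination [f] of words represents [z] modulo ['L_k.+1(EE)] as a product of right-normed
    commutators of generators. It ties the degree-k part of the first coordinate, [dynA f], to the
    class of [z] as seen by functionals. *)
Definition lead k (z : eT) := exists f : A, [/\ fhom k f, fge k.+1 ((z.1 : A) - dynA f) &
  forall (V : lmodType R) (c : eT -> V), good EE k c -> c z = flin (c \o gcom ee) f].

Lemma lead_triv k z : (0 < k)%N -> z \in 'L_k.+1(EE)%g -> lead k z.
Proof.
move=> k0 hz; exists 0; split; first by move=> w _; rewrite fcoef0.
  by rewrite linear0 subr0; apply: lcn_fge.
by move=> V c [_ ->]; rewrite ?linear0.
Qed.

Lemma lead_mul k x y : (0 < k)%N -> x \in 'L_k(EE)%g -> y \in 'L_k(EE)%g ->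
  lead k x -> lead k y -> lead k (x * y)%g.
Proof.
move=> k0 hx hy [f [hf lf cf]] [g [hg lg cg]]; exists (f + g); split.
- by move=> w hw; rewrite fcoefD hf ?hg ?addr0.
- have l := starA_lead m0 k0 (lcn_fge k0 hx) (lcn_fge k0 hy).
  have -> : ((x * y)%g.1 : A) - dynA (f + g) = (star m (@cbr R A) x.1 y.1 - ((x.1 : A) + (y.1 : A)))
      + (((x.1 : A) - dynA f) + ((y.1 : A) - dynA g)).
    by rewrite linearD /= [X in _ = _ + X]addrACA -opprD addrA subrK.
  exact: fgeD l (fgeD lf lg).
by move=> V c gc; case: (gc) => -> // _; rewrite cf // cg // linearD.
Qed.

Lemma lead_inv k x : (0 < k)%N -> x \in 'L_k(EE)%g -> lead k x -> lead k x^-1%g.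
Proof.
move=> k0 hx [f [hf lf cf]]; exists (- f); split.
- by move=> w hw; rewrite fcoefN hf ?oppr0.
- have -> : (x^-1%g.1 : A) - dynA (- f) = - ((x.1 : A) - dynA f).
    by rewrite linearN opprD.
  exact: fgeN.
by move=> V c gc; rewrite (goodV gc) // cf // linearN.
Qed.

Lemma lead_comm k x a : (0 < k < m)%N -> a \in 'L_k(EE)%g -> lead k a -> lead k.+1 [~ ee x, a]%g.
Proof.
case/andP=> k0 km ha [f [hf lf cf]]; exists (letr R m x * f); split.
- exact: (fhomM (@fhom_wd R m gT [:: x]) hf).
- have h1 := @fge1_letr R m gT x; have h2 := lcn_fge k0 ha.
  have f0 : fcoef f [::] = 0 by apply: hf; rewrite /= eq_sym -lt0n.
  have -> : dynA (letr R m x * f) = cbr (letr R m x) (dynA f).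
    rewrite /dynA (dynM (@cbrP R A) (cbrN m0)) f0 scale0r addr0 /letr.
    by rewrite (lact_letter (cbrN m0)).
  have -> : ([~ ee x, a]%g.1 : A) = scomm (letr R m x) (a.1 : A) by apply: UA_comm.
  have := scomm_lead m0 um (ltn0Sn 0) k0 h1 h2; rewrite add1n => l.
  rewrite -[scomm _ _](subrK (cbr (letr R m x) (a.1 : A))) -addrA; apply: fgeD => //.
  rewrite -(lieNr (@cbrP R A)) -(lieDr (@cbrP R A)); exact: (@fge_cbr _ _ _ 1 k.+1).
move=> V c gc.
have g1 : good EE k (fun z => c [~ ee x, z]%g).
  by apply: (good_br gc (i := 1)) => //; rewrite lcn1 ee_in.
rewrite (cf V _ g1) (flin_letrM _ _ km hf); apply: (flin_hom hf) => v sv /=.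
by rewrite ifF //; apply/negbTE; rewrite /nilp sv -lt0n.
Qed.

Lemma lead_lcn k z : (0 < k <= m)%N -> z \in 'L_k(EE)%g -> lead k z.
Proof.
case: k => // k; elim: k z => [|k IH] z /andP [_ km].
  have H1 z' : z' \in EE -> lead 1 z'.
    move: z'; apply: EE_ind => [|x y hy IHy].
      by apply: lead_triv => //; apply: group1.
    apply: lead_mul => //; rewrite ?lcn1 ?ee_in //; exists (letr R m x); split.
    - exact: (@fhom_wd _ _ _ [:: x]).
    - by rewrite dynA_letter // subrr; apply: fge0.
    by move=> V c gc; rewrite flin_wd.
  by rewrite lcn1; apply: H1.
have km' : (0 < k.+1 <= m)%N by rewrite ltn0Sn ltnW.
have sub a b : a \in 'L_k.+1(EE)%g -> b \in EE -> [~ a, b]%g \in 'L_k.+2(EE)%g.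
  by move=> ha hb; rewrite lcnSn mem_commg.
(* Expanding the commutator of [a] with [ee x * b] leaves commutators with one generator, up to a
   factor in ['L_k.+3(EE)]; inversion then moves the generator to the left, as [lead_comm]
   requires. *)
have B b : b \in EE -> forall a, a \in 'L_k.+1(EE)%g -> lead k.+2 [~ a, b]%g.
  move: b; apply: EE_ind => [a ha|x b hb IHb a ha].
    by rewrite commg1; apply: lead_triv => //; apply: group1.
  have hxa := sub a (ee x) ha (ee_in x); have hab := sub a b ha hb.
  have h3 : [~ [~ a, ee x], b]%g \in 'L_k.+3(EE)%g by rewrite lcnSn mem_commg.
  have h3' : [~ [~ a, ee x], b]%g \in 'L_k.+2(EE)%g by apply: (subsetP (lcn_subS _ _)).
  rewrite commgMJ conjg_mulR; apply: lead_mul => //; [by rewrite groupM | exact: IHb |].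
  apply: lead_mul => //; last exact: lead_triv.
  rewrite -invg_comm; apply: lead_inv => //; first by rewrite -groupV invg_comm.
  by apply: lead_comm => //; apply: IH.
rewrite lcnSn; move: z; apply: gen_ind => [|x y hx hy IHy].
  by apply: lead_triv => //; apply: group1.
case/imset2P: hx => a b ha hb ->; apply: lead_mul => //; first exact: sub.
exact: B.
Qed.

Lemma EE_exp z : z \in EE -> (z ^+ q = 1)%g.
Proof.
move=> hz; have E k : (z ^+ k = (z.1 ^+ k, z.2 ^+ k))%g.
  by elim: k => // k IH; rewrite !expgS IH.
by rewrite E lgX hq ?EE_G // Zq_mulrn.
Qed.

(** If [z] is in ['L_k.+1(EE)] and its first coordinate has order above k + 1, then its representing
    combination [f] satisfies [dynA f = 0]. By [gr_dynkin], applying a functional to [dynA f] gives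
    k + 1 times its value at [z]; as k + 1 is a unit, that value is 0. *)
Lemma EE_lcn k z : (k <= m)%N -> z \in EE -> fge k.+1 (z.1 : A) -> z \in 'L_k.+1(EE)%g.
Proof.
elim: k z => [|k IH] z km hz h; first by rewrite lcn1.
have hz' : z \in 'L_k.+1(EE)%g by apply: IH => //; [exact: ltnW | apply: fgeW h].
have [V [c [gc ck]]] := section_functional q1 k.+1 EE_exp; apply: ck => //.
have km' : (0 < k.+1 <= m)%N by [].
have [f [hf lf cf]] := lead_lcn km' hz'.
have df : dynA f = 0.
  have hd : fge k.+2 (dynA f).
    have -> : dynA f = (z.1 : A) - ((z.1 : A) - dynA f) by rewrite subKr.
    exact: fgeB.
  have pf : pr k.+1 f = f by rewrite (fhom_pr _ hf) eqxx.
  apply: fcoefP => w _; rewrite fcoef0 -pf dynA_pr // fcoef_pr; case: eqP => // sw.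
  by apply: hd; rewrite sw.
have uk : (k.+1%:R : R) \is a GRing.unit by apply: um.
have e : flin (c \o gcom ee) (dynA f) = k.+1%:R *: flin (c \o gcom ee) f.
  have -> : dynA f = \sum_(v : {bseq m of gT}) fcoef f v *: lword (@cbr R A) (@letr R m gT) v by [].
  rewrite linear_sum /= [in RHS]/flin scaler_sumr; apply: eq_bigr => v _.
  rewrite linearZ /=; case: (eqVneq (size v) k.+1) => sv; last by rewrite hf // !scale0r scaler0.
  rewrite (gr_dynkin ee_in _ _ sv gc) ?sv //; last by rewrite /nilp sv.
  by rewrite !scalerA mulrC.
rewrite (cf V c gc) -[LHS]scale1r -(mulVr uk) -scalerA -e df linear0 scaler0 //.
Qed.

(** A trivial first coordinate has every order, so [z] lies in term m + 1, and the second projection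
    maps that term into ['L_m.+1(G)], which is trivial. *)
Lemma EE_free z : z \in EE -> z.1 = 1%g -> z = 1%g.
Proof.
move=> hz z1; have h0 : fge m.+1 (z.1 : A) by rewrite z1; apply: fge0.
have := EE_lcn (leqnn m) hz h0 => hl.
have : (snd @* 'L_m.+1(EE) \subset 'L_m.+1(G))%g.
  rewrite morphim_lcn ?subsetT //; apply: lcnS; apply/subsetP => y /morphimP [x _ hx ->].
  exact: EE_G.
rewrite hG => /subsetP/(_ z.2); rewrite mem_morphim ?inE // => /(_ isT)/eqP z2.
by rewrite [z]surjective_pairing z1 z2.
Qed.

End FreeLaz.

Lemma zq_lie (q : nat) (q1 : (1 < q)%N) (V : finZmodType) (H : forall x : V, x *+ q = 0)
    (br : zqmod q1 H -> zqmod q1 H -> zqmod q1 H) :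
  (forall x y z, br (x + y) z = br x z + br y z) ->
  (forall x y z, br x (y + z) = br x y + br x z) ->
  (forall x, br x x = 0) ->
  (forall x y z, br x (br y z) + br y (br z x) + br z (br x y) = 0) ->
  is_lie_bracket (br : (zqmod q1 H : lmodType 'Z_q) -> _ -> _).
Proof.
move=> Dl Dr xx J.
have nl k x z : br (x *+ k) z = br x z *+ k.
  elim: k => [|k IH]; last by rewrite !mulrS Dl IH.
  by apply: (@addrI _ (br 0 z)); rewrite -Dl !addr0.
have nr k x z : br z (x *+ k) = br z x *+ k.
  elim: k => [|k IH]; last by rewrite !mulrS Dr IH.
  by apply: (@addrI _ (br z 0)); rewrite -Dr !addr0.
split=> // [a x y z|a x y z]; first by rewrite Dl; congr (_ + _); apply: nl.
by rewrite Dr; congr (_ + _); apply: nr.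
Qed.

(** A form of [star_morph] for maps such as [thT] below, known to respect the operations only on Lie
    elements. *)
Lemma star_morph_on (R : finComUnitRingType) (m : nat) (L M : lmodType R) (br : L -> L -> L)
    (br' : M -> M -> M) (phi : L -> M) (P : L -> Prop) x y : phi 0 = 0 -> P 0 ->
  (forall c u v, P u -> P v -> P (c *: u + v)) -> (forall u v, P u -> P v -> P (br u v)) ->
  (forall c u v, P u -> P v -> phi (c *: u + v) = c *: phi u + phi v) ->
  (forall u v, P u -> P v -> phi (br u v) = br' (phi u) (phi v)) -> P x -> P y ->
  phi (star m br x y) = star m br' (phi x) (phi y).
Proof.
move=> p0 P0 Plin Pbr plin pbr Px Py; rewrite !starE /lphi /dyn /flin.
have P2 b : P (pair2 x y b) by case: b.
have Pw w : P (lword br (pair2 x y) w) by elim: w => //= b w IH; case: ifP => _ //; apply: Pbr.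
have E w : phi (lword br (pair2 x y) w) = lword br' (pair2 (phi x) (phi y)) w.
  rewrite (@lword_morph _ _ _ _ _ br' phi P) //; by apply: eq_lword; case.
suff [] : P (\sum_(v : {bseq m of bool}) fcoef (fdegV (bch R m)) v *: lword br (pair2 x y) v) /\
  phi (\sum_(v : {bseq m of bool}) fcoef (fdegV (bch R m)) v *: lword br (pair2 x y) v) =
   \sum_(v : {bseq m of bool}) fcoef (fdegV (bch R m)) v *: lword br' (pair2 (phi x) (phi y)) v by [].
by elim/big_rec2: _ => // v z u _ [Pu eu]; rewrite plin // eu E; split=> //; apply: Plin.
Qed.

Definition lazard_iso (R : finComUnitRingType) (m : nat) (N : lie_over R m) (gT : finGroupType)
    (G : {group gT}) (la : lo_car N -> gT) :=
  [/\ injective la, forall x, la x \in G, forall g, g \in G -> exists x, la x = g &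
      forall x y, la (star m (lo_br N) x y) = (la x * la y)%g].

Section LieOfGroup.
Variables (q : nat) (q1 : (1 < q)%N) (m : nat) (m0 : (0 < m)%N).
Variable um : invertible_upto 'Z_q m.
Local Notation R := 'Z_q.
Variables (gT : finGroupType) (G : {group gT}).
Hypothesis hG : ('L_m.+1(G) = 1)%g.
Hypothesis hq : forall x, x \in G -> (x ^+ q = 1)%g.
Local Notation A := (fra R m gT).
Local Notation UA := (lgroup m0 um (freeN q m0 gT)).
Local Notation eT := (UA * gT)%type.
Local Notation EE := (EE m0 um G).
Implicit Types s t : A.

Definition inEE s (g : gT) := ((s : UA, g) : eT) \in EE.

Lemma inEE_mul s t g h : inEE s g -> inEE t h -> inEE (star m (@cbr R A) s t) (g * h)%g.
Proof. exact: groupM. Qed.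
Lemma inEE_inv s g : inEE s g -> inEE (- s) g^-1%g.
Proof. by rewrite /inEE => h; rewrite -groupV in h. Qed.
Lemma inEE1 : inEE 0 1%g. Proof. exact: group1. Qed.
Lemma inEE_letr g : g \in G -> inEE (letr R m g) g.
Proof. by move=> hg; have := ee_in m0 um G g; rewrite /ee /sG hg. Qed.

Lemma inEE_uniq s g h : inEE s g -> inEE s h -> g = h.
Proof.
move=> hg hh; have := groupM (inEE_inv hg) hh.
have e1 : (((- s : A) : UA) * (s : UA))%g = 1%g by apply: (mulVg (s : UA)).
move=> hz; have := EE_free q1 hG hq hz; rewrite /= e1 => /(_ (erefl _)) [_ e2].
by apply/eqP; rewrite eq_mulVg1 e2.
Qed.

Lemma inEE_G s g : inEE s g -> g \in G.
Proof. by move=> h; have := EE_G h. Qed.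

Definition th s : gT := odflt 1%g [pick g | inEE s g].

Lemma thU s g : inEE s g -> th s = g.
Proof.
move=> h; rewrite /th; case: pickP => [g' /= h'|/(_ g)]; last by rewrite h.
exact: inEE_uniq h' h.
Qed.

Lemma thP s : inS s -> inEE s (th s).
Proof.
move=> sS; suff [_ [g hg]] : inS s /\ exists g, inEE s g by rewrite (thU hg).
apply: (inS_gen m0 um (@natZ q) (H := fun t => inS t /\ exists g, inEE t g)) => //.
- by split; [exact: inS0 | exists 1%g; apply: inEE1].
- by move=> f [].
- by move=> f [fS [g hg]]; split; [exact: inSN | exists g^-1%g; apply: inEE_inv].
- move=> f f' [fS [g hg]] [fS' [g' hg']]; split; first exact: inS_starA.
  by exists (g * g')%g; apply: inEE_mul.
move=> x; split; first exact: inS_letter.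
by exists (sG G x); apply: ee_in.
Qed.

Lemma th_star s t : inS s -> inS t -> th (star m (@cbr R A) s t) = (th s * th t)%g.
Proof. by move=> sS tS; apply: thU; apply: inEE_mul; apply: thP. Qed.
Lemma thN s : inS s -> th (- s) = (th s)^-1%g.
Proof. by move=> sS; apply: thU; apply: inEE_inv; apply: thP. Qed.

(** The relation of having the same image in G is a subgroup of a product of two free groups for
    [star]. By [subD] and [subBr] it is then closed under sums and brackets, so both descend to
    G. *)
Definition thker (u : (A * A)%type) := [/\ inS u.1, inS u.2 & th u.1 = th u.2].

Lemma thker_ops : (forall u v, thker u -> thker v -> thker (u + v)) /\
  (forall u v, thker u -> thker v -> thker (pbr (@cbr R A) (@cbr R A) u v)).
Proof.
have P2 := pbrP (@cbrP R A) (@cbrP R A); have N2 := pbrN (@cbrN R m gT m0) (@cbrN R m gT m0).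
have K0 : thker 0 by split; try exact: inS0.
have KN u : thker u -> thker (- u).
  by case=> h1 h2 e; split; try exact: inSN; rewrite /= !thN // e.
have Ks u v : thker u -> thker v -> thker (star m (pbr (@cbr R A) (@cbr R A)) u v).
  case=> h1 h2 e [h1' h2' e']; rewrite star_pair; split; try exact: inS_starA.
  by rewrite /= !th_star // e e'.
split=> u v hu hv.
  exact: (subD m0 um (@natZ q) P2 N2 K0 KN Ks).
exact: (subBr m0 um (@natZ q) P2 N2 K0 KN Ks).
Qed.

Local Notation T := (subg_of G).
Definition thT s : T := subg G (th s).
Definition si (g : T) : A := letr R m (val g).

Lemma val_thT s : inS s -> val (thT s) = th s.
Proof. by move=> sS; rewrite subgK //; apply: inEE_G (thP sS). Qed.
Lemma siS g : inS (si g). Proof. exact: inS_letter. Qed.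
Lemma siK g : thT (si g) = g.
Proof. by apply: val_inj; rewrite val_thT; [apply: thU; apply: inEE_letr; apply: subgP | apply: siS]. Qed.

Lemma thT_ker s t : inS s -> inS t -> thT s = thT t -> thker (s, t).
Proof. by move=> sS tS /(congr1 val); rewrite !val_thT. Qed.
Lemma thker_T s t : thker (s, t) -> thT s = thT t.
Proof. by case=> sS tS e; apply: val_inj; rewrite !val_thT. Qed.

Definition tadd (g h : T) : T := thT (si g + si h).
Definition topp (g : T) : T := thT (- si g).
Definition tbr (g h : T) : T := thT (cbr (si g) (si h)).

Lemma thTD s t : inS s -> inS t -> thT (s + t) = tadd (thT s) (thT t).
Proof.
move=> sS tS; apply: thker_T; apply: (thker_ops.1 (_, _) (_, _)); apply: thT_ker; rewrite ?siK //; exact: siS.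
Qed.
Lemma thTN s : inS s -> thT (- s) = topp (thT s).
Proof.
move=> sS; apply: val_inj; have tS := siS (thT s); rewrite !val_thT; try exact: inSN.
by rewrite !thN // -[in RHS]val_thT // siK val_thT.
Qed.
Lemma thTbr s t : inS s -> inS t -> thT (cbr s t) = tbr (thT s) (thT t).
Proof.
move=> sS tS; apply: thker_T; apply: (thker_ops.2 (_, _) (_, _)); apply: thT_ker; rewrite ?siK //; exact: siS.
Qed.

Lemma thT_surj g : exists2 s, inS s & g = thT s.
Proof. by exists (si g); [exact: siS | rewrite siK]. Qed.

Lemma taddA : associative tadd.
Proof.
move=> x y z; have [a aS ->] := thT_surj x; have [b bS ->] := thT_surj y; have [c cS ->] := thT_surj z.
by rewrite -!thTD ?addrA //; apply: inSD.
Qed.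
Lemma taddC : commutative tadd.
Proof.
move=> x y; have [a aS ->] := thT_surj x; have [b bS ->] := thT_surj y.
by rewrite -!thTD // addrC.
Qed.
Lemma tadd0 : left_id (thT 0) tadd.
Proof. by move=> x; have [a aS ->] := thT_surj x; rewrite -thTD ?add0r //; apply: inS0. Qed.
Lemma taddN : left_inverse (thT 0) topp tadd.
Proof.
by move=> x; have [a aS ->] := thT_surj x; rewrite -thTN // -thTD ?addNr //; apply: inSN.
Qed.

Theorem lazard_of_group : exists (N : lie_over R m) (la : lo_car N -> gT), lazard_iso G la.
Proof.
pose V : finZmodType := HB.pack T (GRing.isZmodule.Build T taddA taddC tadd0 taddN).
have tV s t : inS s -> inS t -> thT (s + t) = (thT s : V) + (thT t : V) := @thTD s t.
have nV s k : inS s -> thT (s *+ k) = (thT s : V) *+ k.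
  move=> sS; elim: k => // k IH; rewrite !mulrS -IH -tV //.
  by rewrite -scaler_nat; apply: inSZ.
have H (x : V) : x *+ q = 0.
  by have [a aS ->] := thT_surj x; rewrite -nV // Zq_mulrn.
have P : @is_lie_bracket R (zqmod q1 H) tbr.
  apply: zq_lie => [x y z|x y z|x|x y z].
  - have [a aS ->] := thT_surj x; have [b bS ->] := thT_surj y; have [c cS ->] := thT_surj z.
    rewrite -[_ + _]/(tadd _ _) -!thTD // -!thTbr ?(lieDl (@cbrP R A)) //; last exact: inSD.
    by rewrite thTD //; apply: cbr_inS.
  - have [a aS ->] := thT_surj x; have [b bS ->] := thT_surj y; have [c cS ->] := thT_surj z.
    rewrite -[_ + _]/(tadd _ _) -!thTD // -!thTbr ?(lieDr (@cbrP R A)) //; last exact: inSD.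
    by rewrite thTD //; apply: cbr_inS.
  - by have [a aS ->] := thT_surj x; rewrite -thTbr // (liexx (@cbrP R A)).
  have [a aS ->] := thT_surj x; have [b bS ->] := thT_surj y; have [c cS ->] := thT_surj z.
  have ab : inS (cbr a b) by apply: cbr_inS.
  have bc : inS (cbr b c) by apply: cbr_inS.
  have ca : inS (cbr c a) by apply: cbr_inS.
  rewrite -!thTbr // -![_ + _]/(tadd (tadd _ _) _) -!thTD; try (exact: cbr_inS || by apply: inSD; apply: cbr_inS).
  by case: (@cbrP R A) => _ _ _ ->.
have Nn : lie_class (tbr : zqmod q1 H -> _ -> _) m.
  move=> s y hs.
  have E : forall s : seq T, exists2 w, size w = size s /\ (forall a, a \in w -> inS a) & s = map thT w.
    elim=> [|x u [w [sw wS] ->]]; first by exists [::].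
    have [a aS ->] := thT_surj x; exists (a :: w) => //; split; first by rewrite /= size_map.
    by move=> b; rewrite inE => /predU1P [->|] //; apply: wS.
  have [w [sw wS] es] := E s; have [b bS ->] := thT_surj y.
  have [F eF] : inS (foldr (@cbr R A) b w) /\ foldr tbr (thT b) (map thT w) = thT (foldr (@cbr R A) b w).
    elim: w wS {sw es} => // a w IH wS /=.
    have [|F ->] := IH; first by move=> c hc; apply: wS; rewrite inE hc orbT.
    have aS : inS a by apply: wS; rewrite inE eqxx.
    by rewrite thTbr //; split=> //; apply: cbr_inS.
  by rewrite es eF (cbrN m0) // sw.
exists (LieOver P Nn), (fun x : T => val x); split.
- exact: val_inj.
- exact: subgP.
- by move=> g hg; exists (subg G g); apply: subgK.
move=> x y; have [a aS ->] := thT_surj x; have [b bS ->] := thT_surj y.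
have := @star_morph_on R m A (zqmod q1 H) (@cbr R A) tbr thT (@inS R m gT) a b.
move=> <- //.
- by rewrite !val_thT //; [apply: th_star | apply: inS_starA].
- exact: inS0.
- by move=> c u v; apply: inS_linear.
- by move=> u v; apply: cbr_inS.
- move=> c u v uS vS; rewrite tV //; last exact: inSZ.
  by congr (_ + _); rewrite -{1}[c]natr_Zp scaler_nat nV.
by move=> u v; apply: thTbr.
Qed.

End LieOfGroup.

(** * Modules over chain rings *)

Definition cfun (R : finComNzRingType) (I : finType) := {ffun I -> R^o}.
HB.instance Definition _ R I := GRing.Lmodule.on (cfun R I).
HB.instance Definition _ (R : finComNzRingType) (I : finType) : isFinite (cfun R I) := Finite.on {ffun I -> R}.

Section Cmod.
Variables (R : finComNzRingType) (pi : R) (I : finType) (e : I -> nat).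
(** The direct sum of the cyclic modules R / (pi ^+ e i), realised by annihilators in R so that no
    quotient is formed. For a chain ring, the annihilator of pi ^+ e is generated by pi ^+ (M - e)
    when e <= M. *)
Definition cpred : {pred cfun R I} := fun c => [forall i, pi ^+ e i * (c : {ffun _ -> _}) i == 0].
Lemma cpred_submod : submod_closed cpred.
Proof.
split=> [|a c d]; first by apply/forallP => i; rewrite ffunE mulr0.
move=> /forallP hc /forallP hd; apply/forallP => i; rewrite !ffunE mulrDr.
by rewrite (eqP (hd i)) mulrCA (eqP (hc i)) mulr0 addr0.
Qed.
HB.instance Definition _ := GRing.isSubmodClosed.Build R (cfun R I) cpred cpred_submod.
Record cmod := CMod { cval :> cfun R I; _ : cval \in cpred }.
HB.instance Definition _ := [isSub for cval].
HB.instance Definition _ := [Choice of cmod by <:].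
HB.instance Definition _ := [SubChoice_isSubLmodule of cmod by <:].
HB.instance Definition _ := [Finite of cmod by <:].
End Cmod.

(* pi generates the maximal ideal, the residue field is F_p and the length is M. *)
Record chain_ring (R : finComNzRingType) (pi : R) (p M : nat) : Prop := ChainRing {
  cr_prime : prime p;
  cr_len : (0 < M)%N;
  cr_nil : pi ^+ M = 0;
  cr_nz : pi ^+ M.-1 != 0;
  cr_res : forall r : R, exists i r', r = i%:R + pi * r';
  cr_p : exists s, p%:R = pi * s
}.

Section Chain.
Variables (R : finComNzRingType) (pi : R) (p M : nat).
Hypothesis CR : chain_ring pi p M.
Implicit Types (r s : R).

Definition dv k r := exists d, r = pi ^+ k * d.

Lemma dvW j k r : (j <= k)%N -> dv k r -> dv j r.
Proof. by move=> h [d ->]; exists (pi ^+ (k - j) * d); rewrite mulrA -exprD subnKC. Qed.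
Lemma dvD k r s : dv k r -> dv k s -> dv k (r + s).
Proof. by move=> [a ->] [b ->]; exists (a + b); rewrite mulrDr. Qed.

Lemma one_plus_pi_unit t : exists v, (1 + pi * t) * v = 1.
Proof.
pose x := - (pi * t); exists (\sum_(i < M) x ^+ i).
have := subrX1 x M; rewrite {1}/x exprNn exprMn (cr_nil CR) mul0r mulr0 sub0r => h.
by apply: oppr_inj; rewrite h -mulNr opprD -/x addrC.
Qed.

Lemma unit_or_dv r : (exists v, r * v = 1) \/ dv 1 r.
Proof.
have [i [r' er]] := cr_res CR r; have [s es] := cr_p CR.
case: (boolP (p %| i)%N) => [/dvdnP [k ei]|].
  by right; exists (k%:R * s + r'); rewrite er ei expr1 natrM es mulrDr mulrCA.
rewrite -(prime_coprime _ (cr_prime CR)) => co; left.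
have i0 : (0 < i)%N.
  rewrite lt0n; apply: contraTneq co => ->.
  by rewrite /coprime gcdn0 neq_ltn (prime_gt1 (cr_prime CR)) orbT.
have /(coprimeP _ i0) [[j k] /= ejk] : coprime i p by rewrite coprime_sym.
have eji : (j * i = 1 + k * p)%N by rewrite -ejk subnK // ltnW // -subn_gt0 ejk.
have [v hv] := one_plus_pi_unit (k%:R * s + j%:R * r').
exists (j%:R * v); rewrite mulrA -[RHS]hv; congr (_ * _).
by rewrite er mulrDl mulrC -natrM eji natrD natrM es mulrDr addrA mulrCA -mulrA [r' * _]mulrC.
Qed.

Lemma pi_not_unit d : pi * d != 1.
Proof.
apply/eqP => h; have := congr1 (fun x => x ^+ M) h.
by rewrite exprMn (cr_nil CR) mul0r expr1n => /eqP; rewrite eq_sym oner_eq0.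
Qed.

Lemma nat_dvd i : dv 1 (i%:R : R) -> (p %| i)%N.
Proof.
case=> d h; apply: contraT; rewrite -(prime_coprime _ (cr_prime CR)) => co.
have i0 : (0 < i)%N.
  rewrite lt0n; apply: contraTneq co => ->.
  by rewrite /coprime gcdn0 neq_ltn (prime_gt1 (cr_prime CR)) orbT.
have /(coprimeP _ i0) [[j k] /= ejk] : coprime i p by rewrite coprime_sym.
have eji : (j * i = 1 + k * p)%N by rewrite -ejk subnK // ltnW // -subn_gt0 ejk.
have [s es] := cr_p CR.
have := pi_not_unit (j%:R * d - k%:R * s); rewrite mulrBr !(mulrCA pi) -es -{1}[pi]expr1 -h.
by rewrite -!natrM eji natrD addrK eqxx.
Qed.

Lemma dv_or_val k r : dv k r \/ exists j u v, [/\ (j < k)%N, r = pi ^+ j * u & u * v = 1].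
Proof.
elim: k => [|k [[d ->]|[j [u [v [h1 h2 h3]]]]]].
- by left; exists r; rewrite expr0 mul1r.
- case: (unit_or_dv d) => [[v hv]|[d' ->]]; first by right; exists k, d, v.
  by left; exists d'; rewrite mulrA expr1 -exprSr.
by right; exists j, u, v; split=> //; apply: ltnW.
Qed.

Lemma ann_pi k r : (k <= M)%N -> pi ^+ k * r = 0 -> dv (M - k) r.
Proof.
move=> kM h; case: (dv_or_val (M - k) r) => // -[j [u [v [hj er uv]]]].
have : pi ^+ (k + j) = 0.
  by rewrite -[LHS]mulr1 -uv exprD -!mulrA [pi ^+ j * (_ * _)]mulrA -er mulrA h mul0r.
rewrite ltn_subRL in hj => hz; case/negP: (cr_nz CR).
have hj' : (k + j <= M.-1)%N by rewrite -ltnS prednK ?(cr_len CR).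
by rewrite -(subnKC hj') exprD hz mul0r.
Qed.

Section Basis.
Variables (V : finLmodType R).

Definition pgen (I : finType) (x : I -> V) (e : I -> nat) := [/\ forall i, (e i <= M)%N, forall i, pi ^+ e i *: x i = 0 &
  forall v, exists c : I -> R, v = \sum_i c i *: x i].

(** The only relations are those of the form [pi ^+ e i *: x i = 0], so V is the direct sum of the
    cyclic modules R / (pi ^+ e i). *)
Definition pbasis (I : finType) (x : I -> V) (e : I -> nat) := pgen x e /\
  forall c : I -> R, \sum_i c i *: x i = 0 -> forall i, dv (e i) (c i).

(** From a relation with a non-trivial term, extract the largest power pi ^+ k dividing every term
    that is not trivially 0. Some coefficient is then [pi ^+ k * u] with [u] a unit and k below the
    order of its generator. The remaining combination [y] is killed by pi ^+ k and can replace that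
    generator, because [u] is invertible. *)
Lemma pgen_step (I : finType) (x : I -> V) (e : I -> nat) : pgen x e -> ~ pbasis x e ->
  exists (x' : I -> V) (e' : I -> nat), pgen x' e' /\ (\sum_i e' i < \sum_i e i)%N.
Proof.
move=> gx nb; have [g1 g2 g3] := gx.
have [c [hc [i1 hi1]]] : exists c : I -> R, \sum_i c i *: x i = 0 /\ exists i, ~ dv (e i) (c i).
  apply: NNPP => h; apply: nb; split=> // c hc i; apply: NNPP => hi; apply: h.
  by exists c; split=> //; exists i.
pose P k := forall i, dv k (c i) \/ dv (e i) (c i).
have [k [Pk nPk]] : exists k, P k /\ ~ P k.+1.
  apply: NNPP => h.
  have PM k : P k.
    elim: k => [|k IH]; first by move=> i; left; exists (c i); rewrite expr0 mul1r.
    by apply: NNPP => hk; apply: h; exists k.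
  by apply: hi1; case: (PM M i1) => //; apply: dvW.
have [i0 [n1 n2]] : exists i, ~ dv k.+1 (c i) /\ ~ dv (e i) (c i).
  apply: NNPP => h; apply: nPk => i; apply: NNPP => hi; apply: h; exists i.
  by split=> hh; apply: hi; [left | right].
have [d hd] : exists d : I -> R, forall i, pi ^+ k *: (d i *: x i) = c i *: x i.
  have H i : exists di, pi ^+ k *: (di *: x i) = c i *: x i.
    case: (Pk i) => [[d ->]|[d ->]]; first by exists d; rewrite scalerA.
    by exists 0; rewrite scale0r scaler0 mulrC -scalerA g2 scaler0.
  have [d hd] := fin_all_exists H; by exists d.
have [[u hu]|//] := Pk i0.
have ki : (k < e i0)%N.
  by rewrite ltnNge; apply/negP => h; apply: n2; exists (pi ^+ (k - e i0) * u); rewrite mulrA -exprD subnKC.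
have [v hv] : exists v, u * v = 1.
  case: (unit_or_dv u) => // -[t ht]; case: n1; exists t.
  by rewrite hu ht mulrA expr1 -exprSr.
pose d' i := if i == i0 then u else d i.
have hd' i : pi ^+ k *: (d' i *: x i) = c i *: x i.
  by rewrite /d'; case: eqP => [->|_ //]; rewrite hu scalerA.
pose y := \sum_i d' i *: x i.
have hy : pi ^+ k *: y = 0.
  by rewrite scaler_sumr (eq_bigr (fun i => c i *: x i)).
exists (fun i => if i == i0 then y else x i), (fun i => if i == i0 then k else e i); split; last first.
  rewrite (bigD1 i0) //= eqxx [X in (_ < X)%N](bigD1 i0) //= -addSn leq_add //.
  by apply: leq_sum => i /negPf ->.
split=> [i|i|w].
- by case: eqP => // _; apply: leq_trans (ltnW ki) (g1 _).
- by case: eqP.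
have [a ea] := g3 w; pose b := a i0 * v.
exists (fun i => if i == i0 then b else a i - b * d i).
rewrite ea (bigD1 i0) //= [RHS](bigD1 i0) //= eqxx.
have -> : \sum_(i | i != i0) (if i == i0 then b else a i - b * d i) *: (if i == i0 then y else x i) =
   \sum_(i | i != i0) a i *: x i - b *: \sum_(i | i != i0) d' i *: x i.
  rewrite scaler_sumr -sumrB; apply: eq_bigr => i /negPf hi; rewrite /d' hi.
  by rewrite scalerBl scalerA.
rewrite /y [X in b *: X](bigD1 i0) //= scalerDr {1}/d' eqxx scalerA /b -mulrA [v * u]mulrC hv mulr1.
by rewrite -addrA; congr (_ + _); rewrite addrCA subrr addr0.
Qed.

(* The generating family V itself is improved by pgen_step until the sum of the orders is minimal. *)
Lemma pbasis_exists : exists (x : V -> V) (e : V -> nat), pbasis x e.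
Proof.
suff H n (x : V -> V) e : pgen x e -> (\sum_i e i < n)%N -> exists (x' : V -> V) e', pbasis x' e'.
  apply: (H (\sum_(i : V) M).+1 id (fun=> M)) => //; split=> // [i|v].
    by rewrite (cr_nil CR) scale0r.
  exists (fun i => (i == v)%:R); rewrite (bigD1 v) //= eqxx scale1r big1 ?addr0 // => i /negPf ->.
  by rewrite scale0r.
elim: n x e => // n IH x e gx hn.
case: (classic (pbasis x e)) => [h|h]; first by exists x, e.
have [x' [e' [gx' h']]] := pgen_step gx h.
by apply: (IH x' e') => //; apply: leq_trans h' _.
Qed.

End Basis.
End Chain.

Section CmodBasis.
Variables (R : finComNzRingType) (pi : R) (p M : nat).
Hypothesis CR : chain_ring pi p M.
Variables (I : finType) (e : I -> nat).
Hypothesis eM : forall i, (e i <= M)%N.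
Local Notation W := (cmod pi e).

Definition cgen_fun (i : I) : cfun R I := [ffun j => if j == i then pi ^+ (M - e i) else 0].
Lemma cgenP i : cgen_fun i \in cpred pi e.
Proof.
apply/forallP => j; rewrite ffunE; case: (j =P i) => [->|_]; last by rewrite mulr0.
by rewrite -exprD subnKC // (cr_nil CR).
Qed.
Definition cgen i : W := CMod (cgenP i).

Lemma cmod_sumE (c : I -> R) j : (cval (\sum_i c i *: cgen i) : {ffun _ -> _}) j = pi ^+ (M - e j) * c j.
Proof.
have -> : cval (\sum_i c i *: cgen i) = \sum_i c i *: cgen_fun i.
  by elim/big_rec2: _ => // i a b _ <-.
rewrite sum_ffunE (bigD1 j) //= !ffunE eqxx big1 ?addr0 1?mulrC // => i hi.
by rewrite !ffunE eq_sym (negPf hi) scaler0.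
Qed.

Lemma cmod_basis : pbasis pi M cgen e.
Proof.
split; first split=> // [i|v].
- apply: val_inj; apply/ffunP => j; rewrite /= !ffunE; case: (j =P i) => [_|_]; last by rewrite scaler0.
  by rewrite -[_ *: _]/(_ * _) -exprD subnKC // (cr_nil CR).
- have H i : exists d, (cval v : {ffun _ -> _}) i = pi ^+ (M - e i) * d.
    by apply: (ann_pi CR (eM i)); apply/eqP; case: v => c /= /forallP.
  have [d hd] := fin_all_exists H; exists d.
  by apply: val_inj; apply/ffunP => j; rewrite [RHS]cmod_sumE.
move=> c hc i; have := congr1 (fun v : W => (cval v : {ffun _ -> _}) i) hc.
rewrite cmod_sumE ffunE => h; rewrite -(subKn (eM i)); apply: (ann_pi CR) => //.
exact: leq_subr.
Qed.
End CmodBasis.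

(** * Bijections additive on the socle and modulo the uniformiser *)

Section Quasi.
Variables (R1 R2 : nzRingType) (pi1 : R1) (pi2 : R2) (V : lmodType R1) (W : lmodType R2).

(** In general no ring morphism links R1 and R2, so commutation with the uniformisers stands in for
    linearity. Additivity is strict if the second summand lies in the socle, and holds up to a
    multiple of [pi2] otherwise. *)
Definition quasi (f : V -> W) := [/\ bijective f, forall x, f (pi1 *: x) = pi2 *: f x,
  forall x w, pi1 *: w = 0 -> f (x + w) = f x + f w &
  forall x y, exists z, f (x + y) = f x + f y + pi2 *: z].

Variable f : V -> W.
Hypothesis qf : quasi f.

Lemma quasi0 : f 0 = 0.
Proof.
case: qf => _ _ h _; have := h 0 0 (scaler0 _ _); rewrite addr0 => /eqP.
by rewrite -subr_eq0 opprD addNKr oppr_eq0 => /eqP.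
Qed.

Lemma quasi_mod x y : exists z, f (x + pi1 *: y) = f x + pi2 *: z.
Proof.
case: qf => _ h1 _ h2; have [z ->] := h2 x (pi1 *: y); exists (f y + z).
by rewrite h1 scalerDr addrA.
Qed.

Lemma quasi_modV x y z : f x = f y + pi2 *: z -> exists t, x = y + pi1 *: t.
Proof.
case: qf => -[g fg gf] h1 _ h2 e; have [z' ez] := h2 y (x - y).
have ed : f (x - y) = pi2 *: (z - z').
  by move: ez; rewrite addrC subrK e -addrA => /addrI e2; rewrite scalerBr e2 addrK.
exists (g (z - z')); rewrite -[pi1 *: _]fg h1 gf -ed fg.
by rewrite addrC subrK.
Qed.

Lemma quasi_nat i x : exists z, f (x *+ i) = f x *+ i + pi2 *: z.
Proof.
elim: i => [|i [z IH]]; first by exists 0; rewrite !mulr0n quasi0 scaler0 addr0.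
case: qf => _ _ _ h; have [t ht] := h x (x *+ i); exists (z + t).
by rewrite !mulrS ht IH scalerDr !addrA.
Qed.

End Quasi.

Lemma quasi_inv (R1 R2 : nzRingType) (pi1 : R1) (pi2 : R2) (V : lmodType R1) (W : lmodType R2)
    (f : V -> W) g : quasi pi1 pi2 f -> cancel f g -> cancel g f -> quasi pi2 pi1 g.
Proof.
move=> qf fg gf; have [_ h1 h2 h3] := qf; split; first by exists f.
- by move=> x; rewrite -{1}[x]gf -h1 fg.
- move=> x w hw; apply: (can_inj fg); rewrite gf h2 ?gf //; apply: (can_inj fg).
  by rewrite h1 gf hw (quasi0 qf).
move=> x y; have [z hz] := h3 (g x) (g y).
apply: (quasi_modV qf (z := - z)).
by rewrite hz !gf scalerN addrK.
Qed.

Lemma quasi_comp (R1 R2 R3 : nzRingType) (pi1 : R1) (pi2 : R2) (pi3 : R3) (V : lmodType R1)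
    (W : lmodType R2) (U : lmodType R3) (f : V -> W) (g : W -> U) :
  quasi pi1 pi2 f -> quasi pi2 pi3 g -> quasi pi1 pi3 (g \o f).
Proof.
move=> qf qg; have [f0 f1 f2 f3] := qf; have [g0 g1 g2 g3] := qg; split.
- exact: bij_comp.
- by move=> x; rewrite /= f1 g1.
- by move=> x w hw; rewrite /= f2 // g2 // -f1 hw (quasi0 qf).
move=> x y /=; have [z ->] := f3 x y; have [t ->] := quasi_mod qg (f x + f y) z.
by have [s ->] := g3 (f x) (f y); exists (s + t); rewrite scalerDr addrA.
Qed.

Lemma quasi_linear_iso (R : nzRingType) (pi : R) (V W : lmodType R) (f : V -> W) :
  linear f -> bijective f -> quasi pi pi f.
Proof.
move=> lf bf; have D x y : f (x + y) = f x + f y by rewrite -[x]scale1r lf !scale1r.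
have f0 : f 0 = 0 by apply: (@addrI _ (f 0)); rewrite -D !addr0.
split=> // [x|x y]; first by rewrite -[pi *: x]addr0 lf f0 addr0.
by exists 0; rewrite scaler0 addr0.
Qed.

Section Linearize.
Variables (R : finComNzRingType) (pi : R) (p M : nat).
Hypothesis CR : chain_ring pi p M.
Variables (V W : finLmodType R) (f : V -> W).
Hypothesis qf : quasi pi pi f.

Lemma quasi_scale c x : exists z, f (c *: x) = c *: f x + pi *: z.
Proof.
have [i [r ->]] := cr_res CR c; rewrite scalerDl -scalerA.
have [z ->] := quasi_mod qf (i%:R *: x) (r *: x); have [t] := quasi_nat qf i x; rewrite -!scaler_nat => ->.
exists (t + z - r *: f x); rewrite scalerDl scalerBr scalerDr -!addrA; congr (_ + _).
by rewrite [RHS]addrC -!addrA -scalerA addNr addr0.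
Qed.

Lemma quasi_sum (I : finType) (c : I -> R) (x : I -> V) :
  exists z, f (\sum_i c i *: x i) = \sum_i c i *: f (x i) + pi *: z.
Proof.
elim/big_rec2: _ => [|i a b _ [z IH]]; first by exists 0; rewrite (quasi0 qf) scaler0 addr0.
case: qf => _ _ _ h; have [t ->] := h (c i *: x i) b; have [s ->] := quasi_scale (c i) (x i).
exists (s + z + t); rewrite IH !scalerDr -!addrA; congr (_ + _).
by rewrite addrCA.
Qed.

(** Take the linear map [g] that agrees with [f] on a basis; the orders of the basis elements make
    it well defined. It agrees with [f] modulo pi because [f] is additive modulo pi, and on the
    socle because that is spanned by the pi ^+ (e i).-1 *: x i, with which [f] is compatible. Being
    injective on the socle, [g] is injective. *)
Lemma linearize : exists g : V -> W, [/\ linear g, bijective g,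
  forall x, exists z, g x = f x + pi *: z & forall w, pi *: w = 0 -> g w = f w].
Proof.
have [x [e [[e1 e2 e3] e4]]] := pbasis_exists CR V.
have [co hco] := fin_all_exists e3.
have fX k v : f (pi ^+ k *: v) = pi ^+ k *: f v.
  case: qf => _ h _ _; elim: k v => [|k IH] v; first by rewrite !expr0 !scale1r.
  by rewrite !exprS -!scalerA h IH.
have ex i : pi ^+ e i *: f (x i) = 0 by rewrite -fX e2 (quasi0 qf).
have wd0 (c : V -> R) : \sum_i c i *: x i = 0 -> \sum_i c i *: f (x i) = 0.
  move=> hc; rewrite big1 // => i _; have [d ->] := e4 c hc i.
  by rewrite mulrC -scalerA ex scaler0.
pose g v := \sum_i co v i *: f (x i).
have gE (c : V -> R) v : v = \sum_i c i *: x i -> g v = \sum_i c i *: f (x i).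
  move=> ev; apply/eqP; rewrite -subr_eq0 -sumrB.
  under eq_bigr => i _ do rewrite -scalerBl.
  apply/eqP; apply: (wd0 (fun i => co v i - c i)).
  under eq_bigr => i _ do rewrite scalerBl.
  by rewrite sumrB -hco -ev subrr.
have lg : linear g.
  move=> a u v; rewrite (gE (fun i => a * co u i + co v i)).
    by rewrite scaler_sumr -big_split; apply: eq_bigr => i _; rewrite scalerDl scalerA.
  rewrite [in LHS](hco u) [in LHS](hco v) scaler_sumr -big_split; apply: eq_bigr => i _ /=.
  by rewrite scalerDl scalerA.
have gsoc w : pi *: w = 0 -> g w = f w.
  move=> hw; have [f0 f1 f2 f3] := qf.
  (* A coordinate of a socle element is a multiple of pi ^+ (e i).-1 up to trivial terms, and only
     the residue j of the cofactor matters. *)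
  have H i : exists j : nat, co w i *: x i = j%:R *: (pi ^+ (e i).-1 *: x i) /\
      co w i *: f (x i) = j%:R *: (pi ^+ (e i).-1 *: f (x i)) /\ pi *: (pi ^+ (e i).-1 *: x i) = 0.
    have hc : \sum_i (pi * co w i) *: x i = 0.
      by under eq_bigr => k _ do rewrite -scalerA; rewrite -scaler_sumr -hco.
    have [d hd] := e4 _ hc i.
    case ei: (e i) (ex i) (e2 i) (e1 i) => [|k] /= exi exi' eM.
      rewrite expr0 scale1r in exi; rewrite expr0 scale1r in exi'.
      by exists 0%N; rewrite exi exi' !scaler0.
    have [t ht] : dv pi k (co w i - pi ^+ k * d).
      apply: (@dvW _ pi k (M - 1)); first by rewrite subn1 -ltnS prednK // (cr_len CR).
      apply: (ann_pi CR); first exact: cr_len CR.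
      by rewrite expr1 mulrBr hd ei mulrA -exprS subrr.
    have ec : co w i = pi ^+ k * (d + t) by rewrite mulrDr -ht addrC subrK.
    have [j [r ejr]] := cr_res CR (d + t); exists j.
    have key (U : lmodType R) (y : U) : pi ^+ k.+1 *: y = 0 ->
        (pi ^+ k * (j%:R + pi * r)) *: y = j%:R *: (pi ^+ k *: y).
      move=> hy; rewrite mulrDr scalerDl mulrA -exprSr [_ * r]mulrC -[(r * _) *: _]scalerA hy.
      by rewrite scaler0 addr0 mulrC scalerA.
    rewrite ec ejr; split; first exact: key.
    split; first exact: key.
    by rewrite scalerA -exprS.
  have fn j v : pi *: v = 0 -> f (j%:R *: v) = j%:R *: f v.
    move=> hv; elim: j => [|j IH]; first by rewrite !scale0r (quasi0 qf).
    by rewrite -[j.+1]addn1 natrD !scalerDl !scale1r f2 // IH.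
  rewrite [in RHS](hco w) /g.
  suff [] : f (\sum_i co w i *: x i) = \sum_i co w i *: f (x i) /\ pi *: (\sum_i co w i *: x i) = 0 by [].
  elim/big_rec2: _ => [|i a b _ [IH1 IH2]]; first by rewrite (quasi0 qf) scaler0.
  have [j [h1 [h2 h3]]] := H i; split; last by rewrite scalerDr IH2 h1 (scalerA pi) [pi * _]mulrC -scalerA h3 scaler0 addr0.
  rewrite addrC f2; first by rewrite IH1 h1 h2 fn // fX addrC.
  by rewrite h1 (scalerA pi) [pi * _]mulrC -scalerA h3 scaler0.
have gX k v : g (pi ^+ k *: v) = pi ^+ k *: g v.
  have g0 : g 0 = 0 by have := lg (-1) 0 0; rewrite scaler0 addr0 scaleN1r addNr.
  by have := lg (pi ^+ k) v 0; rewrite !addr0 g0 addr0.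
have ginj : injective g.
  have K v : g v = 0 -> v = 0.
    move=> gv; have E k : pi ^+ k *: v = 0.
      (* Descending induction on the exponent, from pi ^+ M = 0 down to exponent 0: at each stage
         the multiple of [v] lies in the socle, where [g] is the injective map [f]. The summand k -
         M covers exponents above M. *)
      have -> : k = (M - (M - k) + (k - M))%N.
        by case: (leqP k M) => h; [rewrite subKn // (eqP h) addn0 | rewrite (eqP (ltnW h)) subn0 subnKC // ltnW].
      move: (M - k)%N => d; rewrite exprD mulrC -scalerA.
      suff -> : pi ^+ (M - d) *: v = 0 by rewrite scaler0.
      elim: d => [|d IH]; first by rewrite subn0 (cr_nil CR) scale0r.
      case: (leqP M d) => hd; first by move: IH; rewrite !(eqP (leq_trans hd _)) // (eqP hd).
      have hw : pi *: (pi ^+ (M - d.+1) *: v) = 0 by rewrite scalerA -exprS -subSn.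
      have := gsoc _ hw; rewrite gX gv scaler0; case: qf => -[f' ff' _] _ _ _ hf.
      by rewrite -[LHS]ff' -hf -(quasi0 qf) ff'.
    by have := E 0%N; rewrite expr0 scale1r.
  move=> u v euv; apply/eqP; rewrite -subr_eq0; apply/eqP; apply: K.
  by have := lg (-1) v u; rewrite !scaleN1r euv addNr addrC.
exists g; split=> //.
- apply: (inj_card_bij ginj); case: qf => bf _ _ _; by rewrite (bij_eq_card bf).
move=> v; have [z hz] := quasi_sum (co v) x; exists (- z).
by rewrite [in RHS](hco v) hz scalerN addrK.
Qed.

End Linearize.

(** * Comparing modules over two chain rings of equal length *)

Section Digits.
Variables (R1 R2 : finComNzRingType) (pi1 : R1) (pi2 : R2) (p M : nat).
Hypotheses (C1 : chain_ring pi1 p M) (C2 : chain_ring pi2 p M).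
(* f0 stands for the map which reads the base-pi1 digits of its argument in base pi2. *)
Variable f0 : R1 -> R2.
Hypothesis F1 : forall a, f0 (pi1 * a) = pi2 * f0 a.
Hypothesis F2 : forall e a b, exists z,
  f0 (a + pi1 ^+ e * b) = f0 a + pi2 ^+ e * f0 b + pi2 ^+ e.+1 * z.
Hypothesis F4 : forall b, dv pi2 1 (f0 b) -> dv pi1 1 b.
Hypothesis card12 : #|R1| = #|R2|.

Lemma f0_dv e a a' : dv pi1 e (a - a') -> dv pi2 e (f0 a - f0 a').
Proof.
case=> b hb; have [z hz] := F2 e a' b; rewrite -hb addrC subrK in hz.
by exists (f0 b + pi2 * z); rewrite hz mulrDr mulrA -exprSr -[f0 a' + _ + _]addrA [f0 a' + _]addrC addrK.
Qed.

(** One digit at a time: if [a - a'] is pi1 ^+ e times [b], one more factor pi2 in the images forces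
    pi2 to divide [f0 b], whence pi1 divides [b] by [F4]. *)
Lemma f0_dvV e a a' : (e <= M)%N -> dv pi2 e (f0 a - f0 a') -> dv pi1 e (a - a').
Proof.
elim: e => [|e IH] he h; first by exists (a - a'); rewrite expr0 mul1r.
have [b hb] := IH (ltnW he) (dvW (leqnSn e) h).
have [z hz] := F2 e a' b; rewrite -hb addrC subrK in hz.
case: h => s; rewrite hz -[f0 a' + _ + _]addrA [f0 a' + _]addrC addrK => hs.
have : pi2 ^+ e * (f0 b - pi2 * (s - z)) = 0.
  rewrite mulrBr mulrA -exprSr [in X in _ - X]mulrBr -hs addrK subrr //.
move/(ann_pi C2 (ltnW he)) => h.
have {h} h : dv pi2 1 (f0 b - pi2 * (s - z)) by apply: dvW h; rewrite subn_gt0.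
have [d hd] : dv pi1 1 b.
  apply: F4; rewrite -[f0 b](subrK (pi2 * (s - z))); apply: dvD => //.
  by exists (s - z); rewrite expr1.
by exists d; rewrite hb hd expr1 mulrA -exprSr.
Qed.

Lemma f0_inj : injective f0.
Proof.
move=> a a' h; have [d] : dv pi1 M (a - a').
  by apply: f0_dvV => //; exists 0; rewrite h subrr mulr0.
by rewrite (cr_nil C1) mul0r => /eqP; rewrite subr_eq0 => /eqP.
Qed.

Lemma f0_surj b : exists a, f0 a = b.
Proof. by have [g _ gK] := inj_card_bij f0_inj (eq_leq (esym card12)); exists (g b). Qed.

Lemma f0_0 : f0 0 = 0.
Proof.
have E k : f0 0 = pi2 ^+ k * f0 0.
  by elim: k => [|k IH]; [rewrite expr0 mul1r | rewrite exprS -mulrA -IH -F1 mulr0].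
by rewrite (E M) (cr_nil C2) mul0r.
Qed.

(** Apply [f0] to coordinates. It respects congruence modulo the powers of the uniformisers, so the
    choice of coordinates is immaterial ([fE]). Carries in a sum go to higher digits, which gives
    additivity modulo [pi2]. A socle element has only a top digit in each coordinate, and carries
    out of that digit vanish. *)
Lemma quasi_bases (V : finLmodType R1) (W : finLmodType R2) (I : finType) (e : I -> nat)
    (x : I -> V) (y : I -> W) : pbasis pi1 M x e -> pbasis pi2 M y e ->
  exists f : V -> W, quasi pi1 pi2 f.
Proof.
move=> [[x1 x2 x3] x4] [[y1 y2 y3] y4].
have [co hco] := fin_all_exists x3.
pose f v := \sum_i f0 (co v i) *: y i.
have dvy i b : dv pi2 (e i) b -> b *: y i = 0.
  by case=> d ->; rewrite mulrC -scalerA y2 scaler0.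
have fE (c : I -> R1) v : v = \sum_i c i *: x i -> f v = \sum_i f0 (c i) *: y i.
  move=> ev; apply/eqP; rewrite -subr_eq0 -sumrB big1 // => i _; rewrite -scalerBl.
  apply: dvy; apply: f0_dv; apply: (x4 (fun i => co v i - c i)).
  under eq_bigr => j _ do rewrite scalerBl.
  by rewrite sumrB -hco -ev subrr.
have finj : injective f.
  move=> u v euv; rewrite (hco u) (hco v); apply/eqP; rewrite -subr_eq0 -sumrB big1 // => i _.
  rewrite -scalerBl; have [|d ->] := @f0_dvV (e i) (co u i) (co v i) (x1 i); last first.
    by rewrite mulrC -scalerA x2 scaler0.
  apply: (y4 (fun i => f0 (co u i) - f0 (co v i))).
  under eq_bigr => j _ do rewrite scalerBl.
  by rewrite sumrB -/(f u) -/(f v) euv subrr.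
have fsurj w : exists v, f v = w.
  have [d hd] := y3 w; have [a ha] := fin_all_exists (fun i => f0_surj (d i)).
  exists (\sum_i a i *: x i); rewrite (fE a) // hd; apply: eq_bigr => i _.
  by rewrite ha.
exists f; split.
- have [g hg] := fin_all_exists fsurj; exists g => // v; apply: finj; exact: hg.
- move=> v; rewrite (fE (fun i => pi1 * co v i)).
    by rewrite scaler_sumr; apply: eq_bigr => i _; rewrite F1 scalerA.
  by rewrite {1}(hco v) scaler_sumr; apply: eq_bigr => i _; rewrite scalerA.
- move=> v w hw; rewrite (fE (fun i => co v i + co w i)); last first.
    by rewrite {1}(hco v) {1}(hco w) -big_split; apply: eq_bigr => i _; rewrite scalerDl.
  rewrite -big_split; apply: eq_bigr => i _ /=.
  have hc : \sum_i (pi1 * co w i) *: x i = 0.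
    by under eq_bigr => k _ do rewrite -scalerA; rewrite -scaler_sumr -hco.
  have [d hd] := x4 _ hc i; have := dvy i; have := x1 i; move: hd.
  case ei: (e i) => [|k] hd eM dy.
    by have yi0 b : b *: y i = 0; [apply: dy; exists b; rewrite expr0 mul1r | rewrite !yi0 addr0].
  have [t ht] : dv pi1 k (co w i).
    have -> : co w i = (co w i - pi1 ^+ k * d) + pi1 ^+ k * d by rewrite subrK.
    apply: dvD; last by exists d.
    apply: (@dvW _ pi1 k (M - 1)); first by rewrite subn1 -ltnS prednK // (cr_len C1).
    apply: (ann_pi C1); first exact: cr_len C1.
    by rewrite expr1 mulrBr hd mulrA -exprS subrr.
  have [z hz] := F2 k (co v i) t; have [z' hz'] := F2 k 0 t.
  rewrite add0r -ht f0_0 add0r in hz'; rewrite -ht in hz.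
  rewrite hz hz' !scalerDl -addrA; congr (_ + _); congr (_ + _).
  by rewrite !dy //; [exists z' | exists z].
move=> v w.
have [z hz] := fin_all_exists (fun i => F2 0 (co v i) (co w i)).
exists (\sum_i z i *: y i); rewrite (fE (fun i => co v i + co w i)); last first.
  by rewrite {1}(hco v) {1}(hco w) -big_split; apply: eq_bigr => i _; rewrite scalerDl.
rewrite scaler_sumr -!big_split; apply: eq_bigr => i _ /=.
by have := hz i; rewrite !expr0 !mul1r expr1 => ->; rewrite !scalerDl scalerA.
Qed.

Lemma quasi_to (V : finLmodType R1) : exists (W : finLmodType R2) (f : V -> W), quasi pi1 pi2 f.
Proof.
have [x [e hx]] := pbasis_exists C1 V.
have eM : forall i, (e i <= M)%N by case: hx => -[].
exists (cmod pi2 e); exact: (quasi_bases hx (cmod_basis C2 eM)).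
Qed.

Lemma quasi_from (W : finLmodType R2) : exists (V : finLmodType R1) (f : V -> W), quasi pi1 pi2 f.
Proof.
have [y [e hy]] := pbasis_exists C2 W.
have eM : forall i, (e i <= M)%N by case: hy => -[].
exists (cmod pi1 e); exact: (quasi_bases (cmod_basis C1 eM) hy).
Qed.

End Digits.

HB.instance Definition _ (p n : nat) := GRing.ComNzRing.on (truncR p n).
HB.instance Definition _ (p n : nat) := Finite.on (truncR p n).

(** * Base-p digits: from Z/q to truncated polynomials *)

Section Rings.
Variables (p n : nat) (pp : prime p).
Local Notation M := (n.-1.+1).
Local Notation q := (p ^ M)%N.
Local Notation R2 := (truncR p n).
Local Notation T := (Tgen p n).

Lemma q_gt1 : (1 < q)%N.
Proof. by rewrite -(exp1n M) ltn_exp2r // prime_gt1. Qed.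

Lemma chain_Zq : chain_ring (p%:R : 'Z_q) p M.
Proof.
have q1 := q_gt1; split=> //.
- by rewrite -natrX pchar_Zp.
- rewrite -natrX; apply/eqP => /(congr1 val) /=; rewrite val_Zp_nat // modn_small.
    by move/eqP; rewrite expn_eq0 eqn0Ngt prime_gt0.
  by rewrite ltn_exp2l // prime_gt1.
- move=> r; exists (r %% p)%N, (r %/ p)%:R.
  by rewrite -natrM -natrD mulnC addnC -divn_eq natr_Zp.
by exists 1; rewrite mulr1.
Qed.

Lemma TgenX k : T ^+ k = in_qpoly ('X^n) ('X^k).
Proof. by rewrite /Tgen /qpolyX -rmorphXn. Qed.

Lemma p_trunc0 : (p%:R : R2) = 0.
Proof.
by have := pchar_qpoly ('X^n : {poly 'F_p}) p; rewrite (pchar_Fp pp); apply: pcharf0.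
Qed.

(** For n = 0 the modulus X^0 = 1 is replaced by X in the definition of the quotient ring, so the
    length is 1; this is why M is [n.-1.+1]. *)
Lemma chain_trunc : chain_ring (T : R2) p M.
Proof.
split=> //.
- by rewrite TgenX; apply: val_inj; rewrite /= mk_monic_Xn; apply: Pdiv.RingMonic.rmodpp; apply: monicXn.
- rewrite TgenX; apply/eqP => /(congr1 val) /=; rewrite Pdiv.CommonRing.rmodp_small.
    by move/eqP; rewrite -size_poly_eq0 size_polyXn.
  by rewrite mk_monic_Xn !size_polyXn.
- move=> r; pose c := (val r : {poly 'F_p})`_0; pose d := drop_poly 1 (val r : {poly 'F_p}).
  exists (nat_of_ord c), (in_qpoly ('X^n) d).
  have er : in_qpoly ('X^n) (val r) = r :> R2.
    by apply: val_inj; rewrite /= Pdiv.CommonRing.rmodp_small //; apply: size_mk_monic.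
  have ed : val r = c%:P + 'X * d.
    rewrite -{1}(poly_take_drop 1 (val r)) expr1 [d * _]mulrC; congr (_ + _).
    by apply/polyP => i; rewrite coef_take_poly coefC; case: i.
  rewrite -{1}er ed rmorphD rmorphM /= -/T; congr (_ + _).
  have -> : c%:P = (nat_of_ord c)%:R by rewrite -polyC_natr natr_Zp.
  exact: rmorph_nat.
by exists 0; rewrite mulr0 p_trunc0.
Qed.

Lemma card_trunc : #|{: R2}| = q.
Proof. by rewrite card_qpoly mk_monic_Xn size_polyXn card_Fp. Qed.

Lemma card_ZqE : #|{: 'Z_q}| = q.
Proof. by rewrite card_ord Zp_cast // q_gt1. Qed.

(* As p = 0 in R2, (a %/ p ^ k)%:R only depends on the k-th base-p digit of a. *)
Definition digit_sum (a : nat) : R2 := \sum_(k < M) (a %/ p ^ k)%:R * T ^+ k.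

Lemma p_dvd0 a b : (p %| b)%N -> ((a + b)%:R : R2) = a%:R.
Proof. by case/dvdnP => c ->; rewrite natrD natrM p_trunc0 mulr0 addr0. Qed.

(** Adding p ^ e * b changes the quotients by p ^ k with k < e by multiples of p only, and adds b to
    the one with k = e; the carries affect k > e and are collected in [z]. *)
Lemma digit_sum_lead e a b : exists z,
  digit_sum (a + p ^ e * b) = digit_sum a + b%:R * T ^+ e + T ^+ e.+1 * z.
Proof.
have p0 := prime_gt0 pp.
have H (k : 'I_M) : exists z, ((a + p ^ e * b) %/ p ^ k)%:R * T ^+ k =
    (a %/ p ^ k)%:R * T ^+ k + (if k == e :> nat then b%:R * T ^+ e else 0) + T ^+ e.+1 * z.
  have pk : (0 < p ^ k)%N by rewrite expn_gt0 p0.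
  case: (ltngtP k e) => [ke|ek|ek].
  - exists 0; rewrite mulr0 !addr0; congr (_ * _).
    rewrite -(subnKC (ltnW ke)) expnD -mulnA [(p ^ k * _)%N]mulnC addnC divnMDl // addnC p_dvd0 //.
    by rewrite dvdn_mulr // dvdn_exp // subn_gt0.
  - exists ((((a + p ^ e * b) %/ p ^ k)%:R - (a %/ p ^ k)%:R) * T ^+ (k - e.+1)).
    by rewrite mulrCA -exprD subnKC // addr0 mulrBl addrC subrK.
  exists 0; rewrite mulr0 addr0 -ek [(p ^ k * b)%N]mulnC addnC divnMDl // addnC natrD mulrDl //.
have [z hz] := fin_all_exists H; exists (\sum_k z k).
rewrite /digit_sum (eq_bigr _ (fun k _ => hz k)) !big_split /= mulr_sumr; congr (_ + _ + _).
case: (ltnP e M) => he; last first.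
  rewrite big1 => [|k _]; last by rewrite ltn_eqF // (leq_trans _ he).
  by rewrite -(subnKC he) exprD (cr_nil chain_trunc) mul0r mulr0.
rewrite (bigD1 (Ordinal he)) //= eqxx big1 ?addr0 // => k hk.
by case: eqP => // h; case/eqP: hk; apply: val_inj.
Qed.

Lemma digit_sum_mod a : digit_sum (a %% q) = digit_sum a.
Proof.
rewrite {2}(divn_eq a q) addnC mulnC; have [z ->] := digit_sum_lead M (a %% q) (a %/ q).
have z0 : T ^+ M = 0 := cr_nil chain_trunc.
by rewrite z0 mulr0 addr0 [T ^+ M.+1]exprS z0 mulr0 mul0r addr0.
Qed.

Lemma digit_sum1 b : exists z, digit_sum b = b%:R + T * z.
Proof.
have [z hz] := digit_sum_lead 0 0 b; exists z; move: hz.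
rewrite add0n mul1n expr0 mulr1 expr1 => ->; congr (_ + _).
by rewrite /digit_sum big1 ?add0r // => k _; rewrite div0n mul0r.
Qed.

Lemma digit_sum_pM a : digit_sum (p * a) = T * digit_sum a.
Proof.
have p0 := prime_gt0 pp.
rewrite /digit_sum big_ord_recl [in RHS]big_ord_recr /= mulrDr expr0 mulr1 divn1.
rewrite mulrCA -exprS (cr_nil chain_trunc) mulr0 addr0 natrM p_trunc0 mul0r add0r mulr_sumr.
apply: eq_bigr => k _; rewrite /bump /= add1n expnS divnMl // exprS mulrCA //.
Qed.

Definition digit_map (r : 'Z_q) : R2 := digit_sum r.

Lemma digit_map_nat a : digit_map a%:R = digit_sum a.
Proof. by rewrite /digit_map val_Zp_nat ?q_gt1 // digit_sum_mod. Qed.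

Lemma digit_map1 a : digit_map (p%:R * a) = T * digit_map a.
Proof. by rewrite -[a]natr_Zp -natrM !digit_map_nat digit_sum_pM. Qed.

Lemma digit_map2 e a b : exists z,
  digit_map (a + p%:R ^+ e * b) = digit_map a + T ^+ e * digit_map b + T ^+ e.+1 * z.
Proof.
rewrite -[a]natr_Zp -[b]natr_Zp -natrX -natrM -natrD !digit_map_nat.
have [z ->] := digit_sum_lead e a b; have [t ->] := digit_sum1 b.
exists (z - t); rewrite mulrDr mulrA -exprSr [b%:R * _]mulrC -!addrA; congr (_ + (_ + _)).
by rewrite mulrBr addrCA subrr addr0.
Qed.

Lemma digit_map4 b : dv (T : R2) 1 (digit_map b) -> dv (p%:R : 'Z_q) 1 b.
Proof.
have [z hz] := digit_sum1 b; rewrite -[b]natr_Zp digit_map_nat hz => -[d hd].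
have /(nat_dvd chain_trunc)/dvdnP [c ->] : dv (T : R2) 1 b%:R.
  by exists (d - z); rewrite mulrBr expr1 -[T * d]hd addrK.
by exists c%:R; rewrite natrM mulrC expr1.
Qed.

Lemma card_rings : #|{: 'Z_q}| = #|{: R2}|.
Proof. by rewrite card_ZqE card_trunc. Qed.

Lemma quasi_to_trunc (V : finLmodType 'Z_q) :
  exists (W : finLmodType R2) (f : V -> W), quasi (p%:R : 'Z_q) (T : R2) f.
Proof. exact: (quasi_to chain_Zq chain_trunc digit_map1 digit_map2 digit_map4 card_rings). Qed.

Lemma quasi_from_trunc (W : finLmodType R2) :
  exists (V : finLmodType 'Z_q) (f : V -> W), quasi (p%:R : 'Z_q) (T : R2) f.
Proof. exact: (quasi_from chain_Zq chain_trunc digit_map1 digit_map2 digit_map4 card_rings). Qed.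

End Rings.

(** * Nilpotency class of Lie algebras of order p ^ n *)

Section ClassBound.
Variables (R : nzRingType) (L : finLmodType R) (br : L -> L -> L) (p n : nat).
Hypotheses (brP : is_lie_bracket br) (pp : prime p) (cardL : #|L| = (p ^ n)%N).
Hypothesis nilL : lie_nilpotent br.

(** The terms are additive subgroups in group notation, so that Lagrange's theorem and maximal
    subgroups are at hand; the numbering starts at 0 with L. *)
Fixpoint lcs k : {group L} :=
  if k is k'.+1 then <<[set br x y | x in [set: L], y in lcs k']>>%G else [set: L]%G.

Lemma lcs_br k x y : y \in lcs k -> br x y \in lcs k.+1.
Proof. by move=> hy; apply: mem_gen; apply: imset2_f; rewrite ?inE. Qed.

Lemma lcs_foldr s y : foldr br y s \in lcs (size s).
Proof. by elim: s => [|x s IH]; [rewrite inE | apply: lcs_br]. Qed.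

Lemma lcsS k : lcs k.+1 \subset lcs k.
Proof.
elim: k => [|k IH]; first exact: subsetT.
apply: genS; apply/subsetP => z /imset2P [x y hx hy ->]; apply: imset2_f => //.
exact: (subsetP IH).
Qed.

Lemma lcs_nil : exists k, lcs k = 1%G.
Proof.
have [k hk] := nilL; exists k.
have H i : (i <= k)%N -> forall z, z \in lcs i -> forall s, size s = (k - i)%N -> foldr br z s = 0.
  elim: i => [|i IH] hi; first by move=> z _ s; rewrite subn0; apply: hk.
  apply: gen_ind => [|u v hu _ hv] s hs.
    by elim: s {hs} => // x s IHs /=; rewrite IHs (lie0r brP).
  have D : forall s, foldr br (u + v) s = foldr br u s + foldr br v s.
    by elim=> //= x t ->; rewrite (lieDr brP).
  rewrite [LHS]D hv // addr0; case/imset2P: hu => x y _ hy ->.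
  have := IH (ltnW hi) y hy (rcons s x); rewrite foldr_rcons size_rcons hs; apply.
  by rewrite -subSn.
apply/trivGP; apply/subsetP => z hz; rewrite inE; apply/eqP.
by apply: (H k (leqnn k) z hz [::]); rewrite subnn.
Qed.

Lemma lcs_const k : lcs k.+1 = lcs k -> lcs k = 1%G.
Proof.
move=> e; have C j : lcs (k + j) = lcs k.
  by elim: j => [|j IH]; [rewrite addn0 | rewrite addnS -[RHS]e /= IH].
have [j hj] := lcs_nil; have S i : lcs (j + i) = 1%G.
  elim: i => [|i IH]; first by rewrite addn0.
  by apply/trivGP; have := lcsS (j + i)%N; rewrite IH addnS.
by rewrite -(C j) addnC S.
Qed.

Lemma lcs_index (H K : {group L}) : H \proper K -> (p * #|H| <= #|K|)%N.
Proof.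
case/andP=> sHK nHK; rewrite -(Lagrange sHK) mulnC leq_pmul2l ?cardG_gt0 //.
have i1 : (1 < #|K : H|%g)%N by rewrite indexg_gt1.
have dv : (#|K : H|%g %| p ^ n)%N.
  by rewrite -cardL -cardsT; apply: dvdn_trans (dvdn_indexg _ _) (cardSg (subsetT _)).
case/(dvdn_pfactor _ _ pp): dv => j _ ej.
by rewrite ej in i1 *; case: j i1 {ej} => // j _; rewrite expnS leq_pmulr // expn_gt0 prime_gt0.
Qed.

(* If the index were p, then L would be generated by one element modulo [L, L], and [L, L] would
   equal [L, [L, L]]. *)
Lemma lcs_first : lcs 1 != 1%G -> (p ^ 2 * #|lcs 1| <= #|L|)%N.
Proof.
move=> n1; have pr1 : lcs 1 \proper lcs 0.
  rewrite properEneq lcsS andbT; apply: contra n1 => /eqP e.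
  have e' : lcs 1 = lcs 0 by apply: group_inj.
  by rewrite e' (lcs_const e').
case: (leqP (p ^ 2 * #|lcs 1|) #|L|) => // lt.
have iE : #|[set: L] : lcs 1|%g = p.
  have sT : lcs 1 \subset [set: L] by apply: subsetT.
  have dv : (#|[set: L] : lcs 1|%g %| p ^ n)%N by rewrite -cardL -cardsT; apply: dvdn_indexg.
  have i1 : (1 < #|[set: L] : lcs 1|%g)%N by rewrite indexg_gt1; case/andP: pr1.
  move: lt; rewrite -[#|L|]cardsT -(Lagrange sT) mulnC ltn_pmul2r ?cardG_gt0 //.
  case/(dvdn_pfactor _ _ pp): dv i1 => j _ ->; rewrite ltn_exp2l ?(prime_gt1 pp) //.
  by case: j => [|[|j]].
have [x _ nx] : exists2 x, x \in [set: L] & x \notin lcs 1 by case/properP: pr1.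
have mx : maximal (lcs 1) [set: L].
  by apply: p_index_maximal; rewrite ?subsetT // iE.
have gx : (lcs 1 <*> <[x]> = [set: L])%g.
  case/maxgroupP: mx => _ H; apply/eqP; apply: contraNT nx => nT.
  have e : (lcs 1 <*> <[x]>)%G = lcs 1.
    apply: group_inj; apply: H; last exact: joing_subl.
    by rewrite properEneq nT subsetT.
  by rewrite -e; apply: (subsetP (joing_subr _ _)); apply: cycle_id.
have el a : exists2 u, u \in lcs 1 & exists i, a = u + x *+ i.
  have : a \in (lcs 1 <*> <[x]>)%g by rewrite gx inE.
  have nn : (<[x]> \subset 'N(lcs 1))%g.
    apply: subset_trans (subsetT _) _; apply: sub_abelian_norm (subsetT _).
    exact: FinRing.zmod_abelian.
  rewrite norm_joinEr // => /mulsgP [u v hu /cycleP [i ->] ->]; exists u => //; exists i.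
  by rewrite FinRing.zmodMgE FinRing.zmodXgE.
case/negP: n1; apply/eqP; apply: lcs_const; apply/eqP; rewrite -val_eqE eqEsubset lcsS /=.
rewrite gen_subG; apply/subsetP => z /imset2P [a b _ _ ->].
have [u hu [i ->]] := el a; have [v hv [j ->]] := el b.
rewrite (lieDr brP) !(lieDl brP).
have nat k y w : br (y *+ k) w = br y w *+ k.
  by rewrite -!scaler_nat (lieZl brP).
have nat' k y w : br y (w *+ k) = br y w *+ k.
  by rewrite -!scaler_nat (lieZr brP).
have -> : br (x *+ i) (x *+ j) = 0 by rewrite nat nat' (liexx brP) !mul0rn.
have -> : br u (x *+ j) = br (- (x *+ j)) u by rewrite (lieC brP) (lieNl brP).
rewrite addr0 -!FinRing.zmodMgE; apply: groupM; last exact: (@lcs_br 1%N).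
by apply: groupM; apply: (@lcs_br 1%N).
Qed.

(** Otherwise the index of [lcs 1] is at least p ^ 2, each of the next p - 2 steps has index at
    least p, and [lcs p.-1] has at least p elements. Then L has at least p ^ (p + 1) elements,
    against n <= p. *)
Lemma lie_class_bound : (n <= p)%N -> lie_class br p.-1.
Proof.
move=> np.
have p1 := prime_gt1 pp.
suff e : lcs p.-1 = 1%G.
  move=> s y hs; have := lcs_foldr s y; rewrite hs e inE => /eqP //.
apply/eqP; apply: contraT => nt.
have ntk k : (k <= p.-1)%N -> lcs k != 1%G.
  move=> hk; apply: contra nt => /eqP e; apply/eqP/trivGP.
  have S d : lcs (k + d) \subset lcs k.
    elim: d => [|d IH]; first by rewrite addn0.
    by rewrite addnS; apply: subset_trans (lcsS _) IH.
  by have := S (p.-1 - k)%N; rewrite subnKC // e.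
have step k : (k <= p.-1)%N -> (p * #|lcs k.+1| <= #|lcs k|)%N.
  move=> hk; apply: lcs_index; rewrite properEneq lcsS andbT.
  apply: contra (ntk k hk) => /eqP e; apply/eqP; apply: lcs_const; exact: group_inj.
have m1 : (0 < p.-1)%N by rewrite -ltnS prednK // ltnW.
have f1 := lcs_first (ntk 1%N m1).
have chain d : (d < p.-1)%N -> (p ^ d * #|lcs d.+1| <= #|lcs 1|)%N.
  elim: d => [|d IH] hd; first by rewrite mul1n.
  apply: leq_trans (IH (ltnW hd)); rewrite expnSr -mulnA leq_mul2l step ?orbT //.
  exact: ltnW.
have := chain p.-2; rewrite -[X in (_ < X)%N]prednK // ltnSn prednK // => /(_ isT) c1.
have c2 : (p <= #|lcs p.-1|)%N.
  have := @lcs_index 1%G (lcs p.-1); rewrite cards1 muln1; apply.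
  by rewrite properEneq sub1G andbT eq_sym; apply: contra nt => /eqP e; apply/eqP; apply: group_inj.
have : (p ^ p.+1 <= #|L|)%N.
  apply: leq_trans f1.
  apply: (@leq_trans (p ^ 2 * (p ^ p.-2 * #|lcs p.-1|))); last by rewrite leq_mul2l c1 orbT.
  apply: (@leq_trans (p ^ 2 * (p ^ p.-2 * p))); last by rewrite !leq_mul2l c2 !orbT.
  by rewrite -expnSr -expnD leq_pexp2l ?prime_gt0 // !addSn add0n prednK // prednK // ltnW.
by rewrite cardL leq_exp2l // ltnNge np.
Qed.

End ClassBound.

(** * The correspondence *)

(** A scalar is an integer plus a multiple of pi, and pi kills the bracket from inside and outside;
    so biadditivity implies bilinearity. *)
Lemma lie_of_biadditive (R : finComNzRingType) (pi : R) (p M : nat) (V : lmodType R)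
    (br : V -> V -> V) : chain_ring pi p M ->
  (forall x y z, br (x + y) z = br x z + br y z) ->
  (forall x y z, br x (y + z) = br x y + br x z) ->
  (forall x, br x x = 0) ->
  (forall x y z, br x (br y z) + br y (br z x) + br z (br x y) = 0) ->
  (forall x y, pi *: br x y = 0) -> (forall x y, br (pi *: x) y = 0) ->
  is_lie_bracket br.
Proof.
move=> CR Dl Dr xx J k1 k2.
have anti x y : br x y = - br y x.
  by apply/eqP; rewrite -addr_eq0; apply/eqP; have := xx (x + y); rewrite Dl !Dr !xx add0r addr0.
have br0 z : br 0 z = 0 by apply: (@addrI _ (br 0 z)); rewrite -Dl !addr0.
have nl k x z : br (x *+ k) z = br x z *+ k.
  by elim: k => [|k IH]; [rewrite !mulr0n br0 | rewrite !mulrS Dl IH].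
have Z a x y : br (a *: x) y = a *: br x y.
  have [i [r ->]] := cr_res CR a; rewrite !scalerDl -!scalerA Dl k2 addr0.
  by rewrite !scaler_nat nl (scalerA pi) [pi * r]mulrC -scalerA k1 scaler0 addr0.
split=> // a x y z; first by rewrite Dl Z.
by rewrite Dr anti Z -scalerN -anti.
Qed.

Section Transport.
Variables (R1 R2 : finComNzRingType) (pi1 : R1) (pi2 : R2) (p M : nat).
Hypothesis C2 : chain_ring pi2 p M.
Variables (V : lmodType R1) (W : lmodType R2) (f : V -> W) (g : W -> V).
Hypotheses (qf : quasi pi1 pi2 f) (fg : cancel f g) (gf : cancel g f).
Variable br : V -> V -> V.
Hypotheses (brP : is_lie_bracket br) (br_soc : forall x y, pi1 *: br x y = 0).

Definition transport (u v : W) := f (br (g u) (g v)).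

Lemma transport_morph x y : f (br x y) = transport (f x) (f y).
Proof. by rewrite /transport !fg. Qed.

Lemma transport_soc u v : pi2 *: transport u v = 0.
Proof. by case: qf => _ h _ _; rewrite -h br_soc (quasi0 qf). Qed.

Lemma transport_lie : is_lie_bracket transport.
Proof.
have qg := quasi_inv qf fg gf; have [_ g1 _ g3] := qg; have [_ f1 f2 _] := qf.
have kl x z y : br (x + pi1 *: z) y = br x y.
  by rewrite (lieDl brP) (lieZl brP) br_soc addr0.
have kr x z y : br y (x + pi1 *: z) = br y x.
  by rewrite (lieDr brP) (lieZr brP) br_soc addr0.
apply: (lie_of_biadditive C2) => [x y z|x y z|x|x y z|x y|x y].
- have [t e] := g3 x y; rewrite /transport e kl (lieDl brP) f2 //.
- have [t e] := g3 y z; rewrite /transport e kr (lieDr brP) f2 //.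
- by rewrite /transport (liexx brP) (quasi0 qf).
- by case: brP => _ _ _ J; rewrite /transport !fg -!f2 // J (quasi0 qf).
- exact: transport_soc.
by rewrite /transport g1 (lieZl brP) br_soc (quasi0 qf).
Qed.

Lemma transport_class k : lie_class br k -> lie_class transport k.
Proof.
move=> h s y hs; have -> : foldr transport y s = f (foldr br (g y) (map g s)).
  by elim: s {hs} => [|x s IH] /=; rewrite ?gf // IH /transport fg.
by rewrite h ?size_map // (quasi0 qf).
Qed.

End Transport.

Section LazardMho.
Variables (p q : nat) (q1 : (1 < q)%N) (m : nat) (m0 : (0 < m)%N).
Variable um : invertible_upto 'Z_q m.
Variables (N : lie_over 'Z_q m) (gT : finGroupType) (G : {group gT}) (la : lo_car N -> gT).
Hypotheses (laP : lazard_iso G la) (pG : (p.-group G)%g).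
Local Notation "x ** y" := (star m (lo_br N) x y) (at level 40).

Lemma la0 : la 0 = 1%g.
Proof.
case: laP => _ _ _ h; apply: (mulgI (la 0)); rewrite -h mulg1.
by rewrite (star0x m0 um (lo_P N) (@lo_N _ _ N)).
Qed.

Lemma laX x k : (la x ^+ k)%g = la (x *+ k).
Proof.
case: laP => _ _ _ h; elim: k => [|k IH]; first by rewrite expg0 mulr0n la0.
by rewrite expgSr IH -h (star_natmul m0 (lo_P N) (@lo_N _ _ N)).
Qed.

Lemma laV x : ((la x)^-1)%g = la (- x).
Proof.
case: laP => _ _ _ h; apply/eqP; rewrite eq_invg_mul -h.
by rewrite (starxN m0 um (lo_P N) (@lo_N _ _ N)) la0.
Qed.

(** Brackets lie in the socle, so [star] is addition modulo the socle and group commutators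
    correspond to socle elements. Products of these stay in the socle, where the p-th power, which
    is multiplication by p, is trivial. *)
Lemma mho_of_socle : (forall x y, p%:R *: lo_br N x y = 0) -> ('Mho^1([~: G, G]) = 1)%g.
Proof.
move=> hbr; have [la_inj laG la_surj laM] := laP.
pose P (z : lo_car N) := p%:R *: z = 0.
have Plin (a : 'Z_q) u v : P u -> P v -> P (a *: u + v).
  by rewrite /P scalerDr scalerA mulrC -scalerA => -> ->; rewrite scaler0 addr0.
have P0 : P 0 by rewrite /P scaler0.
have PD u v : P u -> P v -> P (u + v) by move=> hu hv; rewrite -[u]scale1r; apply: Plin.
have Ps x y : P (x ** y - (x + y)) by apply: (star_mod m0 (@lo_N _ _ N)).
have Pc x y : P ((- x ** - y) ** (x ** y)).
  have e : (- x ** - y) ** (x ** y) = ((- x ** - y) ** (x ** y) - ((- x ** - y) + (x ** y)))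
     + (((- x ** - y) - (- x - y)) + ((x ** y) - (x + y))).
    rewrite [X in _ = _ + X]addrACA -opprD [- x - y + _]addrACA !addNr addr0 subr0.
    by rewrite subrK.
  by rewrite e; apply: (PD _ _ (Ps _ _)); apply: PD.
have H g : g \in [~: G, G]%g -> exists2 z, la z = g & P z.
  move: g; apply: gen_ind => [|x y hx _ [z <- hz]]; first by exists 0; rewrite ?la0.
  case/imset2P: hx => a b /la_surj [u <-] /la_surj [v <-] ->.
  exists (((- u ** - v) ** (u ** v)) ** z).
    by rewrite !laM -!laV /commg /conjg !mulgA.
  have := Ps ((- u ** - v) ** (u ** v)) z; set w := (_ ** _) ** z => hw.
  by rewrite -[w](subrK ((- u ** - v) ** (u ** v) + z)); apply: (PD) => //; apply: PD.
have pG' : (p.-group [~: G, G])%g by apply: pgroupS pG; rewrite commg_subl normG.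
have -> := MhoE 1 pG'; apply/trivgP; rewrite gen_subG expn1; apply/subsetP => _ /imsetP [g hg ->].
have [z <- hz] := H g hg; rewrite inE laX -scaler_nat hz la0 //.
Qed.

(** The quotient of G by [G, G] is the group of an abelian Lie algebra, for which [star] is
    addition. By [star_hom_lie] the projection of N onto it respects brackets, so it kills them:
    every bracket is mapped by [la] into [G, G], where p-th powers are trivial. *)
Lemma socle_of_mho : ('Mho^1([~: G, G]) = 1)%g -> forall x y, p%:R *: lo_br N x y = 0.
Proof.
move=> hM x y; have [la_inj laG la_surj laM] := laP.
pose D := [~: G, G]%G; pose Q := (G / D)%G.
have aQ : abelian Q by apply: sub_der1_abelian.
have nD z : z \in G -> z \in 'N(D)%g by apply: subsetP; apply: commg_norml.
have C (a b : subg_of Q) : (a * b = b * a)%g.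
  by apply: val_inj; apply: (centsP aQ); apply: subgP.
have H (a : abz C) : a *+ q = 0.
  rewrite abz_mulrn; apply: val_inj => /=.
  have [z nz hz ez] := morphimP (subgP (a : subg_of Q)).
  have -> : val (a ^+ q : subg_of Q)%g = (sgval a ^+ q)%g by rewrite -morphX ?inE.
  have [t et] := la_surj z hz.
  by rewrite ez -morphX // -et laX (Zq_mulrn q1) la0 morph1.
pose W := zqmod q1 H; pose br0 := fun (_ _ : W) => 0 : W.
have br0P : is_lie_bracket br0.
  by split=> *; rewrite /br0 ?scaler0 ?addr0.
have br0N : lie_class br0 m by case: m m0 => // k _ [].
pose phi z : W := subg Q (coset D (la z)).
have hQ z : coset D (la z) \in Q by apply: mem_quotient.
have phiS u v : phi (star m (lo_br N) u v) = star m br0 (phi u) (phi v).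
  rewrite (star_comm m0 br0P br0N) // /phi laM morphM ?nD //; exact: (subgM (hQ u) (hQ v)).
have [_ _ hb] := star_hom_lie m0 um (@natZ q) (lo_P N) (@lo_N _ _ N) br0P br0N phiS.
have inD : la (lo_br N x y) \in D.
  have := congr1 val (hb x y); rewrite /phi subgK // => e.
  by apply: coset_idr e; apply: nD.
apply: la_inj; rewrite la0 scaler_nat -laX.
have pe : (p.-elt (la (lo_br N x y)))%g by apply: mem_p_elt pG _.
by have := Mho_p_elt 1 inD pe; rewrite hM expn1 inE => /eqP.
Qed.

End LazardMho.

Definition is_lie_iso (R : nzRingType) (V W : lmodType R) (br : V -> V -> V)
    (br' : W -> W -> W) (phi : V -> W) :=
  [/\ bijective phi, linear phi & forall x y, phi (br x y) = br' (phi x) (phi y)].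

Lemma linearize_lie (R : finComNzRingType) (pi : R) (p M : nat) (V W : finLmodType R)
    (br : V -> V -> V) (br' : W -> W -> W) (k : V -> W) : chain_ring pi p M ->
  is_lie_bracket br' -> (forall x y, pi *: br x y = 0) -> (forall x y, pi *: br' x y = 0) ->
  quasi pi pi k -> (forall x y, k (br x y) = br' (k x) (k y)) ->
  exists phi, is_lie_iso br br' phi.
Proof.
move=> CR brP' s1 s2 qk kbr; have [g [lg bg gm gs]] := linearize CR qk.
exists g; split=> // x y; rewrite gs // kbr; have [z ->] := gm x; have [t ->] := gm y.
rewrite (lieDr brP') !(lieDl brP') !(lieZl brP') !(lieZr brP').
by rewrite !s2 !scaler0 !addr0.
Qed.

Section LazardFunctor.
Variables (q m : nat) (m0 : (0 < m)%N).
Variable um : invertible_upto 'Z_q m.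
Variables (N N' : lie_over 'Z_q m) (gT gT' : finGroupType).
Variables (G : {group gT}) (G' : {group gT'}).
Variables (la : lo_car N -> gT) (la' : lo_car N' -> gT').
Hypotheses (laP : lazard_iso G la) (laP' : lazard_iso G' la').

Lemma lie_iso_of_isog : (G \isog G')%g -> exists phi, is_lie_iso (lo_br N) (lo_br N') phi.
Proof.
have [la_inj laG la_surj laM] := laP; have [la_inj' laG' la_surj' laM'] := laP'.
case/isogP => h h_inj hG.
have ex x : exists y, la' y = h (la x).
  by apply: la_surj'; rewrite -hG mem_morphim.
have [phi hphi] := fin_all_exists ex.
have phi_inj : injective phi.
  move=> x y e; apply: la_inj; apply: (injmP h_inj) => //; by rewrite -!hphi e.
have phi_surj y : exists x, phi x = y.
  have : la' y \in (h @* G)%g by rewrite hG.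
  case/morphimP => g _ /la_surj [x <-] e; exists x; apply: la_inj'.
  by rewrite hphi e.
have phi_star x y : phi (star m (lo_br N) x y) = star m (lo_br N') (phi x) (phi y).
  by apply: la_inj'; rewrite laM' !hphi laM morphM.
have [D Z B] := star_hom_lie m0 um (@natZ q) (lo_P N) (@lo_N _ _ N) (lo_P N')
  (@lo_N _ _ N') phi_star.
exists phi; split=> //; last by move=> a x y; rewrite D Z.
have [psi hpsi] := fin_all_exists phi_surj.
by exists psi => // x; apply: phi_inj.
Qed.

Lemma isog_of_lie_iso : (exists phi, is_lie_iso (lo_br N) (lo_br N') phi) -> (G \isog G')%g.
Proof.
have [la_inj laG la_surj laM] := laP; have [la_inj' laG' la_surj' laM'] := laP'.
case=> phi [[psi phiK psiK] lphi bphi].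
pose li g : lo_car N := odflt 0 [pick x | la x == g].
have liK x : li (la x) = x.
  rewrite /li; case: pickP => [y /eqP /la_inj //|/(_ x)]; by rewrite eqxx.
pose h g := la' (phi (li g)).
have hM : {in G &, {morph h : x y / (x * y)%g}}.
  move=> _ _ /la_surj [x <-] /la_surj [y <-].
  by rewrite -laM /h !liK (star_morph m x y lphi bphi) laM'.
apply/isogP; exists (Morphism hM).
  apply/injmP => _ _ /la_surj [x <-] /la_surj [y <-] /=; rewrite /h !liK => /la_inj' e.
  by rewrite (can_inj phiK e).
rewrite morphimEdom; apply/setP => g; apply/imsetP/idP => [[x _ ->]|/la_surj' [y <-]].
  exact: laG'.
by exists (la (psi y)); rewrite ?laG //= /h liK psiK.
Qed.

End LazardFunctor.

Section Correspondence.
Variables (p n : nat).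
Hypotheses (pp : prime p) (np : (n <= p)%N).
Local Notation q := (p ^ n.-1.+1)%N.

Lemma pred_prime_gt0 : (0 < p.-1)%N.
Proof. by rewrite -ltnS prednK ?prime_gt1 ?prime_gt0. Qed.

Lemma invertible_Zq : invertible_upto 'Z_q p.-1.
Proof.
move=> k /andP [k0 kp]; rewrite unitZpE ?q_gt1 // coprimeXl // prime_coprime //.
by apply/negP => /dvdn_leq -/(_ k0); rewrite leqNgt -[p]prednK ?prime_gt0 ?ltnS ?kp.
Qed.

(** A relation suffices: by [lazard_rel_iso] any choice of N, [la] and [f] gives the same
    isomorphism classes, so representatives are chosen only at the end. *)
Definition lazard_rel (G : FinGrp) (L : FinLie p n) :=
  exists (N : lie_over 'Z_q p.-1) (la : lo_car N -> tag G) (f : lo_car N -> lie_car L),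
  [/\ lazard_iso (tagged G) la, quasi (p%:R : 'Z_q) (Tgen p n : truncR p n) f &
      forall x y, f (lo_br N x y) = lie_br L (f x) (f y)].

Lemma lie_of_grp G : good_grp p n G -> exists L, good_lie L /\ lazard_rel G L.
Proof.
case: G => gT G [/= cG mG]; have p0 := prime_gt0 pp.
have pG : (p.-group G)%g by rewrite /pgroup cG pnatX pnat_id.
(* The class of a p-group of order p ^ n is at most max(1, n - 1), hence at most p - 1. *)
have hG : ('L_p.-1.+1(G) = 1)%g.
  apply/(lcn_nil_classP _ (pgroup_nil pG)).
  apply: leq_trans (nil_class_pgroup pG) _; rewrite cG pfactorK // geq_max pred_prime_gt0.
  by rewrite -!subn1 leq_sub2r.
have hq x : x \in G -> (x ^+ q = 1)%g.
  move=> hx; apply/eqP; rewrite -order_dvdn; apply: dvdn_trans (order_dvdG hx) _.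
  by rewrite cG dvdn_exp2l // leqSpred.
have [N [la laP]] := lazard_of_group (q_gt1 n pp) pred_prime_gt0 invertible_Zq hG hq.
have soc := socle_of_mho (q_gt1 n pp) pred_prime_gt0 invertible_Zq laP pG mG.
have [W [f qf]] := quasi_to_trunc pp (lo_car N).
have [[g fg gf] _ _ _] := qf.
have brP := transport_lie (chain_trunc n pp) qf fg gf (lo_P N) soc.
exists (MkFinLie brP); split; last first.
  by exists N, la, f; split=> // x y; rewrite /= -transport_morph.
split.
- by exists p.-1; apply: (transport_class qf fg gf (@lo_N _ _ N)).
- rewrite /= -(bij_eq_card (Bijective fg gf)) -cG.
  have [la_inj laG la_surj _] := laP.
  rewrite -(card_imset _ la_inj); apply: eq_card => x.
  apply/imsetP/idP => [[y _ ->]|/la_surj [y <-]]; [exact: laG | by exists y].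
exact: (transport_soc g qf soc).
Qed.

Lemma grp_of_lie L : good_lie L -> exists G, good_grp p n G /\ lazard_rel G L.
Proof.
case=> nilL cL soc.
have [V [f qf]] := quasi_from_trunc pp (lie_car L).
have [[g fg gf] _ _ _] := qf; have qg := quasi_inv qf fg gf.
have brP := transport_lie (chain_Zq n pp) qg gf fg (lie_brP L) soc.
have cl := lie_class_bound (lie_brP L) pp cL nilL np.
pose N := LieOver brP (transport_class qg gf fg cl).
have m0 := pred_prime_gt0; have um := invertible_Zq.
pose gT := lgroup m0 um N; pose G := [set: gT]%G.
have laP : lazard_iso G (id : lo_car N -> gT).
  by split=> // [x|x _]; [rewrite inE | exists x].
have cG : #|G| = (p ^ n)%N by rewrite cardsT -cL -(bij_eq_card (Bijective fg gf)).
have pG : (p.-group G)%g by rewrite /pgroup cG pnatX pnat_id.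
exists (Tagged (fun T : finGroupType => {group T}) G); split.
  split=> //; apply: (mho_of_socle m0 um laP pG) => x y.
  exact: (transport_soc f qg soc).
exists N, id, f; split=> // x y; exact: gf.
Qed.

Lemma lazard_rel_socle (L : FinLie p n) (N : lie_over 'Z_q p.-1) (f : lo_car N -> lie_car L) :
  quasi (p%:R : 'Z_q) (Tgen p n : truncR p n) f ->
  (forall x y, f (lo_br N x y) = lie_br L (f x) (f y)) ->
  (forall x y, Tgen p n *: lie_br L x y = 0) -> forall x y, p%:R *: lo_br N x y = 0.
Proof.
move=> qf fbr soc x y; have [[g fg _] f1 _ _] := qf; apply: (can_inj fg).
by rewrite f1 fbr soc (quasi0 qf).
Qed.

(** An isomorphism on one side, composed with the comparison maps, gives on the other side a
    bracket-preserving bijection that is only [quasi], but over a single ring; [linearize_lie] turns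
    it into an isomorphism. *)
Lemma lazard_rel_iso G H L K : lazard_rel G L -> lazard_rel H K ->
  (forall x y, Tgen p n *: lie_br L x y = 0) -> (forall x y, Tgen p n *: lie_br K x y = 0) ->
  grp_iso G H <-> lie_iso L K.
Proof.
move=> [N [la [f [laP qf fbr]]]] [N' [la' [f' [laP' qf' fbr']]]] sL sK.
have [[g fg gf] _ _ _] := qf; have [[g' fg' gf'] _ _ _] := qf'.
have qg := quasi_inv qf fg gf; have qg' := quasi_inv qf' fg' gf'.
have gbr x y : g (lie_br L x y) = lo_br N (g x) (g y).
  by apply: (can_inj fg); rewrite fbr !gf.
have gbr' x y : g' (lie_br K x y) = lo_br N' (g' x) (g' y).
  by apply: (can_inj fg'); rewrite fbr' !gf'.
have m0 := pred_prime_gt0; have um := invertible_Zq.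
split.
  move=> iso; have [phi [bphi lphi brphi]] := lie_iso_of_isog m0 um laP laP' iso.
  have qphi := quasi_linear_iso (p%:R : 'Z_q) lphi bphi.
  have qk := quasi_comp (quasi_comp qg qphi) qf'.
  have [|psi [b1 l1 br1]] := linearize_lie (chain_trunc n pp) (lie_brP K) sL sK qk.
    by move=> x y; rewrite /= gbr brphi fbr'.
  by exists psi; split.
case=> psi [bpsi lpsi brpsi].
have qpsi := quasi_linear_iso (Tgen p n : truncR p n) lpsi bpsi.
have qk := quasi_comp (quasi_comp qf qpsi) qg'.
apply: (isog_of_lie_iso laP laP').
apply: (linearize_lie (chain_Zq n pp) (lo_P N')) qk _.
- exact: lazard_rel_socle qf fbr sL.
- exact: lazard_rel_socle qf' fbr' sK.
by move=> x y; rewrite /= fbr brpsi gbr'.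
Qed.

Lemma lie_iso_refl (L : FinLie p n) : lie_iso L L.
Proof. by exists id; split=> //; exists id. Qed.

(** The correspondence must be a total function; this supplies its value at groups that are not
    good. *)
Lemma zero_lie : exists L : FinLie p n, True.
Proof.
have [V [_ _]] := quasi_to_trunc (n := n) pp (('Z_q)^o).
have brP : is_lie_bracket (fun _ _ : V => 0).
  by split=> *; rewrite ?scaler0 ?addr0.
by exists (MkFinLie brP).
Qed.

End Correspondence.

Theorem theorem1p1 (n p : nat) : prime p -> (n <= p)%N -> iso_class_bijection p n.
Proof.
move=> pp np.
have exL G : exists L : FinLie p n, good_grp p n G -> good_lie L /\ lazard_rel G L.
  have [L0 _] := zero_lie n pp.
  case: (classic (good_grp p n G)) => hG; last by exists L0.
  by have [L hL] := lie_of_grp pp np hG; exists L.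
have exG (L : FinLie p n) : exists G, good_lie L -> good_grp p n G /\ lazard_rel G L.
  case: (classic (good_lie L)) => hL.
    by have [G hG] := grp_of_lie pp np hL; exists G.
  by exists (Tagged (fun T : finGroupType => {group T}) [set: {perm 'I_0}]%G).
pose Phi G := proj1_sig (constructive_indefinite_description _ (exL G)).
pose Psi L := proj1_sig (constructive_indefinite_description _ (exG L)).
have PhiP G : good_grp p n G -> good_lie (Phi G) /\ lazard_rel G (Phi G).
  exact: (proj2_sig (constructive_indefinite_description _ (exL G))).
have PsiP (L : FinLie p n) : good_lie L -> good_grp p n (Psi L) /\ lazard_rel (Psi L) L.
  exact: (proj2_sig (constructive_indefinite_description _ (exG L))).
have relI G H (L K : FinLie p n) : lazard_rel G L -> lazard_rel H K -> good_lie L -> good_lie K ->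
    grp_iso G H <-> lie_iso L K.
  by move=> r1 r2 [_ _ s1] [_ _ s2]; exact: (lazard_rel_iso pp r1 r2).
exists Phi, Psi; split.
- by split=> [G /PhiP []|L /PsiP []].
- by move=> G H /PhiP [gG rG] /PhiP [gH rH]; apply: relI.
- by move=> L K hL hK; have [_ rL] := PsiP L hL; have [_ rK] := PsiP K hK; apply: iff_sym; apply: relI.
- move=> G /PhiP [gL rG]; have [_ rL] := PsiP _ gL.
  by apply/(relI _ _ _ _ rL rG gL gL); apply: lie_iso_refl.
move=> L hL; have [gG rL] := PsiP L hL; have [gL' rG] := PhiP _ gG.
by apply/(relI _ _ _ _ rG rL gL' hL); apply: isog_refl.
Qed.
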